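(* There exist nonnegative integers $r$ and $d$ such that the function $\Gamma \mapsto \dim W^r_d(\Gamma)$ is not upper semicontinuous on the moduli space $M_4^{\mathrm{met}}$ of metric graphs of genus $4$. (A function $f$ on a topological space is upper semicontinuous if $\{x : f(x) < c\}$ is open for every real number $c$.)
   Context: Metric graphs. A metric graph is a compact connected metric space obtained from a finite connected graph (loops and multiple edges allowed) by assigning a positive real length to each edge. Its genus $g$ is its first Betti number. Divisors. A divisor on a metric graph $\Gamma$ is a finite $\mathbb{Z}$-linear combination of points of $\Gamma$; its degree is the sum of its coefficients; it is effective if all its coefficients are nonnegative. For a continuous piecewise linear function $f$ on $\Gamma$ with integer slopes, $\mathrm{div}(f) = \sum_{v \in \Gamma} \mathrm{ord}_v(f)\, v$, where $\mathrm{ord}_v(f)$ is the sum of the incoming slopes of $f$ at $v$; such divisors are called principal. Two divisors are equivalent if their difference is principal. $\mathrm{Pic}_d(\Gamma)$ is the set of equivalence classes of divisors of degree $d$. Rank. The rank $r(D)$ of a divisor $D$ is $-1$ if $D$ is not equivalent to an effective divisor, and otherwise is the largest integer $r$ such that for every effective divisor $E$ of degree $r$ on $\Gamma$ there is a divisor $D'$ equivalent to $D$ with $D' - E$ effective. The rank depends only on the class $[D]$. Brill-Noether locus. For nonnegative integers $r,d$, $W^r_d(\Gamma) \subset \mathrm{Pic}_d(\Gamma)$ is the set of divisor classes of degree $d$ and rank at least $r$. Polyhedral structure and dimension. Let $\Omega^*(\Gamma)$ be the dual of the real vector space of harmonic 1-forms on $\Gamma$ (assignments of a real slope to each edge, relative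 to an orientation, such that the sum of incoming slopes is zero at every vertex); $H_1(\Gamma,\mathbb{Z})$ embeds in it as a lattice by integrating 1-forms along 1-cycles. Fix a basepoint $w \in \Gamma$. There is a group isomorphism $\mathrm{Pic}_0(\Gamma) \cong \Omega^*(\Gamma)/H_1(\Gamma,\mathbb{Z})$ sending $[v-w]$ to integration along any path from $w$ to $v$ and, combined with the bijection $\mathrm{Pic}_d(\Gamma) \to \mathrm{Pic}_0(\Gamma)$, $[D] \mapsto [D - dw]$, this gives a universal covering map $\Omega^*(\Gamma) \to \mathrm{Pic}_d(\Gamma)$. A subset of $\mathrm{Pic}_d(\Gamma)$ is polyhedral if it is the image of a finite union of polytopes in $\Omega^*(\Gamma)$ (this is independent of $w$); its dimension is the maximum of the dimensions of these polytopes. The set $W^r_d(\Gamma)$ is polyhedral, and $\dim W^r_d(\Gamma)$ is its dimension ($-\infty$ if empty). Moduli space. For a finite connected graph $G$ of genus $4$ all of whose vertices have valence at least $3$ (a loop counts twice), with edges $e_1, \dots, e_n$, let $\sigma^*_G \subset \mathbb{R}_{\geq 0}^n$ be the set of $\ell = (\ell_1,\dots,\ell_n)$ such that the edges $e_i$ with $\ell_i = 0$ contain no cycle, with the subspace topology. To $\ell \in \sigma^*_G$ is associated the metric graph $\Gamma_\ell$ of genus $4$ obtained by giving $e_i$ length $\ell_i$, edges of length $0$ being contracted. The moduli space $M_4^{\mathrm{met}}$ is the set of isometry classes of all such metric graphs $\Gamma_\ell$, with the finest topology for which all the maps $\sigma^*_G \to M_4^{\mathrm{met}}$, $\ell \mapsto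 [\Gamma_\ell]$, are continuous (i.e. the colimit of the cones $\sigma^*_G$). *)

(* Defs.v *)
From HB Require Import structures.
From mathcomp Require Import all_boot all_order all_algebra.
From mathcomp Require Import all_classical all_reals all_analysis.
From mathcomp.multinomials Require Import freeg.

Set Implicit Arguments.
Unset Strict Implicit.
Unset Printing Implicit Defensive.

Import Order.TTheory GRing.Theory Num.Theory.
Import numFieldNormedType.Exports.

Local Open Scope classical_set_scope.
Local Open Scope quotient_scope.
Local Open Scope ring_scope.

(* Every edge carries an arbitrary orientation, from src to tgt. *)
Record graph := Graph {
  vert : finType;
  edge : finType;
  src : edge -> vert;
  tgt : edge -> vert }.

Section Graphs.
Variable G : graph.

Definition joins (e : edge G) (u v : vert G) : bool :=
  (src e == u) && (tgt e == v) || (src e == v) && (tgt e == u).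

Definition adjacent : rel (vert G) := fun u v => [exists e, joins e u v].

Definition connected_graph : bool :=
  (0 < #|vert G|)%N && [forall u, forall v, connect adjacent u v].

Definition valence (v : vert G) : nat :=
  (#|[pred e | src e == v]| + #|[pred e | tgt e == v]|)%N.

(* (e, false) is e run through from src e to tgt e, (e, true) is the reverse. *)
Definition dart_src (a : edge G * bool) : vert G :=
  if a.2 then tgt a.1 else src a.1.
Definition dart_tgt (a : edge G * bool) : vert G :=
  if a.2 then src a.1 else tgt a.1.

(* A loop gives a cycle of length 1, two parallel edges one of length 2. *)
Definition is_cycle (p : seq (edge G * bool)) : bool :=
  [&& p != [::],
      cycle (fun a b => dart_tgt a == dart_src b) p,
      uniq [seq a.1 | a <- p] &
      uniq [seq dart_src a | a <- p]].

(* The coefficient at v of the simplicial boundary of the 1-chain c; also the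
   sum of the incoming slopes at v of the assignment of slopes c. *)
Definition incoming (A : zmodType) (c : edge G -> A) (v : vert G) : A :=
  \sum_(e | tgt e == v) c e - \sum_(e | src e == v) c e.

Section CycleSpace.
Variable F : fieldType.

Definition boundary (c : {ffun edge G -> F^o}) : {ffun vert G -> F^o} :=
  [ffun v => incoming c v].

Fact boundary_linear : linear boundary.
Proof.
move=> a c c'; apply/ffunP => v; rewrite !ffunE /incoming.
under eq_bigr do rewrite !ffunE.
under [X in _ - X = _]eq_bigr do rewrite !ffunE.
rewrite !big_split /= -!scaler_sumr scalerBr opprD !addrA; congr (_ + _).
by rewrite -!addrA; congr (_ + _); rewrite addrC.
Qed.
HB.instance Definition _ := GRing.isLinear.Build F
  {ffun edge G -> F^o} {ffun vert G -> F^o} _ boundary boundary_linear.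

Definition cycle_space : {vspace {ffun edge G -> F^o}} :=
  lker (linfun boundary).

Fact cycle_spaceP (c : {ffun edge G -> F^o}) :
  reflect (forall v, incoming c v = 0) (c \in cycle_space).
Proof.
rewrite memv_ker lfunE /=; apply: (iffP eqP) => [h v|h].
  by move/ffunP: h => /(_ v); rewrite !ffunE.
by apply/ffunP => v; rewrite !ffunE h.
Qed.

End CycleSpace.

Definition betti1 : nat := \dim (cycle_space rat).

End Graphs.

Record metric_graph (R : realType) := MetricGraph {
  model :> graph;
  model_connected : connected_graph model;
  len : edge model -> R;
  len_gt0 : forall e, 0 < len e }.

Section MetricGraphs.
Variables (R : realType) (Gam : metric_graph R).
Local Notation E := (edge Gam).
Local Notation V := (vert Gam).

(* A point is a vertex, or a pair (e, t) in the interior of the edge e at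
   distance t from its source. *)
Definition pt : Type := (V + {p : E * R | (0 < p.2 < len p.1)%R})%type.
HB.instance Definition _ := Choice.on pt.

(* The point at distance t from the source of e, for 0 <= t <= len e. *)
Definition at_ (e : E) (t : R) : pt :=
  match insub (e, t) with
  | Some p => inr p
  | None => inl (if t <= 0 then src e else tgt e)
  end.

(* A path is a sequence of steps ((e, s), t), each going along the edge e from
   position s to position t. *)
Fixpoint is_path (x : pt) (p : seq (E * R * R)) (y : pt) : Prop :=
  match p with
  | [::] => x = y
  | (e, s, t) :: p' =>
      [/\ 0 <= s <= len e, 0 <= t <= len e, x = at_ e s & is_path (at_ e t) p' y]
  end.

Definition path_len (p : seq (E * R * R)) : R :=
  \sum_(a <- p) `|a.2 - a.1.2|.

Definition dist (x y : pt) : R :=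
  inf [set path_len p | p in [set p | is_path x p y]].

Definition PL_int (L : R) (g : R -> R) : Prop :=
  exists s : seq R,
    [/\ path <%R 0 s, last 0 s = L &
      forall i, (i < size s)%N -> exists m : int,
        let a := nth 0 (0 :: s) i in let b := nth 0 (0 :: s) i.+1 in
        forall t, a <= t <= b -> g t = g a + m%:~R * (t - a)].

(* Being continuous on Gam amounts to being continuous on every closed edge. *)
Definition rational_fun (f : pt -> R) : Prop :=
  forall e, PL_int (len e) (fun t => f (at_ e t)).

Definition slope_fwd (f : pt -> R) (e : E) (t : R) : R :=
  lim (h^-1 * (f (at_ e (t + h)) - f (at_ e t)) @[h --> 0^'+]).
Definition slope_bwd (f : pt -> R) (e : E) (t : R) : R :=
  lim (h^-1 * (f (at_ e (t - h)) - f (at_ e t)) @[h --> 0^'+]).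

(* slope_fwd and slope_bwd are slopes in the directions leaving the point, so
   the incoming slopes are their opposites. *)
Definition ord_ (f : pt -> R) (x : pt) : R :=
  match x with
  | inl v => \sum_(e | src e == v) - slope_fwd f e 0
             + \sum_(e | tgt e == v) - slope_bwd f e (len e)
  | inr p => - slope_fwd f (val p).1 (val p).2 - slope_bwd f (val p).1 (val p).2
  end.

Definition divisor : Type := {freeg pt / int}.
HB.instance Definition _ := GRing.Zmodule.on divisor.

Definition effective (D : divisor) : Prop := forall x, 0 <= coeff x D.

Definition principal (D : divisor) : Prop :=
  exists2 f, rational_fun f & forall x, (coeff x D)%:~R = ord_ f x.

Definition lin_equiv (D D' : divisor) : Prop := principal (D - D').

Definition div_class (D : divisor) : set divisor := [set D' | lin_equiv D D'].

Definition rank_test (D : divisor) (n : nat) : Prop :=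
  forall F : divisor, effective F -> deg F = n%:Z ->
    exists2 D', lin_equiv D D' & effective (D' - F).

Definition div_rank (D : divisor) : int :=
  if `[< exists2 D', lin_equiv D D' & effective D' >]
  then (xget 0%N [set n | rank_test D n /\
                          forall m, rank_test D m -> (m <= n)%N])%:Z
  else -1.

(* Subsets of Pic_d are sets of equivalence classes of divisors. *)
Definition BN_locus (r d : nat) : set (set divisor) :=
  [set div_class D | D in [set D | deg D = d%:Z /\ r%:Z <= div_rank D]].

(* A harmonic 1-form is an assignment of slopes with the same defining
   equations as a real 1-cycle. *)
Definition harmonic : {vspace {ffun E -> R^o}} := cycle_space Gam R.

Definition harmonic_dual : vectType R := 'Hom(subvs_of harmonic, R^o).

Definition path_int (p : seq (E * R * R)) (w : {ffun E -> R^o}) : R :=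
  \sum_(a <- p) (a.2 - a.1.2) * w a.1.1.

Definition chain_int (c : E -> int) (w : {ffun E -> R^o}) : R :=
  \sum_e (c e)%:~R * len e * w e.

(* [D - (deg D) w0] in Pic_0 corresponds to phi modulo H_1(Gam, Z), where w0 is
   the basepoint: phi is the sum over x of (coeff x D) times the integral
   along a path from w0 to x, up to integration along an integral 1-cycle c. *)
Definition lifts (w0 : pt) (phi : harmonic_dual) (D : divisor) : Prop :=
  exists (gam : pt -> seq (E * R * R)) (c : E -> int),
    [/\ forall x, is_path w0 (gam x) x,
        forall v, incoming c v = 0 &
        forall w : subvs_of harmonic,
          phi w = \sum_(x <- dom D) (coeff x D)%:~R * path_int (gam x) (vsval w)
                  + chain_int c (vsval w)].

Definition cover_image (w0 : pt) (d : nat) (A : set harmonic_dual) :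
    set (set divisor) :=
  [set div_class D | D in
     [set D | deg D = d%:Z /\ exists2 phi, A phi & lifts w0 phi D]].

(* The polytope with vertices (or redundant generators) s. *)
Definition conv_hull (W : vectType R) (s : seq W) : set W :=
  [set x | exists a : 'I_(size s) -> R,
     [/\ forall i, 0 <= a i, \sum_i a i = 1 &
         x = \sum_(i < size s) a i *: s`_i]].

Definition polytope_dim (W : vectType R) (s : seq W) : \bar R :=
  if s is x0 :: _ then (\dim <<[seq x - x0 | x <- s]>>%VS)%:R%:E else -oo%E.

Definition union_polytopes (W : vectType R) (ps : seq (seq W)) : set W :=
  \bigcup_(s in [set` ps]) conv_hull s.

Definition polyhedral_of_dim (d : nat) (S : set (set divisor)) (n : \bar R) :
    Prop :=
  exists (w0 : pt) (ps : seq (seq harmonic_dual)),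
    S = cover_image w0 d (union_polytopes ps) /\
    n = \big[maxe/-oo%E]_(s <- ps) polytope_dim s.

(* The dimension of a polyhedral subset of Pic_d does not depend on the
   polytopes; the value +oo is for subsets that are not polyhedral. *)
Definition pic_dim (d : nat) (S : set (set divisor)) : \bar R :=
  xget +oo%E [set n | polyhedral_of_dim d S n].

Definition dim_BN (r d : nat) : \bar R := pic_dim d (BN_locus r d).

End MetricGraphs.

Definition isometric (R : realType) (Gam Gam' : metric_graph R) : Prop :=
  exists2 f : pt Gam -> pt Gam', bijective f &
    forall x y, dist (f x) (f y) = dist x y.

Section Contraction.
Variables (R : realType) (G : graph) (l : edge G -> R).

Definition null_adjacent : rel (vert G) :=
  fun u v => [exists e, (l e == 0) && joins e u v].

Fact null_connect_sym : connect_sym null_adjacent.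
Proof.
apply: sym_connect_sym => u v; apply: eq_existsb => e.
by rewrite /joins orbC.
Qed.

(* The edges of length 0 are contracted: a vertex of the result is a connected
   component of the graph of null edges, given by its canonical root. *)
Definition cvert : finType := {v : vert G | v \in roots null_adjacent}.

Definition cproj (v : vert G) : cvert :=
  Sub (fingraph.root null_adjacent v) (roots_root null_connect_sym v).

Definition cedge : finType := {e : edge G | 0 < l e}.

Definition contract : graph :=
  @Graph cvert cedge (fun e => cproj (src (val e))) (fun e => cproj (tgt (val e))).

Fact contract_connected :
  connected_graph G -> (forall e, 0 <= l e) -> connected_graph contract.
Proof.
case/andP => /card_gt0P [v0 _] /forallP conG l0; apply/andP; split.
  by apply/card_gt0P; exists (cproj v0).
have projK (u : cvert) : cproj (val u) = u.
  by apply: val_inj => /=; apply/eqP; exact: (valP u).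
have step u v : adjacent u v ->
    connect (@adjacent contract) (cproj u) (cproj v).
  case/existsP => e euv; have [le0|le0] := eqVneq (l e) 0.
    suff -> : cproj u = cproj v by exact: connect0.
    apply: val_inj => /=; apply/(fingraph.rootP null_connect_sym)/connect1.
    by apply/existsP; exists e; rewrite le0 eqxx.
  have le_gt0 : 0 < l e by rewrite lt_neqAle eq_sym le0 l0.
  apply/connect1/existsP; exists (Sub e le_gt0 : cedge).
  by case/orP: euv => /andP[/eqP<- /eqP<-]; rewrite /joins /= ?SubK !eqxx ?orbT.
apply/forallP => u; apply/forallP => v; rewrite -(projK u) -(projK v).
move/(_ (val u))/forallP/(_ (val v)): conG => /connectP[p].
elim: p (val u) => [|x p IHp] y /=; first by move=> _ ->; exact: connect0.
case/andP => yx xp vE; apply: connect_trans (step _ _ yx) _.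
exact: IHp.
Qed.

End Contraction.

(* Every finite graph is isomorphic to one with vertices 'I_n and edges 'I_m. *)
Definition comb_graph : Type :=
  {nm : nat * nat & {ffun 'I_nm.2 -> 'I_nm.1 * 'I_nm.1}}.
HB.instance Definition _ := Choice.on comb_graph.

Definition ecount (G : comb_graph) : nat := (tag G).2.

Definition graph_of (G : comb_graph) : graph :=
  @Graph 'I_((tag G).1) 'I_(ecount G)
    (fun e => (tagged G e).1) (fun e => (tagged G e).2).

Definition stable_genus4 (G : graph) : bool :=
  [&& connected_graph G, betti1 G == 4%N & [forall v : vert G, (3 <= valence v)%N]].

Definition genus4_graph : Type := {G : comb_graph | stable_genus4 (graph_of G)}.
HB.instance Definition _ := Choice.on genus4_graph.

Section Moduli.
Variable R : realType.

Definition cone (G : genus4_graph) : set 'rV[R]_(ecount (val G)) :=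
  [set l | (forall e, 0 <= l ord0 e) /\
     forall p : seq (edge (graph_of (val G)) * bool),
       is_cycle p -> ~ {in p, forall a, l ord0 a.1 = 0}].
Arguments cone : clear implicits.

Definition lengths (G : genus4_graph) (l : cone G) :
    edge (graph_of (val G)) -> R := fun e => (set_val l) ord0 e.

Fact lengths_ge0 (G : genus4_graph) (l : cone G) e : 0 <= lengths l e.
Proof. by case: (set_valP l) => l0 _; exact: l0. Qed.

Fact contract_lengths_connected (G : genus4_graph) (l : cone G) :
  connected_graph (contract (lengths l)).
Proof.
apply: contract_connected; last exact: lengths_ge0.
by case/and3P: (valP G).
Qed.

Definition Gamma (G : genus4_graph) (l : cone G) : metric_graph R :=
  @MetricGraph R (contract (lengths l)) (contract_lengths_connected l)
    (fun e => lengths l (val e)) (fun e => valP e).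

Definition cones : Type := {G : genus4_graph & cone G}.
HB.instance Definition _ := Topological.on cones.

Definition Gamma_of (x : cones) : metric_graph R := Gamma (tagged x).

Definition isometric_rel : rel cones :=
  fun x y => `[< isometric (Gamma_of x) (Gamma_of y) >].

Fact isometric_equiv : equiv_class_of isometric_rel.
Proof.
split=> [x|x y|y x z].
- by apply/asboolP; exists id => //; exists id.
- apply: asbool_equiv_eq; split=> -[f [g fK gK] fd]; exists g; try by exists f.
  + by move=> u v; rewrite -fd !gK.
  + by move=> u v; rewrite -fd !gK.
- move=> /asboolP[f bf fd] /asboolP[g bg gd]; apply/asboolP.
  exists (g \o f); first exact: bij_comp.
  by move=> u v /=; rewrite gd fd.
Qed.

Canonical isometric_equiv_rel := EquivRelPack isometric_equiv.

(* The topology on the disjoint union of the cones, each with its subspace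
   topology, descends to the quotient topology: it is the finest one for which
   the maps from the cones are continuous. *)
Definition M4met : Type := quotient_topology {eq_quot isometric_equiv_rel}.
HB.instance Definition _ := Topological.on M4met.

(* dim_BN is invariant under isometry, hence independent of the choice of a
   representative of the isometry class. *)
Definition dim_BN_M4 (r d : nat) (x : M4met) : \bar R :=
  dim_BN (Gamma_of (repr x)) r d.

End Moduli.
Arguments cone : clear implicits.

Definition upper_semicontinuous (R : realType) (T : topologicalType)
    (f : T -> \bar R) : Prop :=
  forall c : R, open [set x | (f x < c%:E)%E].

(* Main.v *)
(* Let r = 1 and d = 3.  On the loop of three loops, whose bridges have length
   t > 0, consider the divisors with one chip at a distance x_i in [0, t] from
   the start of each bridge.  Chips on two different bridges can move by the same
   amount in opposite directions across a loop, so the class depends only on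
   x_1 + x_2 + x_3; two chips that have reached the two ends of a loop can run
   through any of its edges symmetrically.  Hence every class with sum in
   [t, 2 t] has rank at least 1, and W^1_3 contains a segment.  At t = 0 the graph
   becomes a doubled triangle, in which every cut has at least 4 edges.  If
   D - D' = div f with D of degree 3 and D, D' effective, then f is constant on
   the vertices, since the set of vertices where f is maximal has a cut of at
   most 3 edges.  So no chip of D can reach a new vertex unless two chips lie
   inside the same edge, and W^1_3 is reduced to the class of v_1 + v_2 + v_3.

   By the Abel-Jacobi theorem and the discreteness of H_1(Gam, Z), a polyhedral
   set of divisor classes has positive dimension if and only if it is infinite.
   A point of the moduli space is represented by an arbitrary metric graph of
   its isometry class, so one needs that an isometry preserves rational
   functions and their divisors: the germs of edges at a point are recovered
   from the small spheres around it. *)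
Require Import Defs.
From HB Require Import structures.
From mathcomp Require Import all_boot all_order all_algebra.
From mathcomp Require Import all_classical all_reals all_analysis.
From mathcomp.multinomials Require Import freeg.
From mathcomp Require Import zify ring lra.

Set Implicit Arguments.
Unset Strict Implicit.
Unset Printing Implicit Defensive.

Import Order.TTheory GRing.Theory Num.Theory.
Import numFieldNormedType.Exports.

Local Open Scope classical_set_scope.
Local Open Scope ring_scope.

(** * Sums over divisors *)

(** Functions on the graph are eliminated early: [principalP] replaces them by vertex values and
    integer slopes subject to one linear equation per edge. A divisor is then principal if and only
    if it bounds an integral 1-chain, made of full edges and of segments, along which every harmonic
    form integrates to 0 ([principal_lift]). Explicit equivalences become sums of moves of one chip
    along one edge, checked on harmonic forms; inequivalence becomes discreteness of the periods.
    The definitions give slopes by breakpoint lists and limits; one-sided germs take their place,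
    and these also pass through isometries. The dimension is only ever compared with 1. [pic_dim]
    picks the value of an arbitrary polyhedral presentation, and +oo when there is none. So at t = 0
    a presentation has to be exhibited and every presentation bounded, while for t > 0 it is enough
    to refute presentations all of whose polytopes are points. *)

Section DivisorSums.
Variables (K : choiceType) (V : zmodType).
Implicit Types (u : K -> V) (D : {freeg K / int}).

(** The additive extension of [u] from points to divisors. The values lie in any abelian group, so
    that degrees, counts of chips on an edge, positions along it and pushforwards of divisors are
    all instances. *)
Definition dsum u D : V := \sum_(x <- dom D) u x *~ coeff x D.

Lemma dsum_sub (s : seq K) u D : uniq s -> {subset dom D <= s} ->
  dsum u D = \sum_(x <- s) u x *~ coeff x D.
Proof.
move=> us sub; rewrite [RHS](bigID (mem (dom D))) /= [X in _ + X]big1 ?addr0.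
  rewrite -[RHS]big_filter; apply: perm_big; apply: uniq_perm.
  - exact: uniq_dom.
  - exact: filter_uniq.
  - by move=> x; rewrite mem_filter; case: (boolP (x \in dom D)) => // /sub ->.
by move=> x xD; rewrite coeff_outdom // mulr0z.
Qed.

Lemma dsumD u D1 D2 : dsum u (D1 + D2) = dsum u D1 + dsum u D2.
Proof.
pose s := undup (dom D1 ++ dom D2).
have us : uniq s by exact: undup_uniq.
rewrite !(@dsum_sub s) //.
- by rewrite -big_split /=; apply: eq_bigr => x _; rewrite coeffD mulrzDr.
- by move=> x xD; rewrite mem_undup mem_cat xD orbT.
- by move=> x xD; rewrite mem_undup mem_cat xD.
- by move=> x xD; rewrite mem_undup; exact: domD_subset.
Qed.

Lemma dsum0 u : dsum u 0 = 0.
Proof. by rewrite /dsum dom0 big_nil. Qed.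

Lemma dsumN u D : dsum u (- D) = - dsum u D.
Proof. by apply/eqP; rewrite -addr_eq0 -dsumD addNr dsum0. Qed.

Lemma dsumB u D1 D2 : dsum u (D1 - D2) = dsum u D1 - dsum u D2.
Proof. by rewrite dsumD dsumN. Qed.

Lemma dsumU u k x : dsum u << k *g x >> = u x *~ k.
Proof.
rewrite (@dsum_sub [:: x]) ?big_seq1 ?coeffU ?eqxx ?mulr1 //.
move=> y; rewrite mem_dom coeffU inE (eq_sym y).
by case: (x == y); rewrite ?mulr0 ?eqxx.
Qed.

Lemma dsum1 u x : dsum u << x >> = u x.
Proof. by rewrite dsumU. Qed.

Lemma eq_dsum u u' D : u =1 u' -> dsum u D = dsum u' D.
Proof. by move=> uu; apply: eq_bigr => x _; rewrite uu. Qed.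

Lemma dsum_fctD u u' D : dsum (fun x => u x + u' x) D = dsum u D + dsum u' D.
Proof. by rewrite -big_split; apply: eq_bigr => x _; rewrite mulrzDl. Qed.

Lemma dsum_fctN u D : dsum (fun x => - u x) D = - dsum u D.
Proof. by rewrite -sumrN; apply: eq_bigr => x _; rewrite mulNrz. Qed.

Lemma dsum_fct_sum (I : Type) (r : seq I) (P : pred I) (u : I -> K -> V) D :
  dsum (fun x => \sum_(i <- r | P i) u i x) D = \sum_(i <- r | P i) dsum (u i) D.
Proof.
rewrite /dsum exchange_big /=; apply: eq_bigr => x _.
by rewrite -mulrz_suml.
Qed.

Lemma dsum_fct0 D : dsum (fun=> 0) D = 0.
Proof. by rewrite /dsum big1 // => x _; rewrite mul0rz. Qed.

End DivisorSums.

Section DivisorSumsRing.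
Variables (K : choiceType) (F : pzRingType).
Implicit Types (D : {freeg K / int}).

Lemma dsumMr (u : K -> F) a D : dsum (fun x => u x * a) D = dsum u D * a.
Proof. by rewrite mulr_suml; apply: eq_bigr => x _; rewrite mulrzAl. Qed.

Lemma dsum_intr (u : K -> int) D : (dsum u D)%:~R = dsum (fun x => (u x)%:~R : F) D.
Proof.
rewrite /dsum (big_morph _ (@intrD F) (erefl _)).
by apply: eq_bigr => x _; rewrite mulrzz intrM mulrzr.
Qed.

Lemma dsum_natr (u : K -> nat) D :
  (dsum (fun x => (u x)%:R : int) D)%:~R = dsum (fun x => (u x)%:R : F) D.
Proof. by rewrite dsum_intr; apply: eq_dsum => x; rewrite natz -pmulrn. Qed.

End DivisorSumsRing.

Lemma coeff_dsum (K : choiceType) x (D : {freeg K / int}) :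
  coeff x D = dsum (fun y => (y == x)%:R : int) D.
Proof.
case: (boolP (x \in dom D)) => xD.
  rewrite /dsum (bigD1_seq x) ?uniq_dom //= eqxx big1 ?addr0 ?intz //.
  by move=> y /negPf ->; rewrite mul0rz.
rewrite coeff_outdom // /dsum big1_seq // => y /andP[_ yD].
by case: eqP xD yD => [->|_]; rewrite ?mul0rz // => /negPf ->.
Qed.

Lemma deg_dsum (K : choiceType) (D : {freeg K / int}) :
  deg D = dsum (fun=> 1 : int) D.
Proof.
rewrite -{1}(freeg_sumE D) raddf_sum /dsum /=; apply: eq_bigr => x _.
by rewrite degU intz.
Qed.

(** * Piecewise linear functions on an interval *)

Section RealInduction.
Variable R : realType.
Implicit Types (u : R -> R) (L : R).

(** Compactness of [0, L] as real induction: let c be the supremum of the t such that [P] holds on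
    [0, t]. Closure from the left gives [P c], and progress to the right contradicts c < L. *)
Lemma real_ind L (P : R -> Prop) : 0 <= L -> P 0 ->
  (forall c : R, 0 <= c < L -> P c ->
     exists2 e : R, 0 < e & forall t : R, c < t < c + e -> P t) ->
  (forall c : R, 0 < c <= L -> (forall t : R, 0 <= t < c -> P t) -> P c) ->
  P L.
Proof.
move=> L0 P0 Pr Pl.
pose S := [set t : R | 0 <= t <= L /\ forall s : R, 0 <= s <= t -> P s].
have S0 : S 0.
  split; first by rewrite lexx.
  by move=> s /andP[s0 s1]; have -> : s = 0 by apply/eqP; rewrite eq_le s0 s1.
have Sub : ubound S L by move=> t [/andP[]].
have supS : has_sup S by split; [exists 0|exists L].
set c := sup S.
have c0 : 0 <= c by apply: ub_le_sup => //; exists L.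
have cL : c <= L by apply: ge_sup => //; exists 0.
have Pc' (t : R) : 0 <= t < c -> P t.
  move=> /andP[t0 tc]; have [] := @sup_adherent _ S (c - t) _ supS.
    by rewrite subr_gt0.
  move=> s [_ Ps]; rewrite -/c subKr => ts; apply: Ps; rewrite t0; exact: ltW.
have Pc : P c.
  move: c0; rewrite le_eqVlt => /orP[/eqP <- //|c0]; apply: Pl => //.
  by rewrite c0.
have Pc2 (t : R) : 0 <= t <= c -> P t.
  move=> /andP[t0]; rewrite le_eqVlt => /orP[/eqP-> //|tc].
  by apply: Pc'; rewrite t0.
move: cL; rewrite le_eqVlt => /orP[/eqP <- //|cL].
have [|e e0 Pe] := Pr c _ Pc; first by rewrite c0.
pose d := Num.min (c + e / 2) L.
have dc : c < d by rewrite lt_min cL andbT; lra.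
have de : d <= c + e / 2 by rewrite ge_min lexx.
have dL : d <= L by rewrite ge_min lexx orbT.
have : S d.
  split; first by rewrite dL andbT; lra.
  move=> t /andP[t0 td]; case: (leP t c) => tc; first by apply: Pc2; rewrite t0.
  by apply: Pe; rewrite tc; lra.
by move=> /(ub_le_sup (ex_intro _ L Sub)); rewrite -/c leNgt dc.
Qed.

Definition rslope u (t m : R) :=
  exists2 e : R, 0 < e & forall h : R, 0 <= h < e -> u (t + h) = u t + m * h.
Definition lslope u (t m : R) :=
  exists2 e : R, 0 < e & forall h : R, 0 <= h < e -> u (t - h) = u t + m * h.

Lemma rslope_uniq u t m m' : rslope u t m -> rslope u t m' -> m = m'.
Proof.
move=> [e e0 he] [e' e'0 he']; pose h := Num.min e e' / 2.
have h0 : 0 < Num.min e e' by rewrite lt_min e0.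
have h1 : Num.min e e' <= e by rewrite ge_min lexx.
have h2 : Num.min e e' <= e' by rewrite ge_min lexx orbT.
have hp : 0 < h by rewrite /h; lra.
have : m * h = m' * h.
  by apply: (addrI (u t)); rewrite -he -?he' // /h; lra.
by move/mulIf; apply; rewrite gt_eqF.
Qed.

Lemma lslopeE u t m : lslope u t m <-> rslope (fun x => u (- x)) (- t) m.
Proof.
split=> -[e e0 he]; exists e => // h hh; have := he h hh.
  by rewrite opprD !opprK.
by rewrite opprD opprK.
Qed.

Lemma lslope_uniq u t m m' : lslope u t m -> lslope u t m' -> m = m'.
Proof. by move=> /lslopeE h /lslopeE; apply: rslope_uniq. Qed.

Lemma rslopeD u v t m n :
  rslope u t m -> rslope v t n -> rslope (fun x => u x + v x) t (m + n).
Proof.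
move=> [e e0 he] [e' e'0 he']; exists (Num.min e e'); first by rewrite lt_min e0.
by move=> h; rewrite lt_min => /and3P[h0 h1 h2]; rewrite he ?he' ?h0 //; ring.
Qed.

Lemma lslopeD u v t m n :
  lslope u t m -> lslope v t n -> lslope (fun x => u x + v x) t (m + n).
Proof. by move=> /lslopeE h /lslopeE h'; apply/lslopeE; apply: rslopeD. Qed.

Lemma rslopeMz u t m k : rslope u t m -> rslope (fun x => u x *~ k) t (m *~ k).
Proof.
move=> [e e0 he]; exists e => // h hh.
by rewrite he // mulrzDl mulrzAl.
Qed.

Lemma lslopeMz u t m k : lslope u t m -> lslope (fun x => u x *~ k) t (m *~ k).
Proof. by move=> /lslopeE h; apply/lslopeE; apply: rslopeMz. Qed.

Lemma rslope_affine a b t : rslope (fun x => a + b * x) t b.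
Proof. by exists 1 => // h _; ring. Qed.

Lemma lslope_affine a b t : lslope (fun x => a + b * x) t (- b).
Proof. by exists 1 => // h _; ring. Qed.

Lemma rslope_sum (K : choiceType) (D : {freeg K / int}) (u : K -> R -> R) t m :
  (forall x, rslope (u x) t (m x)) ->
  rslope (fun s => dsum (fun x => u x s) D) t (dsum m D).
Proof.
move=> H; rewrite /dsum; elim: (dom D) => [|x s IH].
  exists 1 => // h _; rewrite !big_nil; ring.
rewrite big_cons.
have := rslopeD (rslopeMz (coeff x D) (H x)) IH.
by move=> [e e0 he]; exists e => // h hh; rewrite !big_cons he.
Qed.

Lemma lslope_sum (K : choiceType) (D : {freeg K / int}) (u : K -> R -> R) t m :
  (forall x, lslope (u x) t (m x)) ->
  lslope (fun s => dsum (fun x => u x s) D) t (dsum m D).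
Proof.
move=> H; apply/lslopeE; apply: (@rslope_sum K D (fun x s => u x (- s))) => x.
by apply/lslopeE.
Qed.

Definition ramp (a t : R) : R := Num.max 0 (t - a).

Lemma rslope_ramp (a t : R) : rslope (ramp a) t (a <= t)%R%:R.
Proof.
rewrite /ramp; case: (leP a t) => at'.
  exists 1 => // h /andP[h0 _].
  by rewrite mulr1n !max_r; lra.
exists (a - t); first by rewrite subr_gt0.
by move=> h /andP[h0 h1]; rewrite mulr0n !max_l; lra.
Qed.

Lemma lslope_ramp (a t : R) : lslope (ramp a) t (- (a < t)%R%:R).
Proof.
rewrite /ramp; case: (ltP a t) => at'.
  exists (t - a); first by rewrite subr_gt0.
  by move=> h /andP[h0 h1]; rewrite mulr1n !max_r; lra.
exists 1 => // h /andP[h0 _].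
by rewrite mulr0n !max_l; lra.
Qed.

(** The local form of [PL_int], without a list of breakpoints: it can be checked point by point and
    transported by an isometry. *)
Definition germwise L u :=
  (forall t : R, 0 <= t < L -> exists m : int, rslope u t m%:~R) /\
  (forall t : R, 0 < t <= L -> exists m : int, lslope u t m%:~R).

Lemma PL_germwise L u : PL_int L u -> germwise L u.
Proof.
move=> [s []].
suff gen (a : R) : path <%R a s -> forall b : R, last a s = b ->
   (forall i, (i < size s)%N -> exists m : int,
        let a' := nth 0 (a :: s) i in let b' := nth 0 (a :: s) i.+1 in
        forall t : R, a' <= t <= b' -> u t = u a' + m%:~R * (t - a')) ->
   (forall t : R, a <= t < b -> exists m : int, rslope u t m%:~R) /\
  (forall t : R, a < t <= b -> exists m : int, lslope u t m%:~R).
  by move=> ps ls h; exact: gen ps _ ls h.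
elim: s a => [|c s IH] a /=.
  by move=> _ b <- _; split=> t; rewrite ?lt_le_asym ?le_lt_asym // => /andP[h1 h2];
   move: (lt_le_trans h1 h2); rewrite ltxx.
move=> /andP[ac ps] b ls H.
have [m Hm] := H 0%N isT; rewrite /= in Hm.
have [] := IH c ps b ls; first by move=> i si; exact: H i.+1 si.
move=> Hr Hl; split=> t /andP[t1 t2].
  case: (ltP t c) => tc; last by apply: Hr; rewrite tc.
  exists m, (c - t); first by rewrite subr_gt0.
  by move=> h /andP[h0 h1]; rewrite (Hm (t + h)) 1?(Hm t); [ring|lra|lra].
case: (leP t c) => tc; last by apply: Hl; rewrite tc.
exists (- m), (t - a); first by rewrite subr_gt0.
by move=> h /andP[h0 h1]; rewrite (Hm (t - h)) 1?(Hm t) ?intrN; [ring|lra|lra].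
Qed.

Lemma PL_int_rcons L L' u m : 0 <= L -> L < L' -> PL_int L u ->
  (forall t : R, L <= t <= L' -> u t = u L + m%:~R * (t - L)) -> PL_int L' u.
Proof.
move=> L0 LL' [s [ps ls Hs]] H; exists (rcons s L'); split.
- by rewrite rcons_path ps ls.
- by rewrite last_rcons.
- move=> i; rewrite size_rcons ltnS leq_eqVlt => /orP[/eqP ->|si].
    exists m => /=; rewrite nth_rcons ltnn eqxx -rcons_cons nth_rcons /= ltnS leqnn.
    by rewrite nth_last /= ls.
  have [k Hk] := Hs i si; exists k.
  by rewrite /= nth_rcons si -rcons_cons nth_rcons /= ltnS (ltnW si).
Qed.

(** Finitely many breakpoints come from compactness, by induction on the end of the interval: the
    right slope at c extends a subdivision beyond c, and the left slope at c reaches c from a point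
    strictly before it. *)
Lemma germwise_PL L u : 0 <= L -> germwise L u -> PL_int L u.
Proof.
move=> L0 [Hr Hl].
apply: (@real_ind L (fun t => PL_int t u)) => //.
- by exists [::].
- move=> c cL Pc; have [m [e e0 he]] := Hr c cL; exists e => // t ct.
  apply: (@PL_int_rcons c t u m) => //; try lra.
  move=> s st; have -> : s = c + (s - c) by ring.
  by rewrite he; [ring|lra].
- move=> c cL Pc; have [m [e e0 he]] := Hl c cL.
  pose t := Num.max 0 (c - e / 2).
  have t0 : 0 <= t by rewrite le_max lexx.
  have te : c - e / 2 <= t by rewrite le_max lexx orbT.
  have tc : t < c by rewrite gt_max; lra.
  apply: (@PL_int_rcons t c u (- m)) => //; first by apply: Pc; rewrite t0.
  move=> s st; have -> : s = c - (c - s) by ring.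
  have -> : u t = u (c - (c - t)) by congr u; ring.
  rewrite !he ?intrN; [ring|lra|lra].
Qed.

(** Constancy propagates: if u is constant before c, its left slope at c is 0, hence so is its right
    slope, and u stays constant a little beyond c. *)
Lemma no_kink_const L u : 0 < L -> rslope u 0 0 ->
  (forall t : R, 0 < t < L -> exists2 m, rslope u t m & lslope u t (- m)) ->
  (exists m, lslope u L m) -> u L = u 0 /\ lslope u L 0.
Proof.
move=> L0 H0 Hi HL.
have key (t m c : R) : 0 < c -> lslope u c m -> (forall t : R, 0 <= t < c -> u t = u 0) ->
    t = c -> u t = u 0 /\ m = 0.
  move=> c0 [e e0 he] H ->.
  pose h := Num.min e c / 2.
  have hm : 0 < Num.min e c by rewrite lt_min e0 c0.
  have h1 : Num.min e c <= e by rewrite ge_min lexx.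
  have h2 : Num.min e c <= c by rewrite ge_min lexx orbT.
  (* Continuity at c is not yet known. Comparing the distances h and h / 2 gives m = 0 first, and
     then u c = u 0. *)
  have E1 : u 0 = u c + m * h by rewrite -he ?H // /h; lra.
  have E2 : u 0 = u c + m * (h / 2) by rewrite -he ?H // /h; lra.
  have mh : m * h = 0 by lra.
  have m0 : m = 0.
    by apply/eqP; move/eqP: mh; rewrite mulf_eq0 => /orP[//|/eqP]; rewrite /h; lra.
  by split=> //; rewrite E1 m0 mul0r addr0.
have lall (t : R) : 0 < t <= L -> exists m, lslope u t m.
  move=> /andP[t0]; rewrite le_eqVlt => /orP[/eqP -> //|tL].
  by have [|m _ ?] := Hi t; [rewrite t0|exists (- m)].
have all_const : forall t : R, 0 <= t <= L -> u t = u 0.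
  suff: (fun c : R => forall t : R, 0 <= t <= c -> u t = u 0) L by [].
  apply: (@real_ind L (fun c : R => forall t : R, 0 <= t <= c -> u t = u 0)).
  - exact: ltW.
  - by move=> t t0; have -> : t = 0 by apply/eqP; rewrite eq_le andbC.
  - move=> c /andP[c0 cL] Hc.
    have [e e0 he] : rslope u c 0.
      move: c0; rewrite le_eqVlt => /orP[/eqP <- //|c0].
      have [|m rm lm] := Hi c; first by rewrite c0.
      have [|_ m0] := key c _ c c0 lm _ erefl.
        by move=> t /andP[t0 tc]; apply: Hc; rewrite t0 ltW.
      by have -> : 0 = m by apply: oppr_inj; rewrite m0 oppr0.
    exists e => // t /andP[ct te] s /andP[s0 st].
    case: (leP s c) => sc; first by apply: Hc; rewrite s0.
    have -> : s = c + (s - c) by ring.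
    by rewrite he ?mul0r ?addr0 ?Hc ?c0 ?lexx //; lra.
  - move=> c /andP[c0 cL] Hc t /andP[t0].
    rewrite le_eqVlt => /orP[/eqP E|tc]; last first.
      by apply: (Hc t); rewrite t0 ?tc ?lexx.
    have [|m lm] := lall c; first by rewrite c0.
    have [] := key t _ c c0 lm _ E => //.
    by move=> s /andP[s0 sc]; apply: (Hc s); rewrite s0 ?sc ?lexx.
have [m lm] := HL.
have [|? m0] := key L _ L L0 lm _ erefl.
  by move=> t /andP[t0 tc]; apply: all_const; rewrite t0 ltW.
by split=> //; rewrite -m0.
Qed.

End RealInduction.

(** * Principal divisors and potentials on the vertices *)

Section Points.
Variables (R : realType) (Gam : metric_graph R).
Local Notation E := (edge Gam).
Local Notation V := (vert Gam).
Implicit Types (x y : pt Gam) (e : E) (v : V) (t : R) (f : pt Gam -> R).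

(** An inner point is charged to the source of its edge: a divisor becomes a divisor on the vertices
    together with segments from the sources to the inner chips. *)
Definition vtx x : V := match x with inl v => v | inr p => src (val p).1 end.
Definition on_edge e x : bool :=
  match x with inl _ => false | inr p => (val p).1 == e end.
Definition pos x : R := match x with inl _ => 0 | inr p => (val p).2 end.

Lemma at_src e : at_ e 0 = inl (src e).
Proof. by rewrite /at_ insubF /= ?lexx // ltxx. Qed.

Lemma at_tgt e : at_ e (len e) = inl (tgt e).
Proof. by rewrite /at_ insubF /= ?ltxx ?andbF // leNgt len_gt0. Qed.

Lemma at_inner e t : 0 < t < len e ->
  exists2 p : {p : E * R | (0 < p.2 < len p.1)%R}, at_ e t = inr p & val p = (e, t).
Proof.
move=> te; rewrite /at_; case: insubP => [p _ pE|]; first by exists p.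
by rewrite /= te.
Qed.

Variant pt_spec : pt Gam -> Prop :=
  | PtVertex v : pt_spec (inl v)
  | PtInner e t of 0 < t < len e : pt_spec (at_ e t).

Lemma ptP x : pt_spec x.
Proof.
case: x => [v|p]; first exact: PtVertex.
have pP := valP p; have [q qE qv] := at_inner pP.
have -> : inr p = at_ (val p).1 (val p).2 :> pt Gam.
  by rewrite qE; congr inr; apply: val_inj; rewrite qv; case: (val p).
exact: PtInner.
Qed.

Lemma vtx_at e t : 0 <= t <= len e ->
  vtx (at_ e t) = if t < len e then src e else tgt e.
Proof.
move=> /andP[]; rewrite le_eqVlt => /orP[/eqP<- _|t0].
  by rewrite at_src len_gt0.
rewrite le_eqVlt => /orP[/eqP->|tL]; first by rewrite at_tgt ltxx.
by have [|p -> /= ->] := @at_inner e t; rewrite ?t0 ?tL.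
Qed.

Lemma on_edge_at e e' t : 0 <= t <= len e ->
  on_edge e' (at_ e t) = (e == e') && (0 < t < len e).
Proof.
move=> /andP[]; rewrite le_eqVlt => /orP[/eqP<- _|t0].
  by rewrite at_src ltxx andbF.
rewrite le_eqVlt => /orP[/eqP->|tL]; first by rewrite at_tgt ltxx !andbF.
by have [|p -> /= ->] := @at_inner e t; rewrite t0 tL ?andbT.
Qed.

Lemma pos_at e t : 0 <= t < len e -> pos (at_ e t) = t.
Proof.
move=> /andP[]; rewrite le_eqVlt => /orP[/eqP<- _|t0 tL].
  by rewrite at_src.
by have [|p -> /= ->] := @at_inner e t; rewrite ?t0 ?tL.
Qed.

Lemma on_edge_pos e x : on_edge e x -> 0 < pos x < len e.
Proof. by case: x => //= -[p pP] /= /eqP <-. Qed.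

Lemma at_pos e x : on_edge e x -> at_ e (pos x) = x.
Proof.
move=> ex; have [q qE qv] := at_inner (on_edge_pos ex).
case: x ex qE qv => //= p /eqP <- qE qv; rewrite qE; congr inr.
by apply: val_inj; rewrite /= qv; case: (sval p).
Qed.

Lemma eq_at e t x : 0 < t < len e -> (x == at_ e t) = on_edge e x && (pos x == t).
Proof.
move=> te; have tW : 0 <= t <= len e by lra.
apply/eqP/andP => [->|[ex /eqP <-]]; last by rewrite at_pos.
by rewrite on_edge_at // pos_at ?te ?eqxx //; lra.
Qed.

Definition edge_pos e x : R := if on_edge e x then pos x else 0.

Lemma slope_fwdE f e t m : rslope (fun s => f (at_ e s)) t m ->
  slope_fwd f e t = m.
Proof.
move=> [d d0 H]; rewrite /slope_fwd; apply/cvg_lim; first exact: Rhausdorff.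
apply: cvg_near_cst; near=> h.
have h0 : 0 < h by [].
have hd : h < d by near: h; exact: nbhs_right_lt.
by rewrite H ?(ltW h0) // [_ + _ * _]addrC addrK mulrC mulfK // gt_eqF.
Unshelve. all: by end_near. Qed.

Lemma slope_bwdE f e t m : lslope (fun s => f (at_ e s)) t m ->
  slope_bwd f e t = m.
Proof.
move=> [d d0 H]; rewrite /slope_bwd; apply/cvg_lim; first exact: Rhausdorff.
apply: cvg_near_cst; near=> h.
have h0 : 0 < h by [].
have hd : h < d by near: h; exact: nbhs_right_lt.
by rewrite H ?(ltW h0) // [_ + _ * _]addrC addrK mulrC mulfK // gt_eqF.
Unshelve. all: by end_near. Qed.

Lemma ord_inner f e t m m' : 0 < t < len e ->
  rslope (fun s => f (at_ e s)) t m -> lslope (fun s => f (at_ e s)) t m' ->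
  ord_ f (at_ e t) = - m - m'.
Proof.
move=> te /slope_fwdE rm /slope_bwdE lm.
by have [p -> /= ->] := at_inner te; rewrite /= rm lm.
Qed.

Lemma ord_vertex f (m m' : E -> R) v :
  (forall e, rslope (fun s => f (at_ e s)) 0 (m e)) ->
  (forall e, lslope (fun s => f (at_ e s)) (len e) (m' e)) ->
  ord_ f (inl v) = - (\sum_(e | src e == v) m e) - \sum_(e | tgt e == v) m' e.
Proof.
move=> rm lm; rewrite /ord_ -!sumrN; congr (_ + _); apply: eq_bigr => e _.
  by rewrite (slope_fwdE (rm e)).
by rewrite (slope_bwdE (lm e)).
Qed.

Lemma vtx_eq x v :
  (vtx x == v)%:R = (x == inl v)%:R + \sum_(e | src e == v) (on_edge e x)%:R :> int.
Proof.
case: x => [u|p] /=; first by rewrite big1 // addr0.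
rewrite add0r; case: (boolP (src (val p).1 == v)) => pv.
  rewrite (bigD1 (val p).1) //= eqxx big1 ?addr0 // => e /andP[_].
  by rewrite eq_sym => /negPf ->.
rewrite big1 // => e ev; case: eqP => // pe.
by move: pv; rewrite pe ev.
Qed.

Definition edge_deg e (D : divisor Gam) : int :=
  dsum (fun x => (on_edge e x)%:R : int) D.

Lemma dsum_vtx (D : divisor Gam) v :
  dsum (fun x => (vtx x == v)%:R : int) D =
  coeff (inl v) D + \sum_(e | src e == v) edge_deg e D.
Proof.
rewrite coeff_dsum -dsum_fct_sum -dsum_fctD.
by apply: eq_dsum => x; rewrite vtx_eq.
Qed.

(** It vanishes near the source of e, and its slope rises at each chip by the coefficient of that
    chip. A function with divisor D has its slope lowered there by the same amount, so adding
    [kinks e D] makes it linear on e. *)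
Definition kinks e (D : divisor Gam) t : R :=
  dsum (fun x => if on_edge e x then ramp (pos x) t else 0) D.

Lemma rslope_kinks e D t : rslope (kinks e D) t
  (dsum (fun x => (on_edge e x && (pos x <= t))%R%:R) D).
Proof.
apply: rslope_sum => x; case: (on_edge e x) => /=; first exact: rslope_ramp.
by exists 1 => // h _; ring.
Qed.

Lemma lslope_kinks e D t : lslope (kinks e D) t
  (- dsum (fun x => (on_edge e x && (pos x < t))%R%:R) D).
Proof.
rewrite -dsum_fctN; apply: lslope_sum => x.
case: (on_edge e x) => /=; first exact: lslope_ramp.
by exists 1 => // h _; ring.
Qed.

Lemma kinks0 e D : kinks e D 0 = 0.
Proof.
rewrite -[RHS](dsum_fct0 R D); apply: eq_dsum => x.
case: ifP => // /on_edge_pos /andP[x0 _].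
by rewrite /ramp max_l //; lra.
Qed.

Lemma kinks_len e D : kinks e D (len e) =
  (edge_deg e D)%:~R * len e - dsum (edge_pos e) D.
Proof.
rewrite dsum_intr -dsumMr -dsum_fctN -dsum_fctD.
apply: eq_dsum => x; rewrite /edge_pos.
case: ifP => [/on_edge_pos /andP[_ xL]|_]; last by rewrite mul0r subr0.
by rewrite /ramp mul1r max_r //; lra.
Qed.

Lemma kinks_jump e (D : divisor Gam) t : 0 < t < len e ->
  dsum (fun x => (on_edge e x && (pos x <= t))%R%:R) D -
  dsum (fun x => (on_edge e x && (pos x < t))%R%:R) D = (coeff (at_ e t) D)%:~R :> R.
Proof.
move=> te; rewrite coeff_dsum dsum_intr -dsum_fctN -dsum_fctD.
apply: eq_dsum => x; rewrite eq_at //; case: (on_edge e x) => /=; last by rewrite subr0.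
by rewrite le_eqVlt; case: ltgtP; rewrite /= ?subrr ?subr0.
Qed.

Lemma rslope_eq u u' (t d m : R) : 0 < d ->
  (forall s : R, t <= s < t + d -> u s = u' s) -> rslope u t m -> rslope u' t m.
Proof.
move=> d0 H [e e0 he]; exists (Num.min e d); first by rewrite lt_min e0.
move=> h; rewrite lt_min => /and3P[h0 h1 h2].
by rewrite -!H ?he ?h0 //; lra.
Qed.

Lemma lslope_eq u u' (t d m : R) : 0 < d ->
  (forall s : R, t - d < s <= t -> u s = u' s) -> lslope u t m -> lslope u' t m.
Proof.
move=> d0 H [e e0 he]; exists (Num.min e d); first by rewrite lt_min e0.
move=> h; rewrite lt_min => /and3P[h0 h1 h2].
by rewrite -!H ?he ?h0 //; lra.
Qed.

Lemma incoming_slopes (b k : E -> int) v :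
  - (\sum_(e | src e == v) (b e + k e)%:~R) - \sum_(e | tgt e == v) (- b e)%:~R =
  (incoming b v - \sum_(e | src e == v) k e)%:~R :> R.
Proof.
rewrite /incoming !intrB !rmorph_sum /=.
under eq_bigr do rewrite intrD.
under [X in _ - X = _]eq_bigr do rewrite intrN.
by rewrite big_split sumrN /=; ring.
Qed.

(* F is the restriction to the vertices of a function with divisor D, and b
   consists of its slopes at the targets of the edges. *)
Definition edge_potential (D : divisor Gam) (F : V -> R) (b : E -> int) : Prop :=
  (forall v, incoming b v = dsum (fun x => (vtx x == v)%:R : int) D) /\
  (forall e, F (tgt e) - F (src e) = (b e)%:~R * len e + dsum (edge_pos e) D).

Lemma principal_edge f (D : divisor Gam) e : rational_fun f ->
  (forall x, (coeff x D)%:~R = ord_ f x) ->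
  exists b : int,
    [/\ rslope (fun s => f (at_ e s)) 0 (b + edge_deg e D)%:~R,
        lslope (fun s => f (at_ e s)) (len e) (- b)%:~R &
        f (inl (tgt e)) - f (inl (src e)) = b%:~R * len e + dsum (edge_pos e) D].
Proof.
move=> rf fD; set u := fun s => f (at_ e s).
have [Hr Hl] := PL_germwise (rf e).
have L0 := len_gt0 e.
have [|beta rb] := Hr 0; first by rewrite lexx.
have [|c lc] := Hl (len e); first by rewrite L0 lexx.
(* Subtracting the value and the slope at the source and adding the kinks prescribed by D leaves a
   function without kinks, hence the zero function. Its value at the target gives the edge equation,
   and its left slope there relates the slopes of f at the two ends. *)
pose w := fun t => (u t + (- u 0 + (- beta%:~R) * t)) + kinks e D t.
have rw t m : rslope u t m -> rslope w t (m + (- beta%:~R) +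
    dsum (fun x => (on_edge e x && (pos x <= t))%R%:R) D).
  move=> rm; apply: rslopeD; last exact: rslope_kinks.
  by apply: rslopeD => //; exact: rslope_affine.
have lw t m : lslope u t m -> lslope w t (m + (- - beta%:~R) +
    (- dsum (fun x => (on_edge e x && (pos x < t))%R%:R) D)).
  move=> rm; apply: lslopeD; last exact: lslope_kinks.
  by apply: lslopeD => //; exact: lslope_affine.
have [] := @no_kink_const R (len e) w L0.
- have := rw _ _ rb; rewrite subrr add0r.
  rewrite (_ : dsum _ _ = 0) // -[RHS](dsum_fct0 R D); apply: eq_dsum => x.
  by case: (boolP (on_edge e x)) => //= /on_edge_pos /andP[x0 _]; rewrite leNgt x0.
- move=> t te; have [|mr rm] := Hr t; first by lra.
  have [|ml lm] := Hl t; first by lra.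
  exists (mr%:~R + (- beta%:~R) +
    dsum (fun x => (on_edge e x && (pos x <= t))%R%:R) D); first exact: rw.
  have := lw _ _ lm; congr lslope.
  have := kinks_jump D te; rewrite fD (ord_inner te rm lm); lra.
- by eexists; apply: lw; exact: lc.
move=> wL lwL; have := lslope_uniq lwL (lw _ _ lc).
rewrite (_ : dsum _ _ = (edge_deg e D)%:~R); last first.
  rewrite dsum_intr; apply: eq_dsum => x.
  by case: (boolP (on_edge e x)) => //= /on_edge_pos /andP[_ ->].
move=> /eqP; rewrite eq_sym opprK -intrD -intrN -intrD intr_eq0 => /eqP cb.
exists (- c); split.
- by have -> : - c + edge_deg e D = beta by lia.
- by rewrite opprK.
move: wL; rewrite /w kinks0 kinks_len mulr0 !addr0 subrr.
rewrite /u at_src at_tgt.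
have -> : beta%:~R = (- c)%:~R + (edge_deg e D)%:~R :> R by rewrite -intrD; congr intmul; lia.
lra.
Qed.

(** On each edge a function is determined by its value and slope at one end and by the chips of D
    inside, so a function with divisor D amounts to a solution of a finite system on vertices and
    edges. *)
Lemma principalP (D : divisor Gam) :
  principal D <-> exists F b, edge_potential D F b.
Proof.
split=> [[f rf fD]|[F [b [bD Fb]]]].
  have [b Hb] := choice (fun e => principal_edge e rf fD).
  exists (fun v => f (inl v)), b; split=> [v|e]; last by case: (Hb e).
  apply/eqP; rewrite -(eqr_int R) dsum_vtx [X in _ == X]intrD fD.
  rewrite (@ord_vertex f (fun e => (b e + edge_deg e D)%:~R) (fun e => (- b e)%:~R)).
  - by rewrite incoming_slopes -[X in _ == X]intrD subrK.
  - by move=> e; case: (Hb e).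
  - by move=> e; case: (Hb e).
(* Each chip lowers the slope by its coefficient; to arrive at the target with slope [b e], one
   leaves the source with slope [b e + edge_deg e D]. *)
pose phi e t := F (src e) + (b e + edge_deg e D)%:~R * t + kinks e D t *~ (-1).
pose f x := match x with inl v => F v | inr p => phi (val p).1 (val p).2 end.
have fE e t : 0 <= t <= len e -> phi e t = f (at_ e t).
  move=> /andP[]; rewrite le_eqVlt => /orP[/eqP<- _|t0].
    by rewrite at_src /phi kinks0 /= mul0rz mulr0 !addr0.
  rewrite le_eqVlt => /orP[/eqP->|tL].
    rewrite at_tgt /phi /= kinks_len intrD mulrNz mulr1z.
    have := Fb e; lra.
  by have [|p -> /= ->] := @at_inner e t; rewrite ?t0 ?tL.
pose Sr e t := dsum (fun x => (on_edge e x && (pos x <= t))%R%:R : int) D.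
pose Sl e t := dsum (fun x => (on_edge e x && (pos x < t))%R%:R : int) D.
have rphi e t : rslope (phi e) t (b e + edge_deg e D - Sr e t)%:~R.
  rewrite intrD; apply: rslopeD; first exact: rslope_affine.
  rewrite intrN -mulrN1z; apply: rslopeMz.
  by rewrite /Sr dsum_natr; exact: rslope_kinks.
have lphi e t : lslope (phi e) t (- (b e + edge_deg e D) + Sl e t)%:~R.
  rewrite intrD intrN; apply: lslopeD; first exact: lslope_affine.
  have -> : (Sl e t)%:~R = (- (Sl e t)%:~R : R) *~ (-1) by rewrite mulrN1z opprK.
  by apply: lslopeMz; rewrite /Sl dsum_natr; exact: lslope_kinks.
have rf e t : 0 <= t < len e -> rslope (fun s => f (at_ e s)) t
    (b e + edge_deg e D - Sr e t)%:~R.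
  move=> te; apply: rslope_eq (rphi e t) => [|s ts].
    by instantiate (1 := len e - t); lra.
  by apply: fE; lra.
have lf e t : 0 < t <= len e -> lslope (fun s => f (at_ e s)) t
    (- (b e + edge_deg e D) + Sl e t)%:~R.
  move=> te; apply: lslope_eq (lphi e t) => [|s ts].
    by instantiate (1 := t); lra.
  by apply: fE; lra.
exists f.
  move=> e; apply: germwise_PL; first exact: ltW (len_gt0 e).
  by split=> t te; eexists; [exact: rf|exact: lf].
move=> x; case: (ptP x) => [v|e t te]; last first.
  rewrite (@ord_inner _ _ _ _ _ te (rf e t _) (lf e t _)) //; try lra.
  rewrite -(kinks_jump D te) -/(Sr e t) -/(Sl e t).
  rewrite !intrD !intrN !intrD /Sr /Sl !dsum_natr; ring.
have Sr0 e : Sr e 0 = 0.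
  rewrite /Sr -[RHS](dsum_fct0 int D); apply: eq_dsum => y.
  by case: (boolP (on_edge e y)) => //= /on_edge_pos /andP[y0 _]; rewrite leNgt y0.
have SlL e : Sl e (len e) = edge_deg e D.
  apply: eq_dsum => y.
  by case: (boolP (on_edge e y)) => //= /on_edge_pos /andP[_ ->].
rewrite (@ord_vertex f (fun e => (b e + edge_deg e D)%:~R) (fun e => (- b e)%:~R)).
- by rewrite incoming_slopes bD dsum_vtx addrK.
- move=> e; have := rf e 0; rewrite Sr0 subr0; apply.
  by rewrite lexx len_gt0.
- move=> e; have := lf e (len e); rewrite SlL opprD addrNK; apply.
  by rewrite lexx len_gt0.
Qed.

End Points.

(** * Small balls of the path metric *)

Section Paths.
Variables (R : realType) (Gam : metric_graph R).
Local Notation E := (edge Gam).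
Local Notation V := (vert Gam).
Implicit Types (x y z : pt Gam) (e : E) (v : V) (s t h : R).

Lemma is_path_cat x y z p q :
  is_path x p y -> is_path y q z -> is_path x (p ++ q) z.
Proof.
elim: p x => [|[[e s] t] p IH] x /=; first by move=> ->.
by move=> [h1 h2 h3 hp] hq; split=> //; exact: IH.
Qed.

Lemma is_path_step e s t : 0 <= s <= len e -> 0 <= t <= len e ->
  is_path (at_ e s) [:: (e, s, t)] (at_ e t).
Proof. by []. Qed.

Lemma edge_endpoints e : 0 <= (0 : R) <= len e /\ 0 <= len e <= len e.
Proof. by have := len_gt0 e; split; lra. Qed.

Lemma path_exists x y : exists p, is_path x p y.
Proof.
have conn (u v : V) : exists p, is_path (inl u) p (inl v).
  have /andP[_ /forallP/(_ u)/forallP/(_ v)/connectP[q]] := model_connected Gam.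
  elim: q u => [|w q IH] u /=; first by move=> _ ->; exists [::].
  case/andP=> /existsP[e uw] qw vE.
  have [p hp] := IH w qw vE; have [e0 eL] := edge_endpoints e.
  case/orP: uw => /andP[/eqP su /eqP tw].
    exists ([:: (e, 0, len e)] ++ p); apply: is_path_cat hp.
    by rewrite -su -tw -at_src -at_tgt; exact: is_path_step.
  exists ([:: (e, len e, 0)] ++ p); apply: is_path_cat hp.
  by rewrite -su -tw -at_src -at_tgt; exact: is_path_step.
have toV z : exists p, is_path z p (inl (vtx z)).
  case: (ptP z) => [v|e t te]; first by exists [::].
  have [e0 eL] := edge_endpoints e.
  have tW : 0 <= t <= len e by lra.
  exists [:: (e, t, 0)]; rewrite vtx_at //.
  have -> : t < len e by lra.
  by rewrite -at_src; exact: is_path_step.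
have fromV z : exists p, is_path (inl (vtx z)) p z.
  case: (ptP z) => [v|e t te]; first by exists [::].
  have [e0 eL] := edge_endpoints e.
  have tW : 0 <= t <= len e by lra.
  exists [:: (e, 0, t)]; rewrite vtx_at //.
  have -> : t < len e by lra.
  by rewrite -at_src; exact: is_path_step.
have [p1 h1] := toV x; have [p2 h2] := conn (vtx x) (vtx y).
have [p3 h3] := fromV y; exists (p1 ++ (p2 ++ p3)).
by apply: is_path_cat h1 _; apply: is_path_cat h2 _.
Qed.

Lemma path_len_ge0 (p : seq (E * R * R)) : 0 <= path_len p.
Proof. by apply: sumr_ge0 => a _; exact: normr_ge0. Qed.

(** Upper bounds on [dist] come from single paths. Lower bounds need all paths, and are obtained
    from test functions that are 1-Lipschitz along every edge. *)
Definition lipschitz1 (k : pt Gam -> R) := forall e s t,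
  0 <= s <= len e -> 0 <= t <= len e -> `|k (at_ e s) - k (at_ e t)| <= `|t - s|.

Lemma path_len_lipschitz k x y p : lipschitz1 k -> is_path x p y ->
  `|k x - k y| <= path_len p.
Proof.
move=> kl; rewrite /path_len; elim: p x => [|[[e s] t] p IH] x /=.
  by move=> ->; rewrite big_nil subrr normr0.
move=> [h1 h2 -> /IH H]; rewrite big_cons /=.
have := ler_normD (k (at_ e s) - k (at_ e t)) (k (at_ e t) - k y).
have -> : k (at_ e s) - k (at_ e t) + (k (at_ e t) - k y) = k (at_ e s) - k y by ring.
move=> /le_trans; apply; apply: lerD => //; exact: kl.
Qed.

Lemma lipschitz_dist k x y : lipschitz1 k -> `|k x - k y| <= dist x y.
Proof.
move=> kl; apply: lb_le_inf.
  by have [p hp] := path_exists x y; exists (path_len p), p.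
by move=> _ [p hp <-]; exact: path_len_lipschitz.
Qed.

Lemma dist_le x y p : is_path x p y -> dist x y <= path_len p.
Proof.
move=> hp; apply: ge_inf; last by exists p.
by exists 0 => _ [q _ <-]; exact: path_len_ge0.
Qed.

Lemma dist_edge_le e s t : 0 <= s <= len e -> 0 <= t <= len e ->
  dist (at_ e s) (at_ e t) <= `|t - s|.
Proof.
move=> hs ht; apply: le_trans (dist_le (is_path_step hs ht)) _.
by rewrite /path_len big_seq1.
Qed.

Lemma distxx x : dist x x = 0.
Proof.
apply/eqP; rewrite eq_le; apply/andP; split.
  by apply: le_trans (@dist_le x x [::] erefl) _; rewrite /path_len big_nil.
have := @lipschitz_dist (fun=> 0) x x; rewrite subrr normr0; apply.
by move=> e s t _ _; rewrite subrr normr0 normr_ge0.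
Qed.

(** The distance to the point at position p of e, truncated at r. When r is at most p and
    [len e - p], it equals r at both ends of e and so extends continuously by the constant r. *)
Definition inner_cone e (p r : R) x : R :=
  if on_edge e x then Num.min r `|pos x - p| else r.

Lemma inner_cone_at e (p r : R) e' t : r <= p -> r <= len e - p ->
  0 <= t <= len e' ->
  inner_cone e p r (at_ e' t) = if e' == e then Num.min r `|t - p| else r.
Proof.
move=> rp rq /andP[]; rewrite le_eqVlt => /orP[/eqP<- _|t0].
  rewrite at_src /inner_cone /=; case: eqP => // _.
  by rewrite min_l // sub0r normrN ler_normr rp.
rewrite le_eqVlt => /orP[/eqP->|tL].
  rewrite at_tgt /inner_cone /=; case: eqP => // ->.
  by rewrite min_l // ler_normr rq.
rewrite /inner_cone on_edge_at ?pos_at ?t0 ?tL ?(ltW t0) ?(ltW tL) // andbT.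
by case: eqP => // ->.
Qed.

Lemma min_lipschitz (a b c d : R) :
  `|Num.min a b - Num.min c d| <= Num.max `|a - c| `|b - d|.
Proof.
rewrite le_max; case: (leP a b); case: (leP c d) => h1 h2.
- by rewrite lexx.
- by apply/orP; case: (leP 0 (a - d)) => h;
   [right; rewrite ger0_norm // ler_normr; lra
   |left; rewrite ltr0_norm // ler_normr; lra].
- by apply/orP; case: (leP 0 (b - c)) => h;
   [left; rewrite ger0_norm // ler_normr; lra
   |right; rewrite ltr0_norm // ler_normr; lra].
- by rewrite lexx orbT.
Qed.

Lemma inner_cone_lipschitz e (p r : R) : r <= p -> r <= len e - p ->
  lipschitz1 (inner_cone e p r).
Proof.
move=> rp rq e' s t hs ht; rewrite !inner_cone_at //; case: eqP => _; last first.
  by rewrite subrr normr0 normr_ge0.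
apply: le_trans (min_lipschitz _ _ _ _) _.
rewrite subrr normr0 max_r //; apply: le_trans (ler_dist_dist _ _) _.
by rewrite distrC (_ : t - p - (s - p) = t - s) //; ring.
Qed.

Lemma dist_inner_ge e (p r : R) e' t : 0 < p < len e -> 0 <= r ->
  r <= p -> r <= len e - p -> 0 <= t <= len e' ->
  (if e' == e then Num.min r `|t - p| else r) <= dist (at_ e p) (at_ e' t).
Proof.
move=> hp r0 rp rq ht; have kl := inner_cone_lipschitz rp rq.
apply: le_trans (lipschitz_dist _ _ kl).
have hp' : 0 <= p <= len e by lra.
rewrite !inner_cone_at // eqxx subrr normr0 [Num.min r 0]min_r // sub0r normrN.
exact: ler_norm.
Qed.

(** The distance to v truncated at r. The two ends of an edge contribute separately, so that loops
    at v are covered. *)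
Definition vertex_cone v (r : R) x : R :=
  match x with
  | inl u => if u == v then 0 else r
  | inr p => let: (e, t) := val p in
      Num.min (if src e == v then t else r)
              (Num.min r (if tgt e == v then len e - t else r))
  end.

Lemma vertex_cone_at v (r : R) e t : 0 <= r -> r <= len e -> 0 <= t <= len e ->
  vertex_cone v r (at_ e t) =
  Num.min (if src e == v then t else r)
          (Num.min r (if tgt e == v then len e - t else r)).
Proof.
move=> r0 rL /andP[]; rewrite le_eqVlt => /orP[/eqP<- _|t0].
  rewrite at_src /= subr0; case: ifP => _.
    by rewrite min_l // le_min r0; case: ifP => // _; lra.
  by rewrite min_l // le_min lexx /=; case: ifP.
rewrite le_eqVlt => /orP[/eqP->|tL].
  rewrite at_tgt /= subrr; case: (tgt e == v).
    by rewrite [Num.min r _]min_r // min_r //; case: ifP; lra.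
  by rewrite minxx min_r //; case: ifP.
by have [|p -> /= ->] := @at_inner R Gam e t; rewrite ?t0 ?tL.
Qed.

Lemma vertex_cone_lipschitz v (r : R) : 0 <= r -> (forall e, r <= len e) ->
  lipschitz1 (vertex_cone v r).
Proof.
move=> r0 rL e s t hs ht; rewrite !vertex_cone_at //.
apply: le_trans (min_lipschitz _ _ _ _) _; rewrite ge_max; apply/andP; split.
  by case: ifP => _; [rewrite distrC|rewrite subrr normr0 normr_ge0].
apply: le_trans (min_lipschitz _ _ _ _) _; rewrite ge_max subrr normr0 normr_ge0 /=.
case: ifP => _; last by rewrite subrr normr0 normr_ge0.
by rewrite (_ : len e - s - (len e - t) = t - s) //; ring.
Qed.

Lemma dist_vertex_ge v (r : R) x : 0 <= r -> (forall e, r <= len e) ->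
  vertex_cone v r x <= dist (inl v) x.
Proof.
move=> r0 rL; apply: le_trans (lipschitz_dist _ _ (vertex_cone_lipschitz v r0 rL)).
by rewrite /= eqxx sub0r normrN; exact: ler_norm.
Qed.

Lemma min_len : exists2 m : R, 0 < m & forall e, m <= len e.
Proof.
(* The start value 1 keeps the minimum positive when there is no edge. *)
exists (\big[Num.min/1]_(e : E) len e).
  by apply: (big_ind (fun x : R => 0 < x)) => // [x y|e _]; rewrite ?lt_min ?len_gt0 // => -> ->.
by move=> e; rewrite (bigminD1 e) //= ge_min lexx.
Qed.

(* (e, t, false) and (e, t, true) are the germs of the edge e at the position t
   in the directions of tgt e and of src e. *)
Definition gpt (g : E * R * bool) h : pt Gam :=
  at_ g.1.1 (if g.2 then g.1.2 - h else g.1.2 + h).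

Definition germs x : seq (E * R * bool) :=
  match x with
  | inl v => [seq (e, 0, false) | e <- enum E & src e == v] ++
             [seq (e, len e, true) | e <- enum E & tgt e == v]
  | inr p => [:: (val p, false); (val p, true)]
  end.

Lemma germs_inner e t : 0 < t < len e ->
  germs (at_ e t) = [:: (e, t, false); (e, t, true)].
Proof. by move=> te; have [p -> /= ->] := at_inner te. Qed.

Lemma germs_uniq x : uniq (germs x).
Proof.
case: x => [v|p]; last by rewrite /= inE xpair_eqE andbF.
rewrite /germs cat_uniq !map_inj_uniq; first last.
- by move=> e e' [].
- by move=> e e' [].
apply/and3P; split; try exact/filter_uniq/enum_uniq.
by apply/hasPn => _ /mapP[e _ ->]; apply/negP => /mapP[e' _ []].
Qed.

Lemma gpt0 x g : g \in germs x -> gpt g 0 = x.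
Proof.
case: (ptP x) => [v|e t te].
  rewrite mem_cat => /orP[] /mapP[e]; rewrite mem_filter => /andP[/eqP <- _] ->;
  by rewrite /gpt /= ?addr0 ?subr0 ?at_src ?at_tgt.
rewrite germs_inner // !inE => /orP[] /eqP ->;
by rewrite /gpt /= ?addr0 ?subr0.
Qed.

Variant vertex_germ_spec v : E * R * bool -> Prop :=
  | SrcGerm e of src e = v : vertex_germ_spec v (e, 0, false)
  | TgtGerm e of tgt e = v : vertex_germ_spec v (e, len e, true).

Lemma vertex_germP v g : g \in germs (inl v) -> vertex_germ_spec v g.
Proof.
rewrite mem_cat => /orP[] /mapP[e]; rewrite mem_filter => /andP[/eqP ev _] ->.
  exact: SrcGerm.
exact: TgtGerm.
Qed.

Lemma src_germ e : (e, 0, false) \in germs (inl (src e)).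
Proof.
rewrite mem_cat; apply/orP; left; apply/mapP; exists e => //.
by rewrite mem_filter eqxx mem_enum.
Qed.

Lemma tgt_germ e : (e, len e, true) \in germs (inl (tgt e)).
Proof.
rewrite mem_cat; apply/orP; right; apply/mapP; exists e => //.
by rewrite mem_filter eqxx mem_enum.
Qed.

Lemma fwd_germ e t : 0 <= t < len e -> (e, t, false) \in germs (at_ e t).
Proof.
move=> /andP[]; rewrite le_eqVlt => /orP[/eqP<- _|t0 tL].
  by rewrite at_src src_germ.
by rewrite germs_inner ?t0 ?tL // inE eqxx.
Qed.

Lemma bwd_germ e t : 0 < t <= len e -> (e, t, true) \in germs (at_ e t).
Proof.
move=> /andP[t0]; rewrite le_eqVlt => /orP[/eqP->|tL].
  by rewrite at_tgt tgt_germ.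
by rewrite germs_inner ?t0 ?tL // !inE eqxx orbT.
Qed.

(** A small ball around x is a union of germs parametrized by the distance to x. The last two
    clauses separate germs metrically: at distances s <= h from x, two points of one germ are at
    most h - s apart, and points of different germs strictly more. *)
Definition star x (r : R) : Prop :=
  [/\ forall g h, g \in germs x -> 0 <= h < r -> dist x (gpt g h) = h,
      forall y, 0 < dist x y < r -> exists2 g, g \in germs x & y = gpt g (dist x y),
      forall g s h, g \in germs x -> 0 <= s < r -> 0 <= h < r ->
        dist (gpt g h) (gpt g s) <= `|s - h| &
      forall g g' s h, g \in germs x -> g' \in germs x -> g != g' ->
        0 < s <= h -> h < r -> h - s < dist (gpt g h) (gpt g' s)].

Lemma star_vertex v : exists2 r, 0 < r & star (inl v) r.
Proof.
(* With a quarter of the shortest length, the two germs of a loop at v stay far from each other. *)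
have [m m0 mL] := min_len; exists (m / 4); first by lra.
set r := m / 4.
have r0 : 0 <= r by rewrite /r; lra.
have rL e : r <= len e by have := mL e; rewrite /r; lra.
have dist_germ g h : g \in germs (inl v) -> 0 <= h < r -> dist (inl v) (gpt g h) = h.
  move=> gv hr; have := dist_vertex_ge v (gpt g h) r0 rL.
  case: (vertex_germP gv) => e ev; have := mL e => meL; rewrite /gpt /= => H;
  apply/eqP; rewrite eq_le; apply/andP; split.
  - rewrite -ev -at_src add0r; apply: le_trans (dist_edge_le _ _) _; rewrite /r in hr *; try lra.
    by rewrite subr0 ger0_norm; lra.
  - apply: le_trans H; rewrite vertex_cone_at //; last by rewrite /r in hr *; lra.
    rewrite ev eqxx add0r !le_min lexx /=; apply/andP; split; first by lra.
    by case: ifP => _; rewrite /r in hr *; lra.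
  - rewrite -ev -at_tgt; apply: le_trans (dist_edge_le _ _) _; rewrite /r in hr *; try lra.
    by rewrite addrAC subrr sub0r normrN ger0_norm; lra.
  - apply: le_trans H; rewrite vertex_cone_at //; last by rewrite /r in hr *; lra.
    rewrite ev eqxx !le_min; apply/and3P; split; last 2 first.
    + by lra.
    + by lra.
    by case: ifP => _; rewrite /r in hr *; lra.
split=> //.
- move=> y yr; have := dist_vertex_ge v y r0 rL.
  case: (ptP y) yr => [u|e t te] yr.
    rewrite /=; case: eqP yr => [->|_] yr H; move: yr; first by rewrite distxx ltxx.
    by move=> /andP[_]; rewrite ltNge H.
  have tW : 0 <= t <= len e by lra.
  rewrite vertex_cone_at // => H.
  have : Num.min (if src e == v then t else r)
          (Num.min r (if tgt e == v then len e - t else r)) < r.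
    by apply: le_lt_trans H _; case/andP: yr.
  rewrite !gt_min ltxx /=; case: eqP => [sv|_]; case: eqP => [tv|_]; rewrite ?ltxx ?orbF //=.
  + case/orP => tr.
      exists (e, 0, false); first by rewrite -sv src_germ.
      have -> : at_ e t = gpt (e, 0, false) t by rewrite /gpt /= add0r.
      by rewrite dist_germ //; [rewrite -sv src_germ|lra].
    exists (e, len e, true); first by rewrite -tv tgt_germ.
    have -> : at_ e t = gpt (e, len e, true) (len e - t) by rewrite /gpt /= subKr.
    by rewrite dist_germ //; [rewrite -tv tgt_germ|lra].
  + move=> tr; exists (e, 0, false); first by rewrite -sv src_germ.
    have -> : at_ e t = gpt (e, 0, false) t by rewrite /gpt /= add0r.
    by rewrite dist_germ //; [rewrite -sv src_germ|lra].
  + move=> tr; exists (e, len e, true); first by rewrite -tv tgt_germ.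
    have -> : at_ e t = gpt (e, len e, true) (len e - t) by rewrite /gpt /= subKr.
    by rewrite dist_germ //; [rewrite -tv tgt_germ|lra].
- move=> g s h gv hs hh; case: (vertex_germP gv) => e ev; have := mL e => meL;
    rewrite /gpt /=; apply: le_trans (dist_edge_le _ _) _; rewrite /r in hs hh *; try lra.
    by rewrite !add0r.
  by rewrite (_ : len e - s - (len e - h) = - (s - h)) ?normrN //; ring.
- move=> g g' s h gv gv' gg hs hr.
  (* The cone of radius h centred at the point at distance h from v has value h at every point of
     another germ, and h > h - s. *)
  have far e e' p t : 0 < p < len e -> h <= p -> h <= len e - p -> 0 <= t <= len e' ->
      (e' = e -> h <= `|t - p|) -> h - s < dist (at_ e p) (at_ e' t).
    move=> hp h1 h2 ht H; apply: lt_le_trans (@dist_inner_ge e p h e' t _ _ _ _ _) => //.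
    - case: eqP => [/H H'|_]; last by lra.
      by rewrite lt_min; apply/andP; split; [lra|apply: lt_le_trans H'; lra].
    - by lra.
  have := mL g.1.1; have := mL g'.1.1.
  case: (vertex_germP gv) gg => e ev; case: (vertex_germP gv') => e' ev' gg mL1 mL2;
    rewrite /= in mL1 mL2; rewrite /gpt /= ?add0r; rewrite /r in hr; apply: far; try lra.
  + by move=> ee; move: gg; rewrite ee eqxx.
  + by move=> ->; rewrite ler_normr; apply/orP; left; have := mL e; lra.
  + by move=> _; rewrite ler_normr; apply/orP; right; have := mL e; lra.
  + by move=> ee; move: gg; rewrite ee eqxx.
Qed.

Lemma star_inner e (p : R) : 0 < p < len e -> exists2 r, 0 < r & star (at_ e p) r.
Proof.
move=> pe; pose m := Num.min p (len e - p); have m0 : 0 < m by rewrite lt_min; lra.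
have mp : m <= p by rewrite ge_min lexx.
have mq : m <= len e - p by rewrite ge_min lexx orbT.
clearbody m; exists (m / 2); first by lra.
have dist_germ g h : g \in germs (at_ e p) -> 0 <= h < m / 2 ->
    dist (at_ e p) (gpt g h) = h.
  move=> gv hr; apply/eqP; rewrite eq_le.
  rewrite germs_inner // !inE in gv; case/orP: gv => /eqP ->; rewrite /gpt /=;
    apply/andP; split.
  - by apply: le_trans (dist_edge_le _ _) _; rewrite ?[p + h]addrC ?addrK ?ger0_norm //; lra.
  - apply: le_trans (@dist_inner_ge e p (m / 2) e (p + h) _ _ _ _ _); try lra.
    by rewrite eqxx le_min [p + h]addrC addrK ger0_norm; lra.
  - apply: le_trans (dist_edge_le _ _) _; try lra.
    by rewrite addrAC subrr sub0r normrN ger0_norm; lra.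
  - apply: le_trans (@dist_inner_ge e p (m / 2) e (p - h) _ _ _ _ _); try lra.
    by rewrite eqxx le_min addrAC subrr sub0r normrN ger0_norm; lra.
split=> //.
- move=> y /andP[y0 yr].
  have H e' t : 0 <= t <= len e' -> y = at_ e' t -> e' = e /\ `|t - p| < m / 2.
    move=> te yE; have := @dist_inner_ge e p (m / 2) e' t; rewrite -yE.
    have h1 : 0 <= m / 2 by lra.
    have h2 : m / 2 <= p by lra.
    have h3 : m / 2 <= len e - p by lra.
    move=> /(_ pe h1 h2 h3 te) H; have := le_lt_trans H yr.
    by case: eqP => [->|_]; rewrite ?gt_min ltxx //= => ?; split.
  have [e' [t [te yE]]] : exists e' t, 0 <= t <= len e' /\ y = at_ e' t.
    case: (ptP y) H y0 yr => [v|e' t te] H y0 yr; last by exists e', t; split=> //; lra.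
    have := @inner_cone_lipschitz e p (m / 2).
    have h2 : m / 2 <= p by lra.
    have h3 : m / 2 <= len e - p by lra.
    move=> /(_ h2 h3) /(lipschitz_dist (at_ e p) (inl v)).
    rewrite inner_cone_at ?eqxx ?subrr ?normr0 //; last by lra.
    rewrite min_r /inner_cone /=; last by lra.
    by rewrite sub0r normrN gtr0_norm; lra.
  have [ee tp] := H e' t te yE; rewrite {}yE {}ee in te y0 yr H *.
  case: (leP p t) => pt.
    exists (e, p, false); first by rewrite germs_inner // inE eqxx.
    rewrite ger0_norm in tp; last by lra.
    have tE : at_ e t = gpt (e, p, false) (t - p) by rewrite /gpt /= addrC subrK.
    rewrite {2}tE dist_germ //; first by rewrite germs_inner // inE eqxx.
    by lra.
  exists (e, p, true); first by rewrite germs_inner // !inE eqxx orbT.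
  rewrite ltr0_norm in tp; last by lra.
  have tE : at_ e t = gpt (e, p, true) (p - t) by rewrite /gpt /= subKr.
  rewrite {2}tE dist_germ //; first by rewrite germs_inner // !inE eqxx orbT.
  by lra.
- move=> g s h; rewrite germs_inner // !inE => /orP[] /eqP -> hs hh; rewrite /gpt /=;
    apply: le_trans (dist_edge_le _ _) _; try lra.
    by rewrite (_ : p + s - (p + h) = s - h) //; ring.
  by rewrite (_ : p - s - (p - h) = - (s - h)) ?normrN //; ring.
- move=> g g' s h; rewrite germs_inner // !inE.
  move=> /orP[] /eqP -> /orP[] /eqP ->; rewrite ?eqxx // => _ hs hr; rewrite /gpt /=.
    apply: lt_le_trans (@dist_inner_ge e (p + h) h e (p - s) _ _ _ _ _); try lra.
    by rewrite eqxx lt_min ltr_normr; apply/andP; split; [lra|apply/orP; right; lra].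
  apply: lt_le_trans (@dist_inner_ge e (p - h) h e (p + s) _ _ _ _ _); try lra.
  by rewrite eqxx lt_min ltr_normr; apply/andP; split; [lra|apply/orP; left; lra].
Qed.

Lemma star_exists x : exists2 r, 0 < r & star x r.
Proof. by case: (ptP x) => [v|e t te]; [exact: star_vertex|exact: star_inner]. Qed.

End Paths.

(** * Isometries *)

Section Germs.
Variables (R : realType) (Gam : metric_graph R).
Implicit Types (x : pt Gam) (f : pt Gam -> R) (g : edge Gam * R * bool).

Definition gslope f g (m : R) :=
  rslope (fun h => f (gpt g h)) 0 m.

Lemma gslope_fwd f e (t m : R) :
  gslope f (e, t, false) m <-> rslope (fun s => f (at_ e s)) t m.
Proof.
split=> -[d d0 H]; exists d => // h hd; have := H h hd; by rewrite /gpt /= add0r addr0.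
Qed.

Lemma gslope_bwd f e (t m : R) :
  gslope f (e, t, true) m <-> lslope (fun s => f (at_ e s)) t m.
Proof.
split=> -[d d0 H]; exists d => // h hd; have := H h hd; by rewrite /gpt /= add0r subr0.
Qed.

Lemma germs_gslope f x g : rational_fun f -> g \in germs x ->
  exists m : int, gslope f g m%:~R.
Proof.
move=> rf; case: (ptP x) => [v|e t te].
  move=> /vertex_germP[e _|e _]; have [Hr Hl] := PL_germwise (rf e); have e0 := len_gt0 e.
    by have [|m Hm] := Hr 0; [rewrite lexx|exists m; apply/gslope_fwd].
  by have [|m Hm] := Hl (len e); [rewrite lexx andbT|exists m; apply/gslope_bwd].
have [Hr Hl] := PL_germwise (rf e).
rewrite germs_inner // !inE => /orP[] /eqP ->.
  by have [|m Hm] := Hr t; [lra|exists m; apply/gslope_fwd].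
by have [|m Hm] := Hl t; [lra|exists m; apply/gslope_bwd].
Qed.

Lemma gslope_rational f :
  (forall x g, g \in germs x -> exists m : int, gslope f g m%:~R) -> rational_fun f.
Proof.
move=> H e; apply: germwise_PL; first exact: ltW (len_gt0 e).
split=> t te.
  by have [m /gslope_fwd ?] := H _ _ (fwd_germ te); exists m.
by have [m /gslope_bwd ?] := H _ _ (bwd_germ te); exists m.
Qed.

(** A formula that is uniform in vertices and inner points: an isometry may send a vertex of valence
    2 to an inner point. *)
Lemma ord_germs f x (m : edge Gam * R * bool -> R) :
  (forall g, g \in germs x -> gslope f g (m g)) ->
  ord_ f x = - \sum_(g <- germs x) m g.
Proof.
case: (ptP x) => [v|e t te] H; last first.
  rewrite germs_inner // in H *; rewrite !big_cons big_nil addr0.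
  rewrite (@ord_inner _ _ f e t (m (e, t, false)) (m (e, t, true))) ?opprD //.
    by apply/gslope_fwd/H; rewrite inE eqxx.
  by apply/gslope_bwd/H; rewrite !inE eqxx orbT.
rewrite /germs big_cat !big_map !big_filter /= !big_enum_cond /= opprD -!sumrN.
congr (_ + _); apply: eq_bigr => e /eqP ev.
  by rewrite (@slope_fwdE _ _ f e 0 (m (e, 0, false))) //;
     apply/gslope_fwd/H; rewrite -ev src_germ.
by rewrite (@slope_bwdE _ _ f e (len e) (m (e, len e, true))) //;
   apply/gslope_bwd/H; rewrite -ev tgt_germ.
Qed.

End Germs.

Lemma choose_graph (T U : eqType) (l : seq T) (P : T -> U -> Prop) :
  (forall g, g \in l -> exists g', P g g') ->
  exists ps : seq (T * U), [seq p.1 | p <- ps] = l /\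
    forall p, p \in ps -> P p.1 p.2.
Proof.
elim: l => [|g l IH] H; first by exists [::].
have [g' gg'] := H g (mem_head _ _).
have [|ps [ps1 psP]] := IH; first by move=> k kl; apply: H; rewrite inE kl orbT.
exists ((g, g') :: ps); rewrite /= ps1; split=> // p.
by rewrite inE => /orP[/eqP -> //|/psP].
Qed.

Section Isometry.
Variables (R : realType) (Gam Gam' : metric_graph R).
Variables (f : pt Gam -> pt Gam') (f' : pt Gam' -> pt Gam).
Hypotheses (fK : cancel f f') (f'K : cancel f' f).
Hypothesis fd : forall x y, dist (f x) (f y) = dist x y.

(** The germs at x correspond to the points of a small sphere around x, and f maps this sphere onto
    the sphere around f x. The metric separation of germs in [star] then makes f follow the matched
    germ all the way down to f x. *)
Lemma isometry_germs x : exists2 d : R, 0 < d &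
  exists ps : seq ((edge Gam * R * bool) * (edge Gam' * R * bool)),
  [/\ [seq p.1 | p <- ps] = germs x,
      perm_eq [seq p.2 | p <- ps] (germs (f x)) &
      forall p, p \in ps -> forall h, 0 <= h < d -> f (gpt p.1 h) = gpt p.2 h].
Proof.
have [r r0 [Sa Sb Sc Sd]] := star_exists x.
have [r' r'0 [Sa' Sb' Sc' Sd']] := star_exists (f x).
pose d := Num.min r r' / 2.
have m0 : 0 < Num.min r r' by rewrite lt_min r0.
have m1 : Num.min r r' <= r by rewrite ge_min lexx.
have m2 : Num.min r r' <= r' by rewrite ge_min lexx orbT.
have d0 : 0 < d by rewrite /d; lra.
have dr : d < r by rewrite /d; lra.
have dr' : d < r' by rewrite /d; lra.
clearbody d.
have key g : g \in germs x -> exists g', g' \in germs (f x) /\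
    forall h, 0 <= h <= d -> f (gpt g h) = gpt g' h.
  move=> gx; have dg h : 0 <= h <= d -> dist (f x) (f (gpt g h)) = h.
    by move=> hd; rewrite fd Sa //; lra.
  have [|g' g'x yE] := Sb' (f (gpt g d)).
    by rewrite dg ?lexx ?(ltW d0) // d0 dr'.
  rewrite dg ?lexx ?(ltW d0) // in yE.
  exists g'; split=> // h /andP[]; rewrite le_eqVlt => /orP[/eqP <- _|h0 hd].
    by rewrite (gpt0 gx) (gpt0 g'x).
  have [|g2 g2x zE] := Sb' (f (gpt g h)).
    by rewrite dg ?hd ?(ltW h0) // h0 (le_lt_trans hd).
  rewrite dg ?hd ?(ltW h0) // in zE.
  (* On another germ g2, the image of [gpt g h] would be further than d - h from the image of
     [gpt g d]; but both come from the germ g, where their distance is at most d - h. *)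
  case: (eqVneq g' g2) zE => [-> //|gg] zE; exfalso.
  have := Sd' g' g2 h d g'x g2x gg; rewrite h0 hd dr' => /(_ isT isT).
  rewrite -yE -zE fd ltNge; move/negP; apply.
  apply: le_trans (Sc g h d gx _ _) _; try lra.
  by rewrite ler0_norm; lra.
have [ps [ps1 psP]] := choose_graph key.
exists d => //; exists ps; split=> //; last first.
  move=> p /psP[_ H] h /andP[h0 hd]; apply: H; rewrite h0; exact: ltW.
have dd : 0 < d <= d by rewrite d0 lexx.
have d01 : 0 <= d <= d by rewrite (ltW d0) lexx.
apply: uniq_perm; last 1 first.
- move=> g'; apply/idP/idP => [/mapP[p pps ->]|g'x]; first by have [] := psP p pps.
  have [|g gx zE] := Sb (f' (gpt g' d)).
    by rewrite -fd f'K Sa' ?d0 //; lra.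
  rewrite -[dist _ _]fd f'K Sa' // in zE; last by lra.
  have /mapP[p pps gE] : g \in [seq p.1 | p <- ps] by rewrite ps1.
  apply/mapP; exists p => //.
  have [p2x H] := psP p pps.
  have fE : gpt g' d = gpt p.2 d by rewrite -H // -gE -zE f'K.
  apply/eqP/negPn/negP => gg.
  (* At equal distances the separation reads 0 < [dist], so different germs cannot share a point of
     the sphere. *)
  have := Sd' g' p.2 d d g'x p2x gg dd dr'.
  by rewrite fE distxx subrr ltxx.
- have ups : uniq ps by apply: (@map_uniq _ _ fst); rewrite ps1 germs_uniq.
  rewrite map_inj_in_uniq // => p q pps qps E.
  have [_ Hp] := psP _ pps; have [_ Hq] := psP _ qps.
  have px : p.1 \in germs x by rewrite -ps1 map_f.
  have qx : q.1 \in germs x by rewrite -ps1 map_f.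
  have gE : gpt p.1 d = gpt q.1 d by rewrite -[LHS]fK -[RHS]fK Hp // Hq // E.
  suff : p.1 = q.1 by case: p q E {pps qps Hp Hq px qx gE} => p1 p2 [q1 q2] /= -> ->.
  apply/eqP/negPn/negP => gg.
  by have := Sd p.1 q.1 d d px qx gg dd dr; rewrite gE distxx subrr ltxx.
- exact: germs_uniq.
Qed.

Lemma isometry_pullback (u : pt Gam' -> R) : rational_fun u ->
  rational_fun (u \o f) /\ forall x, ord_ (u \o f) x = ord_ u (f x).
Proof.
move=> ru; pose sl := fun g => xget 0 [set m | gslope u g m].
have slP x g : g \in germs x -> gslope u g (sl g).
  by move=> /(germs_gslope ru)[m Hm]; apply: (xgetPex 0); exists m%:~R.
have transfer x : exists ps : seq ((edge Gam * R * bool) * (edge Gam' * R * bool)),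
    [/\ [seq p.1 | p <- ps] = germs x, perm_eq [seq p.2 | p <- ps] (germs (f x)) &
    forall p, p \in ps -> forall m, gslope u p.2 m <-> gslope (u \o f) p.1 m].
  have [d d0 [ps [ps1 ps2 psP]]] := isometry_germs x.
  exists ps; split=> // p pps m; split; apply: (rslope_eq d0) => h;
    by rewrite add0r => hd; rewrite /= psP.
split.
  apply: gslope_rational => x g; have [ps [ps1 ps2 psP]] := transfer x.
  rewrite -ps1 => /mapP[p pps ->].
  have : p.2 \in germs (f x) by rewrite -(perm_mem ps2) map_f.
  by move=> /(germs_gslope ru)[m Hm]; exists m; apply/psP.
move=> x; have [ps [ps1 ps2 psP]] := transfer x.
rewrite (ord_germs (slP (f x))) -(perm_big _ ps2) big_map.
rewrite (@ord_germs _ _ _ x (fun g => xget 0 [set m | gslope (u \o f) g m])); last first.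
  move=> g; rewrite -ps1 => /mapP[p pps ->]; apply: (xgetPex 0).
  exists (sl p.2); apply/psP => //; apply: (slP (f x)).
  by rewrite -(perm_mem ps2) map_f.
rewrite -ps1 big_map; congr (- _); rewrite big_seq [RHS]big_seq.
apply: eq_bigr => p pps; rewrite /sl; congr (xget 0 _).
by apply/seteqP; split=> m /psP; apply.
Qed.

Definition push_divisor (D : divisor Gam) : divisor Gam' := dsum (fun x => << f x >>) D.

Lemma coeff_push (D : divisor Gam) y : coeff y (push_divisor D) = coeff (f' y) D.
Proof.
rewrite /push_divisor /dsum raddf_sum /= [RHS]coeff_dsum; apply: eq_bigr => x _.
rewrite raddfMz /= coeffU mul1r; congr (_ *~ _); congr (nat_of_bool _)%:R.
by apply/eqP/eqP => [<-|->]; rewrite ?fK ?f'K.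
Qed.

Lemma deg_push (D : divisor Gam) : deg (push_divisor D) = deg D.
Proof.
rewrite [RHS]deg_dsum /push_divisor /dsum raddf_sum /=; apply: eq_bigr => x _.
by rewrite raddfMz /= degU.
Qed.

Lemma push_divisorB D D' : push_divisor (D - D') = push_divisor D - push_divisor D'.
Proof. exact: dsumB. Qed.

Lemma principal_push D : principal (push_divisor D) -> principal D.
Proof.
move=> [u ru uD]; have [rf ordE] := isometry_pullback ru.
by exists (u \o f) => // x; rewrite ordE -uD coeff_push fK.
Qed.

End Isometry.

(** * Transport of divisors, equivalence and rank along an isometry *)

Section IsometricRank.
Variables (R : realType) (Gam Gam' : metric_graph R).
Variables (f : pt Gam -> pt Gam') (f' : pt Gam' -> pt Gam).
Hypotheses (fK : cancel f f') (f'K : cancel f' f).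
Hypothesis fd : forall x y, dist (f x) (f y) = dist x y.
Local Notation push := (push_divisor f).
Local Notation push' := (push_divisor f').

Lemma dist_inv x y : dist (f' x) (f' y) = dist x y.
Proof. by rewrite -fd !f'K. Qed.

Lemma push_divisorK D : push' (push D) = D.
Proof.
by apply/eqP/freeg_eqP => x; rewrite (coeff_push f'K fK) (coeff_push fK f'K) fK.
Qed.

Lemma push_divisorK' D : push (push' D) = D.
Proof.
by apply/eqP/freeg_eqP => x; rewrite (coeff_push fK f'K) (coeff_push f'K fK) f'K.
Qed.

Lemma lin_equiv_push D D' : lin_equiv (push D) (push D') <-> lin_equiv D D'.
Proof.
rewrite /lin_equiv -push_divisorB; split; first exact: principal_push fK f'K fd _.
move=> H; apply: (principal_push f'K fK dist_inv).
by rewrite push_divisorK.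
Qed.

Lemma effective_push D : effective (push D) <-> effective D.
Proof.
split=> H x; last by rewrite (coeff_push fK f'K).
by have := H (f x); rewrite (coeff_push fK f'K) fK.
Qed.

Lemma rank_test_push D n : rank_test D n -> rank_test (push D) n.
Proof.
move=> H F' eF dF; have [||D' DD' eD'] := H (push' F').
- by apply/effective_push; rewrite push_divisorK'.
- by rewrite deg_push.
exists (push D'); first by apply/lin_equiv_push.
by rewrite -[F']push_divisorK' -push_divisorB; apply/effective_push.
Qed.

End IsometricRank.

Lemma isometric_divisors (R : realType) (Gam Gam' : metric_graph R) :
  isometric Gam Gam' ->
  exists (p : divisor Gam -> divisor Gam') (p' : divisor Gam' -> divisor Gam),
  [/\ cancel p p', cancel p' p,
      forall D, deg (p D) = deg D,
      forall D D', lin_equiv (p D) (p D') <-> lin_equiv D D' &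
      forall D, div_rank (p D) = div_rank D].
Proof.
move=> [f [f' fK f'K] fd]; exists (push_divisor f), (push_divisor f'); split.
- exact: push_divisorK.
- exact: push_divisorK'.
- exact: deg_push.
- exact: (lin_equiv_push fK f'K fd).
move=> D; rewrite /div_rank.
have rtE n : rank_test (push_divisor f D) n <-> rank_test D n.
  split; last exact: (rank_test_push fK f'K fd).
  by move/(rank_test_push f'K fK (dist_inv f'K fd)); rewrite (push_divisorK fK f'K).
congr (if _ then _ else _).
  apply/asboolP/asboolP => [][D' DD' eD'].
    exists (push_divisor f' D').
      by apply/(lin_equiv_push fK f'K fd); rewrite (push_divisorK' fK f'K).
    by apply/(effective_push f'K fK).
  exists (push_divisor f D'); first by apply/(lin_equiv_push fK f'K fd).
  by apply/(effective_push fK f'K).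
congr (Posz (xget _ _)); apply/seteqP; split=> n [h1 h2]; split; try exact/rtE;
  by move=> m /rtE /h2.
Qed.

(** * The Abel-Jacobi map *)

Section Chains.
Variables (G : graph) (A : zmodType).
Implicit Types (b c : edge G -> A).

Lemma incomingD b c v : incoming (fun e => b e + c e) v = incoming b v + incoming c v.
Proof. by rewrite /incoming !big_split /= opprD addrACA. Qed.

Lemma incomingN b v : incoming (fun e => - b e) v = - incoming b v.
Proof. by rewrite /incoming !sumrN opprD. Qed.

Lemma incoming0 v : incoming (fun _ : edge G => 0 : A) v = 0.
Proof. by rewrite /incoming !big1 ?subrr. Qed.

Lemma incoming_delta (e : edge G) (a : A) v :
  incoming (fun e' => if e' == e then a else 0) v =
  (if tgt e == v then a else 0) - (if src e == v then a else 0).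
Proof.
rewrite /incoming -!big_mkcondr /=; congr (_ - _).
  case: ifP => ev; last first.
    by rewrite big1 // => e' /andP[e'v /eqP ee]; rewrite -ee e'v in ev.
  rewrite (big_pred1 e) // => e' /=; case: (eqVneq e' e) => [->|_]; by rewrite ?ev ?andbF.
case: ifP => ev; last first.
  by rewrite big1 // => e' /andP[e'v /eqP ee]; rewrite -ee e'v in ev.
rewrite (big_pred1 e) // => e' /=; case: (eqVneq e' e) => [->|_]; by rewrite ?ev ?andbF.
Qed.

End Chains.

Lemma incoming_morph (G : graph) (A B : zmodType) (h : {additive A -> B})
  (c : edge G -> A) v : incoming (fun e => h (c e)) v = h (incoming c v).
Proof. by rewrite /incoming raddfB !raddf_sum. Qed.

Lemma connected_chain (G : graph) : connected_graph G -> forall u v : vert G,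
  exists c : edge G -> int,
    forall w, incoming c w = (v == w)%:R - (u == w)%:R.
Proof.
move=> /andP[_ /forallP conn] u v.
have /forallP/(_ v)/connectP[q] := conn u.
elim: q u => [|x q IH] u /=.
  by move=> _ ->; exists (fun=> 0) => w; rewrite incoming0 subrr.
case/andP=> /existsP[e ux] qx vE; have [c cE] := IH x qx vE.
pose s : int := if src e == u then 1 else -1.
exists (fun e' => c e' + (if e' == e then s else 0)) => w.
rewrite incomingD cE incoming_delta /s.
case/orP: ux => /andP[/eqP su /eqP tx].
  by rewrite su eqxx tx; case: (x == w); case: (u == w); case: (v == w).
rewrite su tx; case: (eqVneq x u) => [->|_];
by case: (x == w); case: (u == w); case: (v == w).
Qed.

(** Summation by parts: coboundary and boundary are adjoint. With w a cycle the sum vanishes; with f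
    = 1 it shows that boundaries have degree 0. *)
Lemma sum_coboundary (G : graph) (F : comPzRingType) (f : vert G -> F) (w : edge G -> F) :
  \sum_e (f (tgt e) - f (src e)) * w e = \sum_v f v * incoming w v.
Proof.
under eq_bigr do rewrite mulrBl.
under [RHS]eq_bigr do rewrite mulrBr !mulr_sumr.
rewrite !sumrB; congr (_ - _).
  rewrite (partition_big (fun e => tgt e) xpredT) //=; apply: eq_bigr => v _.
  by apply: eq_bigr => e /eqP ->.
rewrite (partition_big (fun e => src e) xpredT) //=; apply: eq_bigr => v _.
by apply: eq_bigr => e /eqP ->.
Qed.

(* Unqualified, [harmonic] is the sequence of MathComp-Analysis. *)
Notation harmonic_forms := Defs.harmonic.

Section AbelJacobi.
Variables (R : realType) (Gam : metric_graph R).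
Local Notation E := (edge Gam).
Local Notation V := (vert Gam).
Local Notation form := {ffun E -> R^o}.
Implicit Types (x y : pt Gam) (e : E) (v : V) (D : divisor Gam) (w : form).
Implicit Types (eta : form -> R) (c : E -> int).

Lemma harmonicP w : reflect (forall v, incoming w v = 0) (w \in harmonic_forms Gam).
Proof. exact: cycle_spaceP. Qed.

(** The integral of w along the segment from [vtx x] to x. *)
Definition pos_form x w : R := \sum_e edge_pos e x * w e.

Definition divisor_form D w : R := dsum (pos_form^~ w) D.

Definition vtx_count D v : int := dsum (fun x => (vtx x == v)%:R : int) D.

Lemma chain_intD c c' w :
  chain_int (fun e => c e + c' e) w = chain_int c w + chain_int c' w.
Proof. by rewrite -big_split; apply: eq_bigr => e _; rewrite intrD !mulrDl. Qed.

Lemma chain_intN c w : chain_int (fun e => - c e) w = - chain_int c w.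
Proof. by rewrite -sumrN; apply: eq_bigr => e _; rewrite intrN !mulNr. Qed.

Lemma chain_int0 w : chain_int (fun=> 0) w = 0 :> R.
Proof. by rewrite /chain_int big1 // => e _; rewrite !mul0r. Qed.

Lemma chain_int_delta e (k : int) w :
  chain_int (fun e' => if e' == e then k else 0) w = k%:~R * len e * w e.
Proof.
rewrite /chain_int (bigD1 e) //= eqxx big1 ?addr0 // => e' /negPf ->.
by rewrite !mul0r.
Qed.

(* D is the boundary of an integral chain made of full edges and of segments
   from the sources of the edges; eta is the integration along this chain. *)
Definition lift_form D eta : Prop := exists2 c : E -> int,
  forall v, incoming c v = vtx_count D v &
  forall w, w \in harmonic_forms Gam -> chain_int c w + divisor_form D w = eta w.

Lemma divisor_formE D w : divisor_form D w = \sum_e dsum (edge_pos e) D * w e.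
Proof.
rewrite /divisor_form dsum_fct_sum; apply: eq_bigr => e _.
by rewrite dsumMr.
Qed.

Lemma lift_form_eq D eta eta' : (forall w, w \in harmonic_forms Gam -> eta w = eta' w) ->
  lift_form D eta -> lift_form D eta'.
Proof. by move=> ee [c cD H]; exists c => // w wh; rewrite H ?ee. Qed.

Lemma lift_form0 : lift_form 0 (fun=> 0).
Proof.
exists (fun=> 0) => [v|w _]; first by rewrite incoming0 /vtx_count dsum0.
by rewrite chain_int0 /divisor_form dsum0 addr0.
Qed.

Lemma lift_formD D D' eta eta' : lift_form D eta -> lift_form D' eta' ->
  lift_form (D + D') (fun w => eta w + eta' w).
Proof.
move=> [c cD H] [c' cD' H']; exists (fun e => c e + c' e).
  by move=> v; rewrite incomingD cD cD' /vtx_count dsumD.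
by move=> w wh; rewrite chain_intD /divisor_form dsumD addrACA H ?H'.
Qed.

Lemma lift_formN D eta : lift_form D eta -> lift_form (- D) (fun w => - eta w).
Proof.
move=> [c cD H]; exists (fun e => - c e).
  by move=> v; rewrite incomingN cD /vtx_count dsumN.
by move=> w wh; rewrite chain_intN /divisor_form dsumN -opprD H.
Qed.

Lemma lift_formB D D' eta eta' : lift_form D eta -> lift_form D' eta' ->
  lift_form (D - D') (fun w => eta w - eta' w).
Proof. by move=> h /lift_formN; exact: lift_formD. Qed.

Lemma lift_form_sum (I : Type) (s : seq I) (D : I -> divisor Gam) (eta : I -> form -> R) :
  (forall i, lift_form (D i) (eta i)) ->
  lift_form (\sum_(i <- s) D i) (fun w => \sum_(i <- s) eta i w).
Proof.
move=> H; elim: s => [|i s IH].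
  by rewrite big_nil; apply: lift_form_eq lift_form0 => w _; rewrite big_nil.
rewrite big_cons; apply: lift_form_eq (lift_formD (H i) IH) => w _.
by rewrite big_cons.
Qed.

Lemma lift_formMz D eta (k : int) : lift_form D eta ->
  lift_form (D *~ k) (fun w => eta w *~ k).
Proof.
move=> H; have nat_case n : lift_form (D *+ n) (fun w => eta w *+ n).
  elim: n => [|n IH]; first exact: lift_form0.
  by rewrite mulrS; apply: lift_form_eq (lift_formD H IH) => w _; rewrite mulrS.
case: k => n; rewrite ?NegzE.
  exact: nat_case.
exact: lift_formN.
Qed.

(** The Abel-Jacobi theorem. For a principal D, the slopes form the chain, and the edge equations
    say that the chain with its segments is a coboundary, which is orthogonal to cycles. Conversely,
    the coefficients [r] of that chain are orthogonal to integral cycles, so summing them along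
    paths from a fixed vertex gives a potential. *)
Lemma principal_lift D : principal D <-> lift_form D (fun=> 0).
Proof.
split.
  move=> /principalP[F [b [bD Fb]]]; exists b => // w /harmonicP wh.
  rewrite divisor_formE -big_split /=.
  rewrite (eq_bigr (fun e => (F (tgt e) - F (src e)) * w e)); last first.
    by move=> e _; rewrite Fb mulrDl.
  by rewrite sum_coboundary big1 // => v _; rewrite wh mulr0.
move=> [b bD H]; apply/principalP.
pose r e := (b e)%:~R * len e + dsum (edge_pos e) D.
have rH (c : E -> int) : (forall v, incoming c v = 0) -> \sum_e r e * (c e)%:~R = 0.
  move=> c0; pose w : form := [ffun e => (c e)%:~R].
  have wh : w \in harmonic_forms Gam.
    apply/harmonicP => v; have := incoming_morph (intmul 1 : {additive int -> R}) c v.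
    rewrite c0 raddf0 => <-; rewrite /incoming /w.
    by congr (_ - _); apply: eq_bigr => e _; rewrite ffunE.
  rewrite -[RHS](H w wh) divisor_formE -big_split; apply: eq_bigr => e _ /=.
  by rewrite ffunE /r mulrDl.
have [v0 _] : exists v : V, true.
  by have /andP[/card_gt0P[v _] _] := model_connected Gam; exists v.
have [P PE] := choice (fun v => connected_chain (model_connected Gam) v0 v).
exists (fun v => \sum_e r e * (P v e)%:~R), b; split=> // e.
(* The cycle that goes to the source of e, through e, and back from its target; the vanishing of [r]
   on it is the edge equation. *)
pose c e' := P (src e) e' + (if e' == e then 1 else 0) - P (tgt e) e'.
have /rH : forall v, incoming c v = 0.
  move=> v; rewrite incomingD incomingD incomingN incoming_delta !PE.
  by case: (tgt e == v); case: (src e == v); case: (v0 == v).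
rewrite (eq_bigr (fun e' => r e' * (P (src e) e')%:~R +
    (if e' == e then r e' else 0) - r e' * (P (tgt e) e')%:~R)); last first.
  move=> e' _; rewrite /c intrD intrN intrD.
  by case: eqP => _; ring.
rewrite sumrB big_split /= -big_mkcond big_pred1_eq => H0.
by rewrite -/(r e); lra.
Qed.

(** Two chains with the same boundary differ by an integral cycle, so the functional of a divisor is
    determined up to a period. *)
Lemma lift_form_uniq D eta eta' : lift_form D eta -> lift_form D eta' ->
  exists2 c : E -> int, (forall v, incoming c v = 0) &
    forall w, w \in harmonic_forms Gam -> eta w - eta' w = chain_int c w.
Proof.
move=> [c cD H] [c' cD' H']; exists (fun e => c e - c' e) => [v|w wh].
  by rewrite incomingD incomingN cD cD' subrr.
by rewrite chain_intD chain_intN -H // -H' //; ring.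
Qed.

Lemma segment_chain e (s t : R) : 0 <= s <= len e -> 0 <= t <= len e ->
  exists2 c : E -> int,
    forall v, incoming c v = (vtx (at_ e t) == v)%:R - (vtx (at_ e s) == v)%:R &
    forall w, (t - s) * w e =
      chain_int c w + (pos_form (at_ e t) w - pos_form (at_ e s) w).
Proof.
(* At the end of the edge [vtx] jumps to the target and the position falls back to 0; [k] counts the
   full edge that makes up for it. *)
move=> hs ht; pose k (t : R) : int := (t == len e)%:R.
have posE (u : R) w : 0 <= u <= len e ->
    pos_form (at_ e u) w = (u - (k u)%:~R * len e) * w e.
  move=> hu; rewrite /pos_form (bigD1 e) //= big1 ?addr0.
    rewrite /edge_pos /k on_edge_at // eqxx /=; case: (eqVneq u (len e)) => [->|ue].
      by rewrite ltxx andbF mul1r subrr.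
    have uL : u < len e by rewrite lt_neqAle ue; case/andP: hu.
    rewrite mul0r subr0 uL andbT pos_at; last by case/andP: hu => ->.
    by case: ltgtP (andP hu).1 => // <-.
  move=> e' /negPf ee; rewrite /edge_pos on_edge_at // eq_sym ee /=.
  by rewrite mul0r.
have vtxE (u : R) v : 0 <= u <= len e ->
    (vtx (at_ e u) == v)%:R = (src e == v)%:R +
      (if tgt e == v then k u else 0) - (if src e == v then k u else 0) :> int.
  move=> hu; rewrite vtx_at // /k; case: (eqVneq u (len e)) => [->|ue].
    by rewrite ltxx; case: (src e == v); case: (tgt e == v).
  have -> : u < len e by rewrite lt_neqAle ue; case/andP: hu.
  by rewrite /=; case: (src e == v); case: (tgt e == v).
exists (fun e' => if e' == e then k t - k s else 0) => [v|w].
  rewrite incoming_delta !vtxE //.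
  by case: (src e == v); case: (tgt e == v); ring.
by rewrite chain_int_delta !posE // intrB; ring.
Qed.

(** The move of one chip along one edge, from which all explicit equivalences below are
    assembled. *)
Lemma lift_form_segment e (s t : R) : 0 <= s <= len e -> 0 <= t <= len e ->
  lift_form (<< at_ e t >> - << at_ e s >>) (fun w => (t - s) * w e).
Proof.
move=> hs ht; have [c cE H] := segment_chain hs ht; exists c.
  by move=> v; rewrite cE /vtx_count dsumB !dsum1.
by move=> w _; rewrite H /divisor_form dsumB !dsum1.
Qed.

Lemma path_chain x y p : is_path x p y -> exists2 c : E -> int,
  forall v, incoming c v = (vtx y == v)%:R - (vtx x == v)%:R &
  forall w, path_int p w = chain_int c w + (pos_form y w - pos_form x w).
Proof.
elim: p x => [|[[e s] t] p IH] x /=.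
  move=> ->; exists (fun=> 0) => [v|w]; first by rewrite incoming0 subrr.
  by rewrite /path_int big_nil chain_int0 subrr addr0.
move=> [hs ht -> /IH[c cE H]]; have [c' cE' H'] := segment_chain hs ht.
exists (fun a => c' a + c a) => [v|w]; first by rewrite incomingD cE cE'; ring.
by rewrite /path_int big_cons /= -/(path_int p w) H H' chain_intD; ring.
Qed.

Lemma paths_lift_form x0 (gam : pt Gam -> seq (E * R * R)) D :
  (forall x, is_path x0 (gam x) x) ->
  lift_form (D - << deg D *g x0 >>)
    (fun w => \sum_(x <- dom D) (coeff x D)%:~R * path_int (gam x) w).
Proof.
move=> gamP; have [c cP] := choice (fun x =>
  let: ex_intro2 c h1 h2 := path_chain (gamP x) in
  ex_intro (fun c : E -> int => (forall v, incoming c v = (vtx x == v)%:R - (vtx x0 == v)%:R) /\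
   (forall w, path_int (gam x) w = chain_int c w + (pos_form x w - pos_form x0 w))) c (conj h1 h2)).
have E0 : D - << deg D *g x0 >> = \sum_(x <- dom D) (<< x >> - << x0 >>) *~ coeff x D.
  under eq_bigr do rewrite mulrzBl.
  rewrite sumrB; congr (_ - _).
    rewrite -{1}(freeg_sumE D); apply: eq_bigr => x _.
    by rewrite freeg_mulz mulrzz mul1r.
  rewrite deg_dsum /dsum -[RHS]mulrz_sumr freeg_mulz mulrzz mul1r.
  by congr << _ *g _ >>; apply: eq_bigr => x _; rewrite intz.
rewrite E0; apply: lift_form_eq; last first.
  apply: (@lift_form_sum _ _ _ (fun x w => path_int (gam x) w *~ coeff x D)) => x.
  apply: lift_formMz; have [h1 h2] := cP x; exists (c x) => [v|w _].
    by rewrite h1 /vtx_count dsumB !dsum1.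
  by rewrite h2 /divisor_form dsumB !dsum1.
by move=> w _; apply: eq_bigr => x _; rewrite mulrzl.
Qed.

Lemma lift_form_exists D : deg D = 0 -> exists eta, lift_form D eta.
Proof.
move=> D0; have [v0 _] : exists v : V, true.
  by have /andP[/card_gt0P[v _] _] := model_connected Gam; exists v.
have [gam gamP] := choice (fun x => path_exists (inl v0) x).
have := paths_lift_form D gamP; rewrite D0.
by rewrite freegU0 subr0 => H; eexists; exact: H.
Qed.

(** Projecting to harmonic forms makes phi a function on all edge forms, comparable with the
    functionals of [lift_form]. *)
Definition dual_form (phi : harmonic_dual Gam) : form -> R :=
  fun w => phi (vsproj (harmonic_forms Gam) w).

(** The paths and the period of [lifts] merge into one integral chain with segments. Conversely, any
    choice of paths will do: the discrepancy is a period. *)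
Lemma lifts_lift_form x0 phi D d : deg D = d%:Z ->
  lifts x0 phi D <-> lift_form (D - << d%:Z *g x0 >>) (dual_form phi).
Proof.
move=> Dd; split.
  move=> [gam [c [gamP c0 phiE]]].
  have H := paths_lift_form D gamP; rewrite Dd in H.
  have Hc : lift_form 0 (fun w => chain_int c w).
    exists c => [v|w _]; first by rewrite c0 /vtx_count dsum0.
    by rewrite /divisor_form dsum0 addr0.
  have := lift_formD H Hc; rewrite addr0; apply: lift_form_eq => w wh.
  by rewrite /dual_form phiE vsprojK.
move=> Hphi; have [gam gamP] := choice (fun x => path_exists x0 x).
have H := paths_lift_form D gamP; rewrite Dd in H.
have [c c0 cE] := lift_form_uniq Hphi H.
exists gam, c; split=> // w; have := cE (vsval w) (valP w).
rewrite /dual_form vsvalK => /eqP; rewrite subr_eq => /eqP ->.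
by rewrite addrC.
Qed.

Lemma lifts_lin_equiv x0 phi D D' d : deg D = d%:Z -> deg D' = d%:Z ->
  lifts x0 phi D -> lifts x0 phi D' -> lin_equiv D D'.
Proof.
move=> Dd Dd' /(lifts_lift_form _ _ Dd) h /(lifts_lift_form _ _ Dd') h'.
apply/principal_lift; have := lift_formB h h'.
rewrite opprB addrA subrK; apply: lift_form_eq => w _; exact: subrr.
Qed.

Lemma dual_coords (phi : harmonic_dual Gam) : exists r : E -> R,
  forall w, w \in harmonic_forms Gam -> dual_form phi w = \sum_e r e * w e.
Proof.
pose delta e : form := [ffun e' => (e' == e)%:R].
exists (fun e => dual_form phi (delta e)) => w wh.
have wE : w = \sum_e w e *: delta e.
  apply/ffunP => e; rewrite sum_ffunE (bigD1 e) //= big1 ?addr0.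
    by rewrite !ffunE eqxx /GRing.scale /= mulr1.
  by move=> e' /negPf ee; rewrite !ffunE eq_sym ee scaler0.
rewrite {1}wE /dual_form !linear_sum; apply: eq_bigr => e _.
by rewrite !linearZ /= mulrC.
Qed.

Lemma lift_form_surj (r : E -> R) : exists2 D, deg D = 0 &
  lift_form D (fun w => \sum_e r e * w e).
Proof.
(* A displacement [r e] of any size along e is split into [n e] full edges and a remainder [t e]
   that fits on the edge. *)
pose n e := Num.floor (r e / len e); pose t e := r e - (n e)%:~R * len e.
have te e : 0 <= t e <= len e.
  have L0 := len_gt0 e; have /andP[] := floor_itv (r e / len e).
  rewrite -/(n e) ler_pdivlMr // ltr_pdivrMr // intrD mulrDl mul1r /t; lra.
have [h0 hL] : (forall e, 0 <= (0 : R) <= len e) /\ (forall e, 0 <= len e <= len e).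
  by split=> e; have := len_gt0 e; lra.
exists (\sum_e ((<< at_ e (t e) >> - << at_ e 0 >>) +
                (<< at_ e (len e) >> - << at_ e 0 >>) *~ n e)).
  by rewrite raddf_sum big1 // => e _; rewrite /= degD raddfMz /= !degB !degU subrr mul0rz.
apply: lift_form_eq; last first.
  apply: lift_form_sum => e; apply: lift_formD (lift_formMz _ _).
    exact: lift_form_segment (h0 e) (te e).
  exact: lift_form_segment (h0 e) (hL e).
move=> w _ /=; apply: eq_bigr => e _; rewrite /t -mulrzl; ring.
Qed.

Lemma lifts_surj x0 phi d : exists2 D, deg D = d%:Z & lifts x0 phi D.
Proof.
have [r rE] := dual_coords phi; have [D D0 H] := lift_form_surj r.
have Dd : deg (D + << d%:Z *g x0 >>) = d%:Z by rewrite degD D0 degU add0r.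
exists (D + << d%:Z *g x0 >>) => //; apply/(lifts_lift_form _ _ Dd).
rewrite addrK; apply: lift_form_eq H => w wh; by rewrite rE.
Qed.

(* Test an integral cycle against itself: its pairing with itself is at least
   the least edge length times the sum of the squares of its coefficients. *)
Lemma period_discrete (r : E -> R) : exists2 d : R, 0 < d & forall t, `|t| < d ->
  (exists2 c : E -> int, (forall v, incoming c v = 0) &
    forall w, w \in harmonic_forms Gam -> t * (\sum_e r e * w e) = chain_int c w) ->
  forall w, w \in harmonic_forms Gam -> t * (\sum_e r e * w e) = 0.
Proof.
have [m m0 mL] := min_len Gam; pose B := 1 + \sum_e `|r e|.
have B0 : 0 < B by apply: ltr_wpDr => //; exact: sumr_ge0.
have rB e : `|r e| <= B.
  rewrite /B (bigD1 e) //= addrCA lerDl addr_ge0 //; exact: sumr_ge0.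
exists (m / B); first exact: divr_gt0.
move=> t; rewrite ltr_pdivlMr // => tB [c c0 cE] w wh; rewrite cE //.
pose z : form := [ffun e => (c e)%:~R].
have zh : z \in harmonic_forms Gam.
  apply/harmonicP => v; have := incoming_morph (intmul 1 : {additive int -> R}) c v.
  rewrite c0 raddf0 => <-; rewrite /incoming /z.
  by congr (_ - _); apply: eq_bigr => e _; rewrite ffunE.
pose S : R := \sum_e (c e)%:~R ^+ 2.
have lo : m * S <= chain_int c z.
  rewrite mulr_sumr; apply: ler_sum => e _; rewrite ffunE.
  have := mL e; have : 0 <= ((c e)%:~R : R) ^+ 2 by exact: sqr_ge0.
  by move=> h1 h2; rewrite mulrAC -expr2 mulrC; apply: ler_wpM2l.
have hi : chain_int c z <= `|t| * B * S.
  rewrite -(cE _ zh) mulr_sumr; apply: le_trans (ler_norm _) _.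
  apply: le_trans (ler_norm_sum _ _ _) _; rewrite mulr_sumr; apply: ler_sum => e _.
  rewrite ffunE !normrM -mulrA ler_wpM2l //; apply: ler_pM => //.
  (* An integer is bounded in absolute value by its square. *)
  have [->|cne] := eqVneq (c e) 0; first by rewrite normr0 expr0n.
  rewrite -real_normK ?num_real // expr2 ler_peMl //.
  by rewrite -intr_norm ler1z; case: (c e) cne => // -[].
have S0 : S = 0.
  apply/eqP; rewrite eq_le; apply/andP; split; last first.
    by apply: sumr_ge0 => e _; exact: sqr_ge0.
  rewrite leNgt; apply/negP => Sp.
  have := le_trans lo hi; rewrite ler_pM2r // leNgt tB //.
rewrite /chain_int big1 // => e _.
suff -> : (c e)%:~R = 0 :> R by rewrite !mul0r.
apply/eqP; rewrite -sqrf_eq0; apply/eqP.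
move/eqP: S0; rewrite psumr_eq0; last by move=> ? _; exact: sqr_ge0.
by move=> /allP/(_ e); rewrite mem_index_enum => /(_ isT)/eqP.
Qed.

End AbelJacobi.

(** * Dimension of Brill-Noether loci *)

Section Dimension.
Variables (R : realType) (Gam : metric_graph R).
Implicit Types (D : divisor Gam) (phi : harmonic_dual Gam) (r d : nat).
Local Notation form := {ffun edge Gam -> R^o}.

Lemma lin_equiv_refl D : lin_equiv D D.
Proof. by rewrite /lin_equiv subrr; apply/principal_lift; exact: lift_form0. Qed.

Lemma lin_equiv_sym D D' : lin_equiv D D' -> lin_equiv D' D.
Proof.
move=> /principal_lift/lift_formN H; apply/principal_lift; rewrite -opprB.
by apply: lift_form_eq H => w _; rewrite oppr0.
Qed.

Lemma lin_equiv_trans D1 D2 D3 : lin_equiv D1 D2 -> lin_equiv D2 D3 -> lin_equiv D1 D3.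
Proof.
move=> /principal_lift H /principal_lift H'; apply/principal_lift.
have := lift_formD H H'; rewrite addrA subrK.
by apply: lift_form_eq => w _; rewrite addr0.
Qed.

Lemma div_class_eq D D' : lin_equiv D D' -> div_class D = div_class D'.
Proof.
move=> H; apply/seteqP; split=> X /= HX; last exact: lin_equiv_trans HX.
exact: lin_equiv_trans (lin_equiv_sym H) HX.
Qed.

Lemma div_class_inj D D' : div_class D = div_class D' -> lin_equiv D D'.
Proof.
move=> E; have : div_class D' D' by exact: lin_equiv_refl.
by rewrite -E => H; exact: H.
Qed.

Lemma dual_formB phi psi w : dual_form (phi - psi) w = dual_form phi w - dual_form psi w.
Proof. by rewrite /dual_form add_lfunE opp_lfunE. Qed.

Lemma dual_formZ (a : R) phi w : dual_form (a *: phi) w = a * dual_form phi w.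
Proof. by rewrite /dual_form scale_lfunE. Qed.

Lemma lifts_diff (x0 : pt Gam) phi psi D D' d : deg D = d%:Z -> deg D' = d%:Z ->
  lifts x0 phi D -> lifts x0 psi D' ->
  lift_form (D - D') (fun w => dual_form phi w - dual_form psi w).
Proof.
move=> Dd Dd' /(lifts_lift_form _ _ Dd) h /(lifts_lift_form _ _ Dd') h'.
by have := lift_formB h h'; rewrite opprB addrA subrK.
Qed.

Lemma lifts_exists (x0 : pt Gam) D d : deg D = d%:Z -> exists phi, lifts x0 phi D.
Proof.
move=> Dd; have [eta H] : exists eta, lift_form (D - << d%:Z *g x0 >>) eta.
  by apply: lift_form_exists; rewrite degB Dd degU subrr.
case: H => c cE _.
pose phi0 (u : subvs_of (harmonic_forms Gam)) : R^o :=
  chain_int c (vsval u) + divisor_form (D - << d%:Z *g x0 >>) (vsval u).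
have phi0L : linear phi0.
  move=> a u v; rewrite /phi0 linearP !divisor_formE /chain_int -!big_split.
  rewrite scaler_sumr -big_split; apply: eq_bigr => e _ /=.
  by rewrite !ffunE /GRing.scale /=; ring.
pose mL := GRing.isLinear.Build _ _ _ _ phi0 phi0L.
pose phi1 : {linear subvs_of (harmonic_forms Gam) -> R^o} := HB.pack phi0 mL.
exists (linfun phi1); apply/(lifts_lift_form _ _ Dd); exists c => // w wh.
by rewrite /dual_form lfunE /= /phi0 vsprojK.
Qed.

Lemma conv_hull_single (W : vectType R) (s : seq W) x0 :
  (forall x, x \in s -> x = x0) -> conv_hull s `<=` [set x0].
Proof.
move=> H x [a [_ a1 ->]] /=.
rewrite (eq_bigr (fun i => a i *: x0)) -?scaler_suml ?a1 ?scale1r // => i _.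
by rewrite (H s`_i) // mem_nth.
Qed.

(** A dimension is a natural number, or -oo for the empty list, so below 1 only points and the empty
    set remain. *)
Lemma polytope_dim_lt1 (W : vectType R) (s : seq W) :
  (polytope_dim s < 1%:E)%E <-> exists x0, forall x, x \in s -> x = x0.
Proof.
rewrite /polytope_dim; case: s => [|x0 s].
  by split=> _; [exists 0|exact: ltNyr].
rewrite lte_fin (ltr_nat R _ 1) ltnS leqn0 dimv_eq0; split.
  move=> /eqP span0; exists x0 => x xs.
  have : x - x0 \in <<[seq y - x0 | y <- x0 :: s]>>%VS.
    by apply: memv_span; exact: (map_f (fun y : W => y - x0) xs).
  by rewrite span0 memv0 subr_eq0 => /eqP.
move=> [y Hy]; rewrite -subv0; apply/span_subvP => _ /mapP[x xs ->].
by rewrite (Hy x xs) (Hy x0 (mem_head _ _)) subrr mem0v.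
Qed.

(** On a segment inside a polytope, a point close to one end lifts a divisor equivalent to that of
    the end, as S has only one class. Their difference is a short period in the direction of the
    segment, hence zero, and the segment is a point. *)
Lemma polyhedral_dim_lt1 d (S : set (set (divisor Gam))) n :
  (forall D D', deg D = d%:Z -> deg D' = d%:Z ->
     S (div_class D) -> S (div_class D') -> lin_equiv D D') ->
  polyhedral_of_dim d S n -> (n < 1%:E)%E.
Proof.
move=> HS [x0 [ps [SE ->]]].
rewrite big_seq; apply: (big_ind (fun y : \bar R => (y < 1%:E)%E)).
- exact: ltNyr.
- by move=> y z yl zl; rewrite gt_max yl zl.
move=> s sps; apply/polytope_dim_lt1; case: s sps => [|p0 s] sps; first by exists 0.
exists p0 => x xs; apply/eqP; rewrite -subr_eq0; apply/eqP.
have [c0 c0E] := dual_coords (x - p0); have [e e0 He] := period_discrete c0.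
(* t < 1 keeps the point on the segment, and t < e makes the discreteness of periods apply. *)
pose t := Num.min e 1 / 2.
have m0 : 0 < Num.min e 1 by rewrite lt_min e0 ltr01.
have m1 : Num.min e 1 <= e by rewrite ge_min lexx.
have m2 : Num.min e 1 <= 1 by rewrite ge_min lexx orbT.
have t0 : 0 < t by rewrite /t; lra.
have te : t < e by rewrite /t; lra.
have t1 : t < 1 by rewrite /t; lra.
clearbody t.
have inS a : 0 <= a <= 1 -> union_polytopes ps (p0 + a *: (x - p0)).
  move=> a01; exists (p0 :: s) => //; rewrite /conv_hull /=.
  have [j jx] : exists j : 'I_(size (p0 :: s)), (p0 :: s)`_j = x.
    by have xi := xs; rewrite -index_mem in xi; exists (Ordinal xi); rewrite nth_index.
  (* The weights are added because j may itself be [ord0]. *)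
  exists (fun i => (if i == ord0 then 1 - a else 0) + (if i == j then a else 0)); split.
  - by move=> i; case: eqP; case: eqP => _ _; lra.
  - by rewrite big_split /= -!big_mkcond !big_pred1_eq subrK.
  under eq_bigr do rewrite scalerDl.
  rewrite big_split /=.
  rewrite (bigD1 ord0) //= big1; last by move=> i /negPf ->; rewrite scale0r.
  rewrite (bigD1 j) //= eqxx [X in _ + (_ + X)]big1; last by move=> i /negPf ->; rewrite scale0r.
  by rewrite jx !addr0 scalerBl scale1r scalerBr addrAC addrA.
have [D0 D0d D0l] := lifts_surj x0 (p0 + 0 *: (x - p0)) d.
have [D1 D1d D1l] := lifts_surj x0 (p0 + t *: (x - p0)) d.
have h0 : 0 <= (0 : R) <= 1 by lra.
have h1 : 0 <= t <= 1 by lra.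
have D10 : lin_equiv D1 D0.
  apply: HS => //; rewrite SE; [exists D1|exists D0] => //; split=> //.
    by exists (p0 + t *: (x - p0)) => //; exact: inS.
  by exists (p0 + 0 *: (x - p0)) => //; exact: inS.
have [k k0 kE] := lift_form_uniq (lifts_diff D1d D0d D1l D0l)
  ((principal_lift _).1 D10).
have Hex : exists2 c : edge Gam -> int, (forall v, incoming c v = 0) &
    forall w, w \in harmonic_forms Gam -> t * (\sum_e c0 e * w e) = chain_int c w.
  exists k => // w wh; rewrite -kE // subr0 -dual_formB -c0E //.
  rewrite opprD addrACA subrr add0r scale0r subr0 dual_formZ //.
have key w : w \in harmonic_forms Gam -> dual_form (x - p0) w = 0.
  move=> wh; rewrite c0E //; have := He t; rewrite gtr0_norm // => /(_ te Hex w wh) /eqP.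
  by rewrite mulf_eq0 gt_eqF //= => /eqP.
apply/lfunP => u; have := key _ (valP u).
by rewrite /dual_form vsvalK zero_lfunE.
Qed.

(** A presentation has to exist, since [pic_dim] is +oo otherwise: a single class is the image of
    one point, and an empty locus that of no polytope. Whichever value is picked is then bounded by
    [polyhedral_dim_lt1]. *)
Lemma dim_BN_lt1 r d :
  (forall D D', deg D = d%:Z -> deg D' = d%:Z ->
     r%:Z <= div_rank D -> r%:Z <= div_rank D' -> lin_equiv D D') ->
  (dim_BN Gam r d < 1%:E)%E.
Proof.
move=> H; have HS D D' : deg D = d%:Z -> deg D' = d%:Z ->
    BN_locus r d (div_class D) -> BN_locus r d (div_class D') -> lin_equiv D D'.
  move=> _ _ [X [Xd Xr] /div_class_inj XD] [X' [Xd' Xr'] /div_class_inj XD'].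
  apply: lin_equiv_trans (lin_equiv_sym XD) _; apply: lin_equiv_trans XD'.
  exact: H.
apply: (polyhedral_dim_lt1 HS); rewrite /dim_BN /pic_dim; apply: (xgetPex +oo%E).
have [v0 _] : exists v : vert Gam, true.
  by have /andP[/card_gt0P[v _] _] := model_connected Gam; exists v.
have [[D [Dd Dr]]|none] := pselect (exists D, deg D = d%:Z /\ r%:Z <= div_rank D).
  have [phi phiD] := lifts_exists (inl v0) Dd.
  exists (\big[maxe/-oo%E]_(s <- [:: [:: phi]]) polytope_dim s), (inl v0), [:: [:: phi]].
  split=> //; apply/seteqP; split=> [_ [X [Xd Xr] <-]|_ [X [Xd [psi psiP Xl]] <-]].
    exists D; last by apply: div_class_eq; exact: H.
    split=> //; exists phi => //; exists [:: phi]; first by rewrite /= inE.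
    exists (fun=> 1); split=> //; first by rewrite big_ord1.
    by rewrite big_ord1 scale1r.
  exists D => //; apply: div_class_eq; apply: (lifts_lin_equiv Dd Xd phiD).
  case: psiP => s /=; rewrite inE => /eqP -> /(@conv_hull_single _ _ phi) E.
  by rewrite -E // => y; rewrite inE => /eqP.
exists (\big[maxe/-oo%E]_(s <- [::]) polytope_dim (s : seq (harmonic_dual Gam))), (inl v0), [::].
split=> //; apply/seteqP; split; first by move=> C [X XP _]; case: none; exists X.
by move=> C [X [_ [psi [s sP _] _]] _].
Qed.

(** In dimension below 1 every polytope is at most a point and carries at most one class, so one
    class more than there are polytopes contradicts the pigeonhole principle. The default value +oo
    is not below 1 either. *)
Lemma dim_BN_ge1 r d :
  (forall n, exists D : 'I_n -> divisor Gam,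
     (forall i, deg (D i) = d%:Z /\ r%:Z <= div_rank (D i)) /\
     (forall i j, lin_equiv (D i) (D j) -> i = j)) ->
  ~ (dim_BN Gam r d < 1%:E)%E.
Proof.
move=> H; rewrite /dim_BN /pic_dim; case: xgetP => [n _|_]; last by rewrite ltNge leey.
move=> [x0 [ps [SE nE]]] n1; have [D [Dr Dinj]] := H (size ps).+1.
have single s : s \in ps -> exists x0, forall x, x \in s -> x = x0.
  move=> sps; apply/polytope_dim_lt1; apply: le_lt_trans n1; rewrite nE.
  by rewrite (big_rem s) //= le_max lexx.
have center s : exists c, s \in ps -> forall x, x \in s -> x = c.
  by case: (boolP (s \in ps)) => [/single [c cP]|_]; [exists c|exists 0].
have [ctr ctrP] := choice center.
have loc i : exists k : 'I_(size ps), exists2 X, deg X = d%:Z &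
    lin_equiv (D i) X /\ lifts x0 (ctr (nth [::] ps k)) X.
  have : BN_locus r d (div_class (D i)) by exists (D i).
  rewrite SE => -[X [Xd [phi [s /= sps phis] Xl]] /div_class_inj XD].
  have si : (index s ps < size ps)%N by rewrite index_mem.
  exists (Ordinal si), X => //; split; first exact: lin_equiv_sym.
  rewrite /= nth_index //.
  by have /(_ _ phis) /= <- := @conv_hull_single _ s (ctr s) (ctrP s sps).
have [k kP] := choice loc.
have kinj : injective k.
  move=> i j kij; apply: Dinj.
  have [X Xd [DX XL]] := kP i; have [Y Yd [DY YL]] := kP j.
  apply: lin_equiv_trans DX _; apply: lin_equiv_trans (lin_equiv_sym DY).
  by apply: lifts_lin_equiv Xd Yd XL _; rewrite kij.
by have := leq_card k kinj; rewrite !card_ord ltnn.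
Qed.

End Dimension.

Lemma isometric_dim_BN_lt1 (R : realType) (Gam Gam' : metric_graph R) r d :
  isometric Gam Gam' ->
  (forall D D' : divisor Gam, deg D = d%:Z -> deg D' = d%:Z ->
     r%:Z <= div_rank D -> r%:Z <= div_rank D' -> lin_equiv D D') ->
  (dim_BN Gam' r d < 1%:E)%E.
Proof.
move=> /isometric_divisors[p [p' [pK p'K pd pl pr]]] H.
apply: dim_BN_lt1 => D D'; rewrite -[D]p'K -[D']p'K !pd !pr => *.
by apply/pl; exact: H.
Qed.

Lemma isometric_dim_BN_ge1 (R : realType) (Gam Gam' : metric_graph R) r d :
  isometric Gam Gam' ->
  (forall n, exists D : 'I_n -> divisor Gam,
     (forall i, deg (D i) = d%:Z /\ r%:Z <= div_rank (D i)) /\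
     (forall i j, lin_equiv (D i) (D j) -> i = j)) ->
  ~ (dim_BN Gam' r d < 1%:E)%E.
Proof.
move=> /isometric_divisors[p [p' [pK p'K pd pl pr]]] H.
apply: dim_BN_ge1 => n; have [D [DP Dinj]] := H n.
exists (fun i => p (D i)); split=> [i|i j /pl /Dinj //].
by rewrite pd pr; exact: DP.
Qed.

(** * Rank and cuts *)

Section Rank.
Variables (R : realType) (Gam : metric_graph R).
Local Notation E := (edge Gam).
Local Notation V := (vert Gam).
Implicit Types (D : divisor Gam) (x : pt Gam) (v : V) (e : E).

Lemma deg_vtx D : deg D = \sum_v vtx_count D v.
Proof.
rewrite deg_dsum -dsum_fct_sum; apply: eq_dsum => x.
by rewrite (bigD1 (vtx x)) //= eqxx big1 // => v; rewrite eq_sym => /negPf ->.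
Qed.

Lemma deg_coeff_edge D : deg D = \sum_v coeff (inl v) D + \sum_e edge_deg e D.
Proof.
rewrite deg_vtx (eq_bigr _ (fun v _ => dsum_vtx D v)) big_split; congr (_ + _).
by rewrite [RHS](partition_big (fun e => src e) xpredT).
Qed.

Lemma deg_principal D : principal D -> deg D = 0.
Proof.
move=> /principalP[F [b [bD _]]]; rewrite deg_vtx.
have := sum_coboundary (fun=> 1 : int) b.
rewrite (eq_bigr (fun=> 0)) ?big1_eq; last by move=> e _; rewrite subrr mul0r.
by move=> H; rewrite [RHS]H; apply: eq_bigr => v _; rewrite bD mul1r.
Qed.

Lemma deg_lin_equiv D D' : lin_equiv D D' -> deg D = deg D'.
Proof. by move=> /deg_principal; rewrite degB => /eqP; rewrite subr_eq0 => /eqP. Qed.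

Lemma effective_deg_ge0 D : effective D -> 0 <= deg D.
Proof.
move=> eD; rewrite deg_dsum; apply: sumr_ge0 => x _.
by rewrite intz; exact: eD.
Qed.

Lemma effective_deg0 D : effective D -> deg D = 0 -> D = 0.
Proof. by move=> eD; apply: fgpos_eq0P; apply/fgposP. Qed.

Lemma effective_deg1 D : effective D -> deg D = 1 -> exists x, D = << x >>.
Proof. by move=> eD; apply: deg1pos; apply/fgposP. Qed.

Lemma effectiveD D D' : effective D -> effective D' -> effective (D + D').
Proof. by move=> eD eD' x; rewrite coeffD addr_ge0. Qed.

Lemma effectiveU (k : int) x : 0 <= k -> effective (<< k *g x >> : divisor Gam).
Proof. by move=> k0 y; rewrite coeffU mulr_ge0. Qed.

Lemma effective_sub_pt D x : effective D -> 0 < coeff x D -> effective (D - << x >>).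
Proof.
move=> eD xD y; rewrite coeffB coeffU mul1r.
by case: eqP => [<-|_]; [rewrite subr_ge0|rewrite subr0].
Qed.

Lemma rank_ge1_through D x : 1 <= div_rank D ->
  exists D', [/\ lin_equiv D D', effective D' & 0 < coeff x D'].
Proof.
rewrite /div_rank; case: ifP => // _; case: xgetP => [n _ [Dn _]|_] // n1.
(* The test is known to succeed only for n, the rank itself; n chips at x give at least one since n
   >= 1. *)
have [||D' DD' eD'] := Dn << n%:Z *g x >>; first exact: effectiveU.
- by rewrite degU.
exists D'; split=> //.
  by rewrite -(subrK << n%:Z *g x >> D'); apply: effectiveD => //; exact: effectiveU.
have := eD' x; rewrite coeffB coeffU eqxx mulr1 subr_ge0; exact: lt_le_trans.
Qed.

Lemma rank_test_le D n : rank_test D n -> n%:Z <= deg D.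
Proof.
have [v0 _] : exists v : V, true.
  by have /andP[/card_gt0P[v _] _] := model_connected Gam; exists v.
move=> /(_ << n%:Z *g inl v0 >>)[||D' DD' eD']; first exact: effectiveU.
- by rewrite degU.
rewrite (deg_lin_equiv DD'); have := effective_deg_ge0 eD'.
by rewrite degB degU subr_ge0.
Qed.

(** [div_rank] falls back to 0 unless a greatest successful n exists; it does, as the degree bounds
    all of them. *)
Lemma rank_test1_ge D : rank_test D 1 -> 1 <= div_rank D.
Proof.
move=> D1; rewrite /div_rank; have [v0 _] : exists v : V, true.
  by have /andP[/card_gt0P[v _] _] := model_connected Gam; exists v.
have -> : `[< exists2 D', lin_equiv D D' & effective D' >].
  apply/asboolP; have [||D' DD' eD'] := D1 << inl v0 >>; first exact: effectiveU.
  - by rewrite degU.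
  exists D' => //; rewrite -(subrK << inl v0 >> D'); apply: effectiveD => //.
  exact: effectiveU.
set S := (X in xget _ X).
have [m mS] : exists m, S m.
  have exP : exists n, `[< rank_test D n >] by exists 1%N; apply/asboolP.
  have ubP n : `[< rank_test D n >] -> (n <= `|deg D|)%N.
    by move=> /asboolP /rank_test_le; lia.
  case: (ex_maxnP exP ubP) => m /asboolP Dm Hm; exists m; split=> // k Dk.
  by apply: Hm; apply/asboolP.
have [_ H] : S (xget 0%N S) by apply: (xgetPex 0%N); exists m.
by rewrite lez_nat; exact: H.
Qed.

Lemma edge_deg_ge0 D e : effective D -> 0 <= edge_deg e D.
Proof.
move=> eD; apply: sumr_ge0 => x _; rewrite -mulrzl intz mulr_ge0 //; exact: eD.
Qed.

Lemma edge_deg_gt0 D e : effective D -> 0 < edge_deg e D ->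
  exists2 x, on_edge e x & 0 < coeff x D.
Proof.
move=> eD; rewrite lt0r => /andP[ne _]; apply: contrapT => none.
move/negP: ne; apply; apply/eqP; rewrite /edge_deg /dsum big1_seq // => x _.
case: (boolP (on_edge e x)) => xe; last by rewrite mul0rz.
have := eD x; rewrite le_eqVlt => /orP[/eqP <-|x0]; first by rewrite mulr0z.
by case: none; exists x.
Qed.

Lemma dsum_ge0 D (u : pt Gam -> R) : effective D -> (forall x, 0 <= u x) -> 0 <= dsum u D.
Proof.
move=> eD u0; apply: sumr_ge0 => x _; rewrite -mulrzl mulr_ge0 // ler0z; exact: eD.
Qed.

Lemma edge_pos_bounds e x : 0 <= edge_pos e x <= (on_edge e x)%:R * len e.
Proof.
rewrite /edge_pos; case: (boolP (on_edge e x)) => [/on_edge_pos|_] /=.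
  by rewrite mul1r => /andP[/ltW -> /ltW ->].
by rewrite mul0r lexx.
Qed.

Lemma dsum_edge_pos_ge0 D e : effective D -> 0 <= dsum (edge_pos e) D.
Proof. by move=> eD; apply: dsum_ge0 => // x; have /andP[] := edge_pos_bounds e x. Qed.

Lemma dsum_edge_pos_compl D e :
  (edge_deg e D)%:~R * len e - dsum (edge_pos e) D =
  dsum (fun x => (on_edge e x)%:R * len e - edge_pos e x) D.
Proof. by rewrite dsum_fctD dsum_fctN dsumMr -dsum_natr. Qed.

Lemma dsum_edge_pos_le D e : effective D ->
  dsum (edge_pos e) D <= (edge_deg e D)%:~R * len e.
Proof.
move=> eD; rewrite -subr_ge0 dsum_edge_pos_compl; apply: dsum_ge0 => // x.
by rewrite subr_ge0; have /andP[] := edge_pos_bounds e x.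
Qed.

(** One chip inside e is split off: it is at positive distance from both ends, and the others
    satisfy the weak bounds. *)
Lemma dsum_edge_pos_strict D e : effective D -> 0 < edge_deg e D ->
  0 < dsum (edge_pos e) D < (edge_deg e D)%:~R * len e.
Proof.
move=> eD /(edge_deg_gt0 eD)[x xe xD].
have eDx := effective_sub_pt eD xD.
have := dsum_edge_pos_ge0 e eDx; have := dsum_edge_pos_le e eDx.
rewrite /edge_deg !dsumB !dsum1 xe intrB mulrBl mul1r.
have := on_edge_pos xe; rewrite /edge_pos xe.
by lra.
Qed.

End Rank.

(** * Effective divisors and edge cuts *)

Section Cuts.
Variables (R : realType) (Gam : metric_graph R).
Local Notation E := (edge Gam).
Local Notation V := (vert Gam).
Implicit Types (D : divisor Gam) (x : pt Gam) (v : V) (e : E).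

Definition cut (U : {set V}) : {set E} := [set e | (src e \in U) != (tgt e \in U)].

(** Leaving U along a cut edge, the function has to descend. Either it does so at once, which counts
    as a positive incoming slope at the end in U, or its slope drops at a chip of D inside the edge.
    So each cut edge costs a chip of D. *)
Lemma deg_ge_cut D D' (U : {set V}) (F : V -> R) b :
  effective D -> effective D' -> edge_potential (D - D') F b ->
  (forall u v, u \in U -> v \notin U -> F v < F u) ->
  (#|cut U|)%:Z <= deg D.
Proof.
move=> eD eD' [bD Fb] FU.
pose K e := edge_deg e D - edge_deg e D'.
have DU : \sum_(u in U) (coeff (inl u) D - coeff (inl u) D') =
    \sum_(e | tgt e \in U) b e - \sum_(e | src e \in U) (b e + K e).
  rewrite (eq_bigr (fun u => \sum_(e | tgt e == u) b e - \sum_(e | src e == u) (b e + K e))).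
    rewrite sumrB; congr (_ - _).
      rewrite [RHS](partition_big (fun e => tgt e) (mem U)) //=; apply: eq_bigr => u uU.
      by apply: eq_bigl => e; case: eqP => [->|_]; rewrite ?andbF // andbT.
    rewrite [RHS](partition_big (fun e => src e) (mem U)) //=; apply: eq_bigr => u uU.
    by apply: eq_bigl => e; case: eqP => [->|_]; rewrite ?andbF // andbT.
  move=> u _; have H := bD u; rewrite dsum_vtx coeffB /incoming in H.
  rewrite [X in _ = _ + X](eq_bigr K) in H; last by move=> e _; rewrite /edge_deg dsumB.
  by rewrite big_split /= opprD addrA H addrK.
(* The right side adds the incoming slopes of e at its ends in U, [b e] at the target and
   [- (b e + K e)] at the source, to the chips of D inside e. *)
have term e : (e \in cut U : nat)%:Z <=
    (if tgt e \in U then b e else 0) - (if src e \in U then b e + K e else 0) + edge_deg e D.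
  rewrite inE.
  have := edge_deg_ge0 e eD; have := edge_deg_ge0 e eD'.
  have := Fb e; rewrite dsumB.
  have L0 := len_gt0 e.
  have := dsum_edge_pos_ge0 e eD; have := dsum_edge_pos_le e eD.
  have := dsum_edge_pos_ge0 e eD'; have := dsum_edge_pos_le e eD'.
  rewrite /K; case: (boolP (src e \in U)) => sU; case: (boolP (tgt e \in U)) => tU /=.
  - by clear; move=> *; lia.
  - have lt := FU _ _ sU tU => h1 h2 h3 h4 h5 h6 h7.
    suff : b e + (edge_deg e D - edge_deg e D') < edge_deg e D by clear; lia.
    rewrite -(ltr_int R) -(ltr_pM2r L0) intrD intrB.
    by clear -lt h1 h2 h3 h4 h5; lra.
  - have lt := FU _ _ tU sU => h1 h2 h3 h4 h5 h6 h7.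
    suff : - edge_deg e D < b e by clear; lia.
    rewrite -(ltr_int R) -(ltr_pM2r L0) intrN.
    by clear -lt h1 h2 h3 h4 h5; lra.
  - by clear; move=> *; lia.
rewrite deg_coeff_edge -sum1_card big_mkcond.
rewrite (big_morph Posz PoszD (erefl _)) /=.
apply: le_trans (_ : \sum_(u in U) (coeff (inl u) D - coeff (inl u) D') +
  \sum_e edge_deg e D <= _).
  rewrite DU [X in X - _]big_mkcond [X in _ - X]big_mkcond -sumrB -big_split.
  by apply: ler_sum => e _ /=; have := term e; case: (e \in cut U).
rewrite lerD2r [leRHS](bigID (mem U)) /= -[leLHS]addr0; apply: lerD.
  by apply: ler_sum => u _; rewrite gerBl; exact: eD'.
by apply: sumr_ge0 => u _; exact: eD.
Qed.

Lemma two_inner_chips D D' v : effective D -> effective D' -> lin_equiv D D' ->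
  coeff (inl v) D = 0 -> 0 < coeff (inl v) D' ->
  (forall (U : {set V}) u w, u \in U -> w \notin U -> deg D < (#|cut U|)%:Z) ->
  exists e, 2 <= edge_deg e D.
Proof.
move=> eD eD' /principalP[F [b Fpot]] D0 D'0 Hcut.
have [Fb' FbE] := Fpot.
have [m mP] : exists m, forall u, F u <= F m.
  exists [arg max_(u > v) F u]%O; case: arg_maxP => // i _ H u; exact: H.
pose U : {set V} := finset (fun u => F u == F m).
have Fc w : F w = F m.
  apply/eqP/negPn/negP => wm; have mU : m \in U by rewrite inE.
  have wU : w \notin U by rewrite inE.
  have := Hcut U m w mU wU; rewrite ltNge => /negP; apply.
  apply: deg_ge_cut eD eD' Fpot _ => u x; rewrite !inE => /eqP -> xF.
  by rewrite lt_neqAle xF mP.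
apply: contrapT => none.
have small e : edge_deg e D <= 1.
  by rewrite leNgt; apply/negP => h; apply: none; exists e; lia.
pose K e := edge_deg e D - edge_deg e D'.
(* With equal values at both ends and at most one chip of D inside e, neither incoming slope is
   negative. Summed around v, this gives D at least as many chips at v as D', a contradiction. *)
have edgeP e : 0 <= b e /\ b e + K e <= 0.
  have := FbE e; rewrite !Fc subrr dsumB => H.
  have L0 := len_gt0 e; have N0 := edge_deg_ge0 e eD.
  have h1 := dsum_edge_pos_ge0 e eD'; have h2 := dsum_edge_pos_le e eD'.
  have [h3 h4] : dsum (edge_pos e) D < len e /\
      (edge_deg e D)%:~R * len e - dsum (edge_pos e) D < len e.
    have := small e; rewrite le_eqVlt => /orP[/eqP E1|lt1].
      by have := dsum_edge_pos_strict (e := e) eD; rewrite E1 mul1r => /(_ isT); lra.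
    have E0 : edge_deg e D = 0 by clear -lt1 N0; lia.
    have := dsum_edge_pos_ge0 e eD; have := dsum_edge_pos_le e eD.
    by rewrite E0 mul0r; lra.
  split.
    suff : -1 < b e by clear; lia.
    rewrite -(ltr_int R) -(ltr_pM2r L0) mulN1r.
    by clear -H h1 h3; lra.
  suff : b e + K e < 1 by clear; lia.
  rewrite -(ltr_int R) -(ltr_pM2r L0) mul1r /K intrD intrB.
  by clear -H h2 h4; lra.
have H := Fb' v; rewrite dsum_vtx coeffB D0 /incoming in H.
rewrite [X in _ = _ + X](eq_bigr K) in H; last by move=> e _; rewrite /edge_deg dsumB.
have : 0 <= \sum_(e | tgt e == v) b e by apply: sumr_ge0 => e _; have [] := edgeP e.
have : \sum_(e | src e == v) (b e + K e) <= 0 by apply: sumr_le0 => e _; have [] := edgeP e.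
rewrite big_split /= => h1 h2.
by clear -D'0 H h1 h2; lra.
Qed.

Lemma on_edge_at_pos e x : on_edge e x -> exists2 t, 0 < t < len e & x = at_ e t.
Proof. by move=> xe; exists (pos x); [exact: on_edge_pos|rewrite at_pos]. Qed.

Lemma subrDD (A : zmodType) (x a b c d : A) :
  (a - c) + (b - d) = (x + (a + b)) - (x + (c + d)).
Proof. by rewrite opprD [RHS]addrACA subrr add0r opprD addrACA. Qed.

(** The chips move apart by equal amounts until one of them reaches an end; the comparison of s with
    [len e - t] tells which end comes first. *)
Lemma spread_chips e (s t : R) (X : divisor Gam) : 0 < s < len e -> 0 < t < len e ->
  exists u y, lin_equiv (X + (<< at_ e s >> + << at_ e t >>)) (X + (<< inl u >> + << y >>)).
Proof.
wlog st : s t / s <= len e - t => [H|] hs ht.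
  case: (leP s (len e - t)) => st; first exact: H.
  exists (tgt e), (at_ e (s - (len e - t))).
  have h1 : 0 <= s <= len e by lra.
  have h2 : 0 <= t <= len e by lra.
  have h3 : 0 <= s - (len e - t) <= len e by lra.
  have h4 : 0 <= len e <= len e by lra.
  apply/principal_lift; rewrite -at_tgt.
  have := lift_formD (lift_form_segment h4 h2) (lift_form_segment h3 h1).
  rewrite (subrDD X) [<< at_ e t >> + _]addrC.
  by apply: lift_form_eq => w _; ring.
exists (src e), (at_ e (t + s)).
have h1 : 0 <= s <= len e by lra.
have h2 : 0 <= t <= len e by lra.
have h3 : 0 <= t + s <= len e by lra.
have h4 : 0 <= (0 : R) <= len e by lra.
apply/principal_lift; rewrite -at_src.
have := lift_formD (lift_form_segment h4 h1) (lift_form_segment h3 h2).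
rewrite (subrDD X).
by apply: lift_form_eq => w _; ring.
Qed.

(** A representative with a chip at v1 either covers all three vertices, and is their sum by degree,
    or has its other two chips inside one edge. Spreading these puts a second chip on a vertex; at
    most one chip is then inside an edge, so no vertex can be missing. *)
Lemma rank1_deg3_unique D : #|V| = 3%N ->
  (forall (U : {set V}) u w, u \in U -> w \notin U -> (4 <= #|cut U|)%N) ->
  deg D = 3%:Z -> 1 <= div_rank D -> lin_equiv D (\sum_(v : V) << inl v >>).
Proof.
move=> V3 Hcut D3 Dr.
have full X : lin_equiv D X -> effective X -> (forall v, 0 < coeff (inl v) X) ->
    lin_equiv D (\sum_(v : V) << inl v >>).
  move=> DX eX Xv; suff -> : \sum_(v : V) << inl v >> = X by [].
  apply/esym/eqP; rewrite -subr_eq0; apply/eqP/effective_deg0; last first.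
    rewrite degB -(deg_lin_equiv DX) D3 raddf_sum (eq_bigr (fun=> 1)); last first.
      by move=> v _; rewrite /= degU.
    by rewrite sumr_const V3.
  move=> x; rewrite coeffB raddf_sum /=; case: x => [v|p].
    rewrite (bigD1 v) //= coeffU eqxx big1 ?addr0 ?subr_ge0; first exact: Xv.
    by move=> u uv; rewrite coeffU (_ : (inl u == inl v) = (u == v)) // (negPf uv).
  rewrite big1 ?subr0; first exact: eX.
  by move=> v _; rewrite coeffU.
have missing X v : lin_equiv D X -> effective X -> coeff (inl v) X = 0 ->
    exists e, 2 <= edge_deg e X.
  move=> DX eX Xv; have [Y [DY eY Yv]] := rank_ge1_through (inl v) Dr.
  apply: (two_inner_chips eX eY _ Xv Yv).
    exact: lin_equiv_trans (lin_equiv_sym DX) DY.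
  by move=> U u w uU wU; rewrite -(deg_lin_equiv DX) D3 ltz_nat; exact: Hcut uU wU.
have [v1 _] : exists v : V, true.
  by have /andP[/card_gt0P[v _] _] := model_connected Gam; exists v.
have [X [DX eX Xv1]] := rank_ge1_through (inl v1) Dr.
have [allX|] := pselect (forall v, 0 < coeff (inl v) X); first exact: full DX eX allX.
move=> /existsNP[v /negP]; rewrite -leNgt => Xv.
have Xv0 : coeff (inl v) X = 0 by apply/eqP; rewrite eq_le Xv eX.
have [e Xe] := missing X v DX eX Xv0.
have eX1 := effective_sub_pt eX Xv1.
have Xe1 : 2 <= edge_deg e (X - << inl v1 >>) by rewrite /edge_deg dsumB dsum1 subr0.
have [|x xe xX] := edge_deg_gt0 (e := e) eX1; first exact: lt_le_trans Xe1.
have eX2 := effective_sub_pt eX1 xX.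
have [|y yE] := effective_deg1 eX2.
  by rewrite !degB !degU -(deg_lin_equiv DX) D3.
have ye : on_edge e y.
  move: Xe1; have -> : X - << inl v1 >> = << x >> + << y >> by rewrite -yE [RHS]addrC subrK.
  by rewrite /edge_deg dsumD !dsum1 xe; case: (on_edge e y).
have [s hs xs] := on_edge_at_pos xe; have [t ht yt] := on_edge_at_pos ye.
have XE : X = << inl v1 >> + (<< at_ e s >> + << at_ e t >>).
  by rewrite -xs -yt -yE [<< x >> + _]addrC subrK [RHS]addrC subrK.
have [u [z]] := spread_chips << inl v1 >> hs ht.
rewrite -XE; set Y := (_ + _) => XY.
have DY := lin_equiv_trans DX XY.
have eY : effective Y by apply: effectiveD (effectiveD _ _); exact: effectiveU.
apply: (full Y DY eY) => w; rewrite lt0r eY andbT; apply/eqP => Yw.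
have [e' ] := missing Y w DY eY Yw.
rewrite /Y /edge_deg !dsumD !dsum1 /=; by case: (on_edge e' z).
Qed.

End Cuts.

(** * The loop of three loops *)

(* The loop of three loops has vertices 0, ..., 5, the loops {i, i + 3} from the
   vertex 2 i to the vertex 2 i + 1 for i < 3, and the bridges 6, 7, 8 from each
   loop to the next one. *)
Definition loops_src : seq nat := [:: 0; 2; 4; 0; 2; 4; 1; 3; 5]%N.
Definition loops_tgt : seq nat := [:: 1; 3; 5; 1; 3; 5; 2; 4; 0]%N.

Section LoopOfLoops.
Variables (R : realType) (Gam : metric_graph R).
Local Notation E := (edge Gam).
Local Notation V := (vert Gam).
Variables (vx : nat -> V) (ed : nat -> E) (c : R).
Hypothesis src_ed : forall i, (i < 9)%N -> src (ed i) = vx (nth 0%N loops_src i).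
Hypothesis tgt_ed : forall i, (i < 9)%N -> tgt (ed i) = vx (nth 0%N loops_tgt i).
Hypothesis vx_inj : forall i j, (i < 6)%N -> (j < 6)%N -> (vx i == vx j) = (i == j).
Hypothesis vx_surj : forall v, exists2 i, (i < 6)%N & v = vx i.
Hypothesis ed_enum : perm_eq (index_enum E) [seq ed i | i <- iota 0 9].
Hypothesis len_bridge : forall i, (5 < i < 9)%N -> len (ed i) = c.

Lemma incoming_loops (A : zmodType) (w : E -> A) k : (k < 6)%N ->
  incoming w (vx k) =
    \sum_(i <- [seq i <- iota 0 9 | nth 0%N loops_tgt i == k]) w (ed i) -
    \sum_(i <- [seq i <- iota 0 9 | nth 0%N loops_src i == k]) w (ed i).
Proof.
move=> k6; have small s i : all (fun a => (a < 6)%N) s -> (nth 0%N s i < 6)%N.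
  move=> /all_nthP H; case: (ltnP i (size s)) => [|h]; first exact: H.
  by rewrite nth_default.
rewrite /incoming !(perm_big _ ed_enum) !big_map !big_filter; congr (_ - _);
  rewrite big_seq_cond [RHS]big_seq_cond; apply: eq_bigl => i;
  rewrite mem_iota add0n leq0n; case: (ltnP i 9) => // i9.
  by rewrite tgt_ed // vx_inj // small.
by rewrite src_ed // vx_inj // small.
Qed.

(** The flow entering a loop by one bridge splits over its two edges and leaves by the next
    bridge. *)
Lemma harmonic_bridges w : w \in harmonic_forms Gam ->
  w (ed 6) = w (ed 7) /\ w (ed 7) = w (ed 8).
Proof.
move=> /harmonicP wh.
have h k (k6 : (k < 6)%N) := etrans (esym (incoming_loops w k6)) (wh (vx k)).
have h2 := subr0_eq (h 2%N isT); have h3 := subr0_eq (h 3%N isT).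
have h4 := subr0_eq (h 4%N isT); have h5 := subr0_eq (h 5%N isT).
rewrite /= big_seq1 in h2; rewrite /= big_seq1 in h3.
rewrite /= big_seq1 in h4; rewrite /= big_seq1 in h5.
split; first by rewrite h2 -h3.
by rewrite h4 -h5.
Qed.

Definition bridge_chips (x y z : R) : divisor Gam :=
  << at_ (ed 6) x >> + << at_ (ed 7) y >> + << at_ (ed 8) z >>.

Lemma bridge_chips_effective x y z : effective (bridge_chips x y z).
Proof. by apply: effectiveD; [apply: effectiveD|]; exact: effectiveU. Qed.

Lemma subrD3 (A : zmodType) (a b d a' b' d' : A) :
  (a - a') + (b - b') + (d - d') = (a + b + d) - (a' + b' + d').
Proof. by rewrite [a - a' + _]addrACA [LHS]addrACA !opprD. Qed.

Lemma bridge_chips_form x y z x' y' z' :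
  0 <= x <= c -> 0 <= y <= c -> 0 <= z <= c ->
  0 <= x' <= c -> 0 <= y' <= c -> 0 <= z' <= c ->
  lift_form (bridge_chips x y z - bridge_chips x' y' z')
    (fun w => (x + y + z - (x' + y' + z')) * w (ed 8)).
Proof.
rewrite -{1 4}(len_bridge (i := 6)) // -{1 3}(len_bridge (i := 7)) //.
rewrite -{1 2}(len_bridge (i := 8)) // => h1 h2 h3 h4 h5 h6.
have := lift_formD (lift_formD (lift_form_segment h4 h1) (lift_form_segment h5 h2))
  (lift_form_segment h6 h3).
rewrite subrD3; apply: lift_form_eq => w /harmonic_bridges[-> ->]; ring.
Qed.

Lemma bridge_chips_equiv x y z x' y' z' :
  0 <= x <= c -> 0 <= y <= c -> 0 <= z <= c ->
  0 <= x' <= c -> 0 <= y' <= c -> 0 <= z' <= c ->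
  x + y + z = x' + y' + z' ->
  lin_equiv (bridge_chips x y z) (bridge_chips x' y' z').
Proof.
move=> h1 h2 h3 h4 h5 h6 E1; apply/principal_lift.
apply: lift_form_eq (bridge_chips_form h1 h2 h3 h4 h5 h6) => w _.
by rewrite E1 subrr mul0r.
Qed.

Lemma endpoints_slide e (u : R) (X : divisor Gam) : 0 <= u <= len e ->
  lin_equiv (X + (<< inl (src e) >> + << inl (tgt e) >>))
            (X + (<< at_ e u >> + << at_ e (len e - u) >>)).
Proof.
move=> hu; apply/principal_lift; rewrite -at_src -at_tgt.
have h0 : 0 <= (0 : R) <= len e by lra.
have hL : 0 <= len e <= len e by lra.
have hv : 0 <= len e - u <= len e by lra.
have := lift_formD (lift_form_segment hu h0) (lift_form_segment hv hL).
rewrite (subrDD X); by apply: lift_form_eq => w _; ring.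
Qed.

(** Two chips at the ends of a loop and one on the last bridge. The positions add up to c + y, so y
    in [0, c] runs through the admissible sums. *)
Definition loops_divisor (y : R) := bridge_chips c 0 y.

Lemma c_ge0 : 0 <= c.
Proof. by rewrite -(len_bridge (i := 6)) // ltW // len_gt0. Qed.

Definition reaches (D : divisor Gam) (x : pt Gam) :=
  exists D', [/\ lin_equiv D D', effective D' & 0 < coeff x D'].

Lemma reaches_loop D X e (t : R) : effective X ->
  lin_equiv D (X + (<< inl (src e) >> + << inl (tgt e) >>)) -> 0 <= t <= len e ->
  reaches D (at_ e t).
Proof.
move=> eX DX ht; exists (X + (<< at_ e t >> + << at_ e (len e - t) >>)); split.
- exact: lin_equiv_trans DX (endpoints_slide _ ht).
- by apply: effectiveD => //; apply: effectiveD; exact: effectiveU.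
rewrite !coeffD !coeffU eqxx !mul1r addrCA ltr_pwDl // addr_ge0 //; exact: eX.
Qed.

Lemma at_bridge0 i : (5 < i < 9)%N -> at_ (ed i) 0 = inl (vx (nth 0%N loops_src i)).
Proof. by move=> /andP[_ hi]; rewrite at_src src_ed. Qed.

Lemma at_bridge1 i : (5 < i < 9)%N -> at_ (ed i) c = inl (vx (nth 0%N loops_tgt i)).
Proof. by move=> hi; rewrite -(len_bridge hi) at_tgt tgt_ed //; case/andP: hi. Qed.

Lemma loops_divisor_reaches (y : R) x : 0 <= y <= c -> reaches (loops_divisor y) x.
Proof.
move=> hy; have c0 := c_ge0.
have h0 : 0 <= (0 : R) <= c by lra.
have hc : 0 <= c <= c by lra.
(* The sum c + y is distributed over the bridges as (0, y, c), (c, 0, y) and (y, c, 0); each time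
   the chips at positions c and 0 occupy the two ends of one loop. *)
have D0 : lin_equiv (loops_divisor y)
    (<< at_ (ed 7) y >> + (<< inl (vx 0) >> + << inl (vx 1) >>)).
  have := @bridge_chips_equiv c 0 y 0 y c hc h0 hy h0 hy hc.
  rewrite /bridge_chips (at_bridge0 (i := 6)) // (at_bridge1 (i := 8)) //=.
  rewrite [<< inl (vx 1) >> + _]addrC -[X in lin_equiv _ X]addrA [<< inl (vx 1) >> + _]addrC.
  by apply; ring.
have D1 : lin_equiv (loops_divisor y)
    (<< at_ (ed 8) y >> + (<< inl (vx 2) >> + << inl (vx 3) >>)).
  rewrite /loops_divisor /bridge_chips (at_bridge0 (i := 7)) // (at_bridge1 (i := 6)) //=.
  by rewrite addrC; exact: lin_equiv_refl.
have D2 : lin_equiv (loops_divisor y)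
    (<< at_ (ed 6) y >> + (<< inl (vx 4) >> + << inl (vx 5) >>)).
  have := @bridge_chips_equiv c 0 y y c 0 hc h0 hy hy hc h0.
  rewrite /bridge_chips (at_bridge0 (i := 8)) // (at_bridge1 (i := 7)) //=.
  by rewrite -[X in lin_equiv _ X]addrA; apply; ring.
have eU z : effective (<< z >> : divisor Gam) by exact: effectiveU.
have through X p q z : lin_equiv (loops_divisor y) (<< X >> + (<< p >> + << q >>)) ->
    z = p \/ z = q -> reaches (loops_divisor y) z.
  move=> DX pq; exists (<< X >> + (<< p >> + << q >>)); split=> //.
    by apply: effectiveD => //; exact: effectiveD.
  rewrite !coeffD !coeffU !mul1r.
  by case: pq => ->; rewrite eqxx; case: (_ == _); case: (_ == _).
case: (ptP x) => [v|e t te].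
  have [i i6 ->] := vx_surj v.
  case: i i6 => [|[|[|[|[|[|//]]]]]] _; [apply: through D0 _|apply: through D0 _|
    apply: through D1 _|apply: through D1 _|apply: through D2 _|apply: through D2 _]; by tauto.
have : e \in [seq ed i | i <- iota 0 9] by rewrite -(perm_mem ed_enum) mem_index_enum.
move=> /mapP[i]; rewrite mem_iota /= add0n => i9 eE; rewrite {}eE in te *.
have tW : 0 <= t <= len (ed i) by lra.
have loop k X : (k < 9)%N -> lin_equiv (loops_divisor y) (<< X >> +
     (<< inl (vx (nth 0%N loops_src k)) >> + << inl (vx (nth 0%N loops_tgt k)) >>)) ->
     0 <= t <= len (ed k) -> reaches (loops_divisor y) (at_ (ed k) t).
  by move=> k9; rewrite -src_ed // -tgt_ed // => H; exact: reaches_loop H.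
(* To put a chip at position s of one bridge, the other two share the rest c + y - s equally; it
   lies between 0 and 2 c. *)
have half (s : R) : 0 <= s <= c -> 0 <= (c + y - s) / 2 <= c by lra.
have bridge (a b d : R) z : 0 <= a <= c -> 0 <= b <= c -> 0 <= d <= c ->
    c + 0 + y = a + b + d -> [|| z == at_ (ed 6) a, z == at_ (ed 7) b | z == at_ (ed 8) d] ->
    reaches (loops_divisor y) z.
  move=> ha hb hd sE zE; exists (bridge_chips a b d); split.
  - exact: bridge_chips_equiv.
  - exact: bridge_chips_effective.
  rewrite /bridge_chips !coeffD !coeffU !mul1r ![_ == z]eq_sym.
  by case/or3P: zE => ->; case: (_ == _); case: (_ == _).
case: i i9 tW te => [|[|[|[|[|[|i]]]]]] i9 tW te.
- exact: (loop 0%N _ i9 D0 tW).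
- exact: (loop 1%N _ i9 D1 tW).
- exact: (loop 2%N _ i9 D2 tW).
- exact: (loop 3%N _ i9 D0 tW).
- exact: (loop 4%N _ i9 D1 tW).
- exact: (loop 5%N _ i9 D2 tW).
have hi : (5 < i.+4.+2 < 9)%N by rewrite i9 andbT.
rewrite (len_bridge hi) in tW te; have ht := half t tW.
case: i i9 tW te hi => [|[|[|//]]] i9 tW te hi.
- by apply: (bridge t ((c + y - t) / 2) ((c + y - t) / 2)); rewrite ?eqxx ?orbT //; lra.
- by apply: (bridge ((c + y - t) / 2) t ((c + y - t) / 2)); rewrite ?eqxx ?orbT //; lra.
- by apply: (bridge ((c + y - t) / 2) ((c + y - t) / 2) t); rewrite ?eqxx ?orbT //; lra.
Qed.

Lemma loops_divisor_rank (y : R) : 0 <= y <= c -> 1 <= div_rank (loops_divisor y).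
Proof.
move=> hy; apply: rank_test1_ge => F' eF dF.
have [x ->] := effective_deg1 eF dF.
have [D' [DD' eD' xD']] := loops_divisor_reaches x hy.
by exists D' => //; exact: effective_sub_pt.
Qed.

(** The flow around the big cycle: 2 through every bridge, and 1 through each of the two edges of
    every loop. *)
Lemma loops_harmonic : exists2 w, w \in harmonic_forms Gam & w (ed 8) = 2.
Proof.
pose s := [seq ed i | i <- iota 0 9].
have us : uniq s by rewrite -(perm_uniq ed_enum) index_enum_uniq.
pose w : {ffun E -> R^o} := [ffun e => if (5 < index e s)%N then 2 else 1].
have wE i : (i < 9)%N -> w (ed i) = if (5 < i)%N then 2 else 1.
  move=> i9; rewrite ffunE (_ : ed i = nth (ed 0) s i).
    by rewrite index_uniq // size_map size_iota.
  by rewrite (nth_map 0%N) ?size_iota // nth_iota.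
exists w; last by rewrite wE.
apply/harmonicP => v; have [i i6 ->] := vx_surj v.
rewrite incoming_loops //; case: i i6 => [|[|[|[|[|[|//]]]]]] _;
  rewrite !big_cons !big_nil !wE //=; lra.
Qed.

(** The statement is local because the functional of y - y' could be a nonzero period; below d it
    vanishes, and testing it on a flow with nonzero value on the bridge gives y = y'. *)
Lemma loops_divisor_inj : exists2 d : R, 0 < d & forall y y' : R,
  0 <= y <= c -> 0 <= y' <= c -> `|y - y'| < d ->
  lin_equiv (loops_divisor y) (loops_divisor y') -> y = y'.
Proof.
have [d d0 Hd] := period_discrete (fun e => (e == ed 8)%:R : R).
have sumE (w : {ffun E -> R^o}) : \sum_e (e == ed 8)%:R * w e = w (ed 8).
  rewrite (bigD1 (ed 8)) //= eqxx mul1r big1 ?addr0 // => e /negPf ->.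
  by rewrite mul0r.
exists d => // y y' hy hy' yd /principal_lift H.
have c0 := c_ge0.
have h0 : 0 <= (0 : R) <= c by lra.
have hc : 0 <= c <= c by lra.
have [k k0 kE] := lift_form_uniq (bridge_chips_form hc h0 hy hc h0 hy') H.
have [w wh w2] := loops_harmonic.
have := Hd (y - y') yd _ w wh; rewrite sumE w2 => Hy.
have /Hy : exists2 c : E -> int, (forall v, incoming c v = 0) &
    forall w, w \in harmonic_forms Gam ->
      (y - y') * (\sum_e (e == ed 8)%:R * w e) = chain_int c w.
  by exists k => // w' wh'; rewrite -kE // sumE; ring.
by lra.
Qed.

Lemma loops_BN_infinite n : exists D : 'I_n -> divisor Gam,
  (forall i, deg (D i) = 3%:Z /\ 1%:Z <= div_rank (D i)) /\
  (forall i j, lin_equiv (D i) (D j) -> i = j).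
Proof.
have [d d0 Hd] := loops_divisor_inj.
have c0 : 0 < c by rewrite -(len_bridge (i := 6)) // len_gt0.
pose m := Num.min c d / 2; have m0 : 0 < Num.min c d by rewrite lt_min c0.
have m1 : Num.min c d <= c by rewrite ge_min lexx.
have m2 : Num.min c d <= d by rewrite ge_min lexx orbT.
have n0 : 0 < (n.+1)%:R :> R by rewrite ltr0n.
pose y (i : 'I_n) := m * (i%:R / n.+1%:R).
have yb i : 0 <= y i <= m.
  have m0' : 0 <= m by rewrite /m; lra.
  apply/andP; split; first by rewrite mulr_ge0 // divr_ge0 // ler0n.
  rewrite /y -[leRHS]mulr1; apply: ler_wpM2l => //.
  by rewrite ler_pdivrMr // mul1r ler_nat ltnW // ltnS ltnW.
exists (fun i => loops_divisor (y i)); split=> [i|i j Dij].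
  split; first by rewrite !degD !degU.
  by apply: loops_divisor_rank; have := yb i; rewrite /m; lra.
have yij : y i = y j.
  apply: Hd Dij; have := yb i; have := yb j; rewrite /m; try lra.
  by move=> *; rewrite ltr_norml; lra.
apply/val_inj/eqP; rewrite /= -(eqr_nat R); apply/eqP.
have mne : m != 0 by rewrite gt_eqF // /m; lra.
by move: yij => /(mulfI mne) /(mulIf (invr_neq0 (lt0r_neq0 n0))).
Qed.

End LoopOfLoops.

(** * A family in the moduli space *)

Section CycleSpaceDim.
Variables (G : graph) (F : fieldType).
Local Notation C1 := {ffun edge G -> F^o}.
Local Notation C0 := {ffun vert G -> F^o}.

Definition vtx_sum (u : C0) : F^o := \sum_v u v.

Lemma vtx_sum_linear : linear vtx_sum.
Proof.
move=> a u u'; rewrite /vtx_sum scaler_sumr -big_split.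
by apply: eq_bigr => v _; rewrite !ffunE.
Qed.
HB.instance Definition _ := GRing.isLinear.Build F C0 F^o _ vtx_sum vtx_sum_linear.

Lemma limg_boundary : connected_graph G ->
  limg (linfun (@boundary G F)) = lker (linfun vtx_sum).
Proof.
move=> conG; apply/vspaceP => u; apply/idP/idP.
  move=> /memv_imgP[c _ ->]; rewrite memv_ker !lfunE /= /vtx_sum; apply/eqP.
  have := sum_coboundary (fun=> 1 : F) c.
  rewrite (eq_bigr (fun=> 0)) ?big1_eq; last by move=> e _; rewrite subrr mul0r.
  by move=> H; rewrite [RHS]H; apply: eq_bigr => v _; rewrite ffunE mul1r.
rewrite memv_ker lfunE /= /vtx_sum => /eqP u0.
have [v0 _] : exists v : vert G, true.
  by case/andP: conG => /card_gt0P[v _] _; exists v.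
have [P PE] := choice (fun v => connected_chain conG v0 v).
(* Since the values of u sum to 0, the multiples of v0 cancel in the boundary of the paths from v0
   to v weighted by u v. *)
have -> : u = linfun (@boundary G F) (\sum_v u v *: [ffun e => (P v e)%:~R]).
  rewrite linear_sum; apply/ffunP => x; rewrite sum_ffunE.
  rewrite (eq_bigr (fun v => u v * (v == x)%:R - u v * (v0 == x)%:R)).
    rewrite sumrB -mulr_suml u0 mul0r subr0 (bigD1 x) //= eqxx mulr1 big1 ?addr0 //.
    by move=> v /negPf ->; rewrite mulr0.
  move=> v _; rewrite linearZ /= ffunE lfunE /= ffunE /GRing.scale /= -mulrBr.
  congr (_ * _); have := incoming_morph (intmul 1 : {additive int -> F}) (P v) x.
  rewrite PE raddfB /= !mulrz_nat => <-.
  by rewrite /incoming; congr (_ - _); apply: eq_bigr => e _; rewrite ffunE.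
exact/memv_img/memvf.
Qed.

(** Rank-nullity twice: the image of the boundary is the kernel of the sum over the vertices, which
    has codimension 1. *)
Lemma dim_cycle_space : connected_graph G ->
  (\dim (cycle_space G F) + #|vert G| = #|edge G| + 1)%N.
Proof.
move=> conG.
have dimE (T : finType) : \dim {: {ffun T -> F^o}} = #|T|.
  by rewrite dimvf /dim /= /dim /= muln1.
have h1 := limg_ker_dim (linfun (@boundary G F)) fullv.
have h2 := limg_ker_dim (linfun vtx_sum) fullv.
rewrite capfv dimE in h1; rewrite capfv dimE in h2.
have h3 : (limg (linfun vtx_sum) = {: F^o})%VS.
  apply/eqP; rewrite eqEsubv subvf /=; apply/subvP => x _.
  have [v0 _] : exists v : vert G, true.
    by case/andP: conG => /card_gt0P[v _] _; exists v.
  have -> : x = linfun vtx_sum [ffun v => if v == v0 then x else 0].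
    rewrite lfunE /= /vtx_sum; under eq_bigr do rewrite ffunE.
    by rewrite -big_mkcond big_pred1_eq.
  exact/memv_img/memvf.
have h4 : \dim {: F^o} = 1%N by rewrite dimvf /dim.
by rewrite h3 h4 -limg_boundary // in h2; rewrite -h1 -h2 addnA.
Qed.

End CycleSpaceDim.

Definition loops_comb_graph : comb_graph :=
  @Tagged _ (6, 9)%N (fun nm => {ffun 'I_nm.2 -> 'I_nm.1 * 'I_nm.1}%type)
    [ffun i : 'I_9 => (inord (nth 0%N loops_src i), inord (nth 0%N loops_tgt i)) : 'I_6 * 'I_6].

Local Notation LG := (graph_of loops_comb_graph).

Lemma loops_small i : (nth 0 loops_src i < 6)%N /\ (nth 0 loops_tgt i < 6)%N.
Proof.
split; case: (ltnP i 9) => [i9|h]; try by rewrite nth_default.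
  by apply: (@allP _ (fun a => (a < 6)%N) loops_src isT); exact: mem_nth.
by apply: (@allP _ (fun a => (a < 6)%N) loops_tgt isT); exact: mem_nth.
Qed.

Lemma LG_srcE (e : edge LG) : src e = inord (nth 0%N loops_src e) :> 'I_6.
Proof. by rewrite /= ffunE. Qed.

Lemma LG_tgtE (e : edge LG) : tgt e = inord (nth 0%N loops_tgt e) :> 'I_6.
Proof. by rewrite /= ffunE. Qed.

Lemma val_LG_src (e : edge LG) : val (src e : 'I_6) = nth 0%N loops_src e.
Proof. by rewrite LG_srcE /= inordK //; case: (loops_small e). Qed.

Lemma val_LG_tgt (e : edge LG) : val (tgt e : 'I_6) = nth 0%N loops_tgt e.
Proof. by rewrite LG_tgtE /= inordK //; case: (loops_small e). Qed.

Lemma adjacent_sym (G : graph) : connect_sym (@Defs.adjacent G).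
Proof.
apply: sym_connect_sym => u v; apply: eq_existsb => e.
by rewrite /joins orbC.
Qed.

Lemma LG_connected : connected_graph LG.
Proof.
apply/andP; split; first by apply/card_gt0P; exists (ord0 : 'I_6).
have path0 k : (k < 6)%N -> connect (@Defs.adjacent LG) (inord 0 : 'I_6) (inord k : 'I_6).
  elim: k => [|k IH] k6; first exact: connect0.
  apply: connect_trans (IH (ltnW k6)) _; apply/connect1/existsP.
  (* Entry k of the list is an edge between the vertices k and k + 1. *)
  exists (inord (nth 0%N [:: 0; 6; 1; 7; 2] k)%N : 'I_9).
  by rewrite /joins LG_srcE LG_tgtE; case: k k6 {IH} => [|[|[|[|[|//]]]]] _;
    rewrite inordK //= !eqxx ?orbT.
apply/forallP => u; apply/forallP => v.
rewrite -[u](@inord_val 5) -[v](@inord_val 5).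
apply: connect_trans (path0 _ (ltn_ord v)).
by rewrite adjacent_sym; exact: path0 (ltn_ord u).
Qed.

Lemma LG_stable : stable_genus4 LG.
Proof.
apply/and3P; split; first exact: LG_connected.
  (* With 6 vertices and 9 edges, the genus is 9 + 1 - 6 = 4. *)
  rewrite /betti1 -(eqn_add2r 6).
  by have := dim_cycle_space rat LG_connected; rewrite /= !card_ord => ->.
apply/forallP => v; rewrite /valence -!sum1_card.
rewrite (eq_bigl (fun e : 'I_9 => nth 0%N loops_src e == val (v : 'I_6))); last first.
  by move=> e; rewrite inE -val_LG_src (inj_eq val_inj).
rewrite [X in (_ <= _ + X)%N](eq_bigl
  (fun e : 'I_9 => nth 0%N loops_tgt e == val (v : 'I_6))); last first.
  by move=> e; rewrite inE -val_LG_tgt (inj_eq val_inj).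
rewrite -(big_mkord (fun i => nth 0%N loops_src i == val v) (fun=> 1%N)).
rewrite -(big_mkord (fun i => nth 0%N loops_tgt i == val v) (fun=> 1%N)).
case: v => k /= k6; rewrite unlock.
by case: k k6 => [|[|[|[|[|[|//]]]]]].
Qed.

Definition loops_graph : genus4_graph := Sub loops_comb_graph LG_stable.

(* The three classes of vertices that are identified when the bridges are
   contracted. *)
Definition bridge_class (k : nat) : nat := (uphalf k %% 3)%N.

Lemma bridge_class_ends i : (5 < i < 9)%N ->
  bridge_class (nth 0%N loops_src i) = ((i - 5) %% 3)%N /\
  bridge_class (nth 0%N loops_tgt i) = ((i - 5) %% 3)%N.
Proof. by do 9?[case: i => [|i] //]. Qed.

(** Both ends of a bridge lie in one class, and different bridges belong to different classes. Two
    consecutive darts share a vertex, hence would run along the same bridge; and no bridge is a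
    loop. *)
Lemma bridges_acyclic (p : seq (edge LG * bool)) : is_cycle p ->
  ~ {in p, forall a, (5 < (a.1 : 'I_9))%N}.
Proof.
have ends (a : edge LG * bool) : (5 < (a.1 : 'I_9))%N ->
    bridge_class (val (dart_src a : 'I_6)) = ((a.1 - 5) %% 3)%N /\
    bridge_class (val (dart_tgt a : 'I_6)) = ((a.1 - 5) %% 3)%N.
  case: a => e b; rewrite [_.1]/= => he.
  have [|h1 h2] := @bridge_class_ends e; first by rewrite he ltn_ord.
  by case: b; rewrite /dart_src /dart_tgt [_.2]/= [_.1]/= val_LG_src val_LG_tgt.
case: p => [//|a [|b p]] /and4P[_ cyc us _] H.
  have := H a (mem_head _ _); move: cyc; rewrite /= andbT => /eqP.
  rewrite /dart_src /dart_tgt => E he.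
  have : src a.1 = tgt a.1 by case: (a.2) E => ->.
  move/(congr1 (fun v : 'I_6 => val v)); rewrite val_LG_src val_LG_tgt.
  by case: a.1 he => i /= i9; do 9?[case: i i9 => [|i] // i9].
have ha := H a (mem_head _ _); have hb : (5 < (b.1 : 'I_9))%N.
  by apply: H; rewrite !inE eqxx orbT.
move: cyc us => /= /andP[/eqP tab _] /andP[]; rewrite inE negb_or => /andP[/eqP ab _] _.
apply: ab; apply: ord_inj.
have [_ ] := ends a ha; rewrite tab => E; have [] := ends b hb; rewrite E => + _.
have := ltn_ord a.1; have := ltn_ord b.1; move: ha hb; clear.
case: (a.1) => i /= _; case: (b.1) => j /= _.
by do 9?[case: i => [|i] //]; do 9?[case: j => [|j] //].
Qed.

Section Family.
Variable R : realType.

Definition loops_len (t : R) : 'rV[R]_(ecount (val loops_graph)) :=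
  \row_(i < 9) (if (i < 6)%N then 1 else t).

Lemma loops_len_cone (t : R) : 0 <= t -> cone R loops_graph (loops_len t).
Proof.
move=> t0; split=> [e|p pc pz]; first by rewrite mxE; case: ifP.
apply: (bridges_acyclic pc) => a /pz; rewrite mxE; case: ltnP => // _ /eqP.
by rewrite oner_eq0.
Qed.

Definition loops_cone (t : R) (t0 : 0 <= t) : cone R loops_graph :=
  exist _ (loops_len t) (mem_set (loops_len_cone t0)).

Lemma lengths_loops t (t0 : 0 <= t) (e : 'I_9) :
  lengths (loops_cone t0) e = if (e < 6)%N then 1 else t.
Proof. by rewrite /lengths /= mxE. Qed.

End Family.

Lemma card_enumeration (T : finType) (s : seq T) : uniq s -> (forall x, x \in s) ->
  #|T| = size s.
Proof.
by move=> us sT; rewrite -(card_uniqP us); apply: eq_card => x; rewrite sT inE.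
Qed.

(** * The metric graphs of the family, with bridges of length t or contracted *)

Section Contracted.
Variables (R : realType) (t : R) (t0 : 0 <= t).
Local Notation ell := (lengths (loops_cone t0)).
Local Notation Gam := (Gamma (loops_cone t0)).

Lemma ell_gt0 (e : 'I_9) : (e < 6)%N || (0 < t) -> 0 < ell e.
Proof. by rewrite lengths_loops; case: ifP => //=; rewrite ltr01. Qed.

Lemma ell_inord0_gt0 : 0 < ell (inord 0 : 'I_9).
Proof. by apply: ell_gt0; rewrite inordK. Qed.

Definition loops_vx (k : nat) : vert Gam := cproj ell (inord k : 'I_6).

(** At t = 0 the bridges are not edges of the contracted graph; they default to edge 0, which has
    length 1 for every t. *)
Definition loops_ed (i : nat) : edge Gam :=
  insubd (Sub (inord 0) ell_inord0_gt0 : cedge ell) (inord i : 'I_9).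

Lemma val_loops_ed i : (i < 9)%N -> (i < 6)%N || (0 < t) ->
  val (loops_ed i : cedge ell) = (inord i : 'I_9).
Proof. by move=> i9 h; apply: insubdK; apply: ell_gt0; rewrite inordK. Qed.

Lemma loops_src_ed i : (i < 9)%N -> (i < 6)%N || (0 < t) ->
  src (loops_ed i) = loops_vx (nth 0%N loops_src i).
Proof.
move=> i9 h; rewrite /loops_vx.
have -> : src (loops_ed i) = cproj ell (src (val (loops_ed i : cedge ell))) by [].
by rewrite val_loops_ed // LG_srcE inordK.
Qed.

Lemma loops_tgt_ed i : (i < 9)%N -> (i < 6)%N || (0 < t) ->
  tgt (loops_ed i) = loops_vx (nth 0%N loops_tgt i).
Proof.
move=> i9 h; rewrite /loops_vx.
have -> : tgt (loops_ed i) = cproj ell (tgt (val (loops_ed i : cedge ell))) by [].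
by rewrite val_loops_ed // LG_tgtE inordK.
Qed.

Lemma loops_ed_inj i j : (i < 9)%N -> (j < 9)%N -> (i < 6)%N || (0 < t) ->
  (j < 6)%N || (0 < t) -> loops_ed i = loops_ed j -> i = j.
Proof.
move=> i9 j9 hi hj /(congr1 (fun e : cedge ell => val e)).
by rewrite !val_loops_ed // => /(congr1 (@nat_of_ord 9)); rewrite !inordK.
Qed.

Lemma cprojE (u v : 'I_6) :
  (cproj ell u == cproj ell v) = connect (@null_adjacent R LG ell) u v.
Proof.
exact: (fingraph.root_connect (null_connect_sym ell) u v).
Qed.

Lemma loops_vx_surj v : exists2 k, (k < 6)%N & v = loops_vx k.
Proof.
exists (val (val (v : cvert ell) : 'I_6)); first exact: ltn_ord.
rewrite /loops_vx inord_val; apply: val_inj => /=.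
by apply/esym/eqP; exact: (valP (v : cvert ell)).
Qed.

Lemma loops_deg_infinite n : 0 < t -> exists D : 'I_n -> divisor Gam,
  (forall i, deg (D i) = 3%:Z /\ 1%:Z <= div_rank (D i)) /\
  (forall i j, lin_equiv (D i) (D j) -> i = j).
Proof.
move=> tp; have tT i : (i < 6)%N || (0 < t) by rewrite tp orbT.
apply: (@loops_BN_infinite R Gam loops_vx loops_ed t).
- by move=> i i9; exact: loops_src_ed.
- by move=> i i9; exact: loops_tgt_ed.
- move=> i j i6 j6; rewrite /loops_vx cprojE; apply/idP/eqP => [|->]; last exact: connect0.
  case/connectP=> -[|x p] /=.
    by move=> _ /(congr1 (@nat_of_ord 6)); rewrite !inordK.
  by case/andP=> /existsP[e /andP[/eqP e0 _]]; have := ell_gt0 (tT e); rewrite e0 ltxx.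
- exact: loops_vx_surj.
- apply: uniq_perm; first exact: index_enum_uniq.
    rewrite map_inj_in_uniq ?iota_uniq // => i j; rewrite !mem_iota !add0n !leq0n /= => i9 j9.
    exact: loops_ed_inj.
  move=> e; rewrite mem_index_enum; apply/esym/mapP.
  exists (val (val (e : cedge ell) : 'I_9)); first by rewrite mem_iota ltn_ord.
  by apply: val_inj; rewrite [RHS]val_loops_ed ?inord_val ?tT //; exact: ltn_ord.
- move=> i /andP[i6 i9]; rewrite /= val_loops_ed // lengths_loops inordK //.
  by rewrite ltnNge i6.
Qed.

(** Only bridges can be contracted, so the class descends to the vertices of the contracted graph
    and keeps three of them apart. *)
Lemma null_bridge_class (u v : 'I_6) : connect (@null_adjacent R LG ell) u v ->
  bridge_class u = bridge_class v.
Proof.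
case/connectP=> p; elim: p u => [|x p IH] u /=; first by move=> _ ->.
case/andP=> /existsP[e /andP[/eqP e0 ux]] px vE; rewrite -(IH x px vE).
have e5 : (5 < (e : 'I_9))%N.
  by rewrite ltnNge; apply/negP => e5; have := @ell_gt0 e; rewrite e0 ltxx ltnS e5 => /(_ isT).
have [|h1 h2] := @bridge_class_ends e; first by rewrite e5 ltn_ord.
case/orP: ux => /andP[/eqP <- /eqP <-];
  by rewrite -[LHS]/(bridge_class (val (_ : 'I_6))) -[RHS]/(bridge_class (val (_ : 'I_6)))
     val_LG_src val_LG_tgt h1 h2.
Qed.

Lemma loops_vx_glued i : t = 0 -> (5 < i < 9)%N ->
  loops_vx (nth 0%N loops_src i) = loops_vx (nth 0%N loops_tgt i).
Proof.
move=> tz /andP[i5 i9]; apply/eqP; rewrite /loops_vx cprojE; apply/connect1/existsP.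
exists (inord i : 'I_9); rewrite lengths_loops inordK // ltnNge i5 /= tz eqxx /=.
by rewrite /joins LG_srcE LG_tgtE inordK // !eqxx.
Qed.

Lemma loops_card_vert : t = 0 -> #|vert Gam| = 3%N.
Proof.
move=> tz; pose w j := loops_vx (nth 0%N [:: 1; 3; 5]%N j).
have wE v : v \in [seq w j | j <- iota 0 3].
  have g6 := @loops_vx_glued 6 tz isT; have g7 := @loops_vx_glued 7 tz isT.
  have g8 := @loops_vx_glued 8 tz isT; rewrite /= in g6 g7 g8.
  have [k k6 ->] := loops_vx_surj v; rewrite !inE /w /=.
  by case: k k6 => [|[|[|[|[|[|//]]]]]] _; rewrite -?g6 -?g7 -?g8 !eqxx ?orbT.
have wu : uniq [seq w j | j <- iota 0 3].
  have ne a b : (a < 6)%N -> (b < 6)%N -> bridge_class a != bridge_class b ->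
      loops_vx a != loops_vx b.
    move=> a6 b6; apply: contra; rewrite /loops_vx cprojE => /null_bridge_class.
    by rewrite !inordK // => ->.
  by rewrite /= !inE !negb_or !ne.
by rewrite (card_enumeration wu wE) size_map size_iota.
Qed.

(** A set that separates the vertices of a triangle cuts the two sides at one of its vertices, and
    here every side is doubled. *)
Lemma loops_cut (U : {set vert Gam}) u v : t = 0 -> u \in U -> v \notin U ->
  (4 <= #|cut U|)%N.
Proof.
move=> tz uU vU; pose P k := loops_vx k \in U.
have cutE i : (i < 6)%N -> (loops_ed i \in cut U) =
    (P (nth 0%N loops_src i) != P (nth 0%N loops_tgt i)).
  by move=> i6; rewrite inE loops_src_ed ?loops_tgt_ed ?i6 //; exact: ltn_trans i6 _.
have g6 : P 2%N = P 1%N by rewrite /P (@loops_vx_glued 6 tz isT).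
have g7 : P 4%N = P 3%N by rewrite /P (@loops_vx_glued 7 tz isT).
have g8 : P 0%N = P 5%N by rewrite /P (@loops_vx_glued 8 tz isT).
have four (s : seq nat) : uniq s -> size s = 4%N -> all (fun k => (k < 6)%N) s ->
    all (fun k => loops_ed k \in cut U) s -> (4 <= #|cut U|)%N.
  move=> us s4 /allP s6 /allP sU; apply/card_geqP; exists [seq loops_ed k | k <- s].
  split; last by move=> e /mapP[k /sU ? ->].
    rewrite map_inj_in_uniq // => a b /s6 a6 /s6 b6.
    by apply: loops_ed_inj; rewrite ?a6 ?b6 // ltnW // ltnW // ltnW.
  by rewrite size_map.
have mixed : ~~ [&& P 1%N == P 3%N & P 3%N == P 5%N].
  apply/negP => /andP[/eqP e1 /eqP e2]; move: uU vU.
  have [a a6 ->] := loops_vx_surj u; have [b b6 ->] := loops_vx_surj v.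
  have PE k : (k < 6)%N -> P k = P 5%N.
    by case: k => [|[|[|[|[|[|//]]]]]] _; rewrite ?g6 ?g7 ?g8 ?e1 ?e2.
  by rewrite -/(P a) -/(P b) !PE // => ->.
have c0 := cutE 0%N isT; have c1 := cutE 1%N isT; have c2 := cutE 2%N isT.
have c3 := cutE 3%N isT; have c4 := cutE 4%N isT; have c5 := cutE 5%N isT.
rewrite /= in c0 c1 c2 c3 c4 c5; move: mixed c0 c1 c2 c3 c4 c5; rewrite g6 g7 g8.
case: (P 1%N); case: (P 3%N); case: (P 5%N) => //= _ c0 c1 c2 c3 c4 c5;
  first [apply: (four [:: 0; 3; 1; 4]%N) => //=; rewrite c0 c3 c1 c4 //; fail
        |apply: (four [:: 0; 3; 2; 5]%N) => //=; rewrite c0 c3 c2 c5 //; fail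
        |apply: (four [:: 1; 4; 2; 5]%N) => //=; rewrite c1 c4 c2 c5 //; fail].
Qed.

Lemma loops_BN_unique (D D' : divisor Gam) : t = 0 ->
  deg D = 3%:Z -> deg D' = 3%:Z -> 1%:Z <= div_rank D -> 1%:Z <= div_rank D' ->
  lin_equiv D D'.
Proof.
move=> tz D3 D'3 Dr D'r; have Hcut U u w := @loops_cut U u w tz.
have H := rank1_deg3_unique (loops_card_vert tz) Hcut D3 Dr.
have H' := rank1_deg3_unique (loops_card_vert tz) Hcut D'3 D'r.
exact: lin_equiv_trans H (lin_equiv_sym H').
Qed.

End Contracted.

(** * Small bridges and the quotient topology *)

Section Topology.
Variable R : realType.

Definition loops_point (t : R) (t0 : 0 <= t) : cones R :=
  existT _ loops_graph (loops_cone t0).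

(** An open set of the moduli space pulls back to an open set of the cone of the graph. It contains
    a ball around the length vector with t = 0, hence the vector with t equal to half the radius. *)
Lemma open_loops_near0 (A : set (M4met R)) : open A ->
  A (\pi_(M4met R) (loops_point (lexx 0)))%qT ->
  exists (t : R) (tp : 0 < t), A (\pi_(M4met R) (loops_point (ltW tp)))%qT.
Proof.
move=> oA A0.
have oA' : open
    ([set l | A (\pi_(M4met R) (existT _ loops_graph l))%qT] : set (cone R loops_graph)).
  exact: ((sigT_openP _).1 oA loops_graph).
have [W oW WE] := oA'.
have W0 : W (loops_len 0).
  suff : (set_val @^-1` W : set (cone R loops_graph)) (loops_cone (lexx 0)) by [].
  by rewrite WE.
have /nbhs_ballP[e /= e0 eW] : nbhs (loops_len 0 : 'rV[R]_(ecount (val loops_graph))) W.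
  exact: open_nbhs_nbhs.
have tp : 0 < e / 2 by lra.
exists (e / 2), tp.
suff : (set_val @^-1` W : set (cone R loops_graph)) (loops_cone (ltW tp)) by rewrite WE.
apply: eW; split=> // i j; rewrite /ball /= !mxE.
by case: ifP => _; rewrite ?subrr ?normr0 // sub0r normrN gtr0_norm //; lra.
Qed.

Lemma isometric_repr (x : cones R) :
  isometric (Gamma_of x) (Gamma_of (repr (\pi_(M4met R) x)%qT)).
Proof.
have /eqmodP : (x = repr (\pi_({eq_quot (isometric_equiv_rel R)}) x)
    %[mod {eq_quot (isometric_equiv_rel R)}])%qT.
  by rewrite reprK.
by move=> /asboolP.
Qed.

End Topology.

Theorem theorem1p1 (R : realType) :
  exists r d : nat, ~ upper_semicontinuous (@dim_BN_M4 R r d).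
Proof.
exists 1%N, 3%N => usc.
(* For the threshold 1, openness would carry the bound on the dimension from t = 0 to some t > 0. *)
have [|t [tp]] := open_loops_near0 (usc 1).
  rewrite /= /dim_BN_M4; apply: (isometric_dim_BN_lt1 (isometric_repr _)) => D D'.
  exact: loops_BN_unique.
rewrite /= /dim_BN_M4; apply: (isometric_dim_BN_ge1 (isometric_repr _)) => n.
exact: loops_deg_infinite.
Qed.
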